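(* Let $n\ge2$ and let $V:\mathbb T^n\times[-1,1]\to\mathbb R^n$ be a Lipschitz vector field such that $V(x,0)\equiv\omega\in\mathcal D(\sigma,C_\omega,n)$ for $x\in\mathbb T^n$. Consider the parametrized ODE $\dot x=V(x,\delta)$, $x\in\mathbb T^n$, and let $\mu_0$ be the unique invariant probability measure for $\delta=0$ (the Lebesgue measure on $\mathbb T^n$). There exists a constant $C=C(\sigma,C_\omega,\|V\|_{W^{1,\infty}})>0$ such that for every $\delta$ (with $\delta\in(0,1]$ if $\sigma>1$, and $\delta\in(0,\frac12]$ if $\sigma=1$) and every probability measure $\mu_\delta$ on $\mathbb T^n$ invariant under the flow of $\dot x=V(x,\delta)$, $$\mathcal W_1(\mu_\delta,\mu_0)\le C\begin{cases}\delta^{\frac1{1+\sigma}}, & \sigma>1,\\ \delta^{\frac12}|\log\delta|, & \sigma=1.\end{cases}$$ Moreover, for $n=2$ and $\omega\in\mathcal D(\sigma,C_\omega,2)$, this is nearly optimal in the following sense. If $\sigma_*(\omega)>1$ and $1<r<\sigma_*(\omega)$, or if $\sigma_*(\omega)=1$, there exist a sequence $\delta_j>0$ with $\delta_j\to0$, vector fields $V(\cdot,\delta_j)$ on $\mathbb T^2$ (belonging to a Lipschitz family $V:\mathbb T^2\times[-1,1]\to\mathbb R^2$ with $V(x,0)\equiv\omega$ for $x\in\mathbb T^2$), and probability measures $\mu_{\delta_j}$ invariant under the flow of $\dot x=V(x,\delta_j)$, such that for all $j$ $$\mathcal W_1(\mu_{\delta_j},\mu_0)\ge C'\begin{cases}\delta_j^{\frac1{1+r}},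 & \sigma_*(\omega)>r>1,\\ \delta_j^{\frac12}, & \sigma_*(\omega)=1,\end{cases}$$ where $C'=C'(\sigma,C_\omega)>0$ is a uniform constant.
   Context: $\mathbb T^n=\mathbb R^n/\mathbb Z^n$, with Euclidean norm $|\cdot|$. Diophantine class: for $\sigma>0$, $C_\omega>0$, $\mathcal D(\sigma,C_\omega,n)$ is the set of $\omega\in\mathbb R^n$ with $|k\cdot\omega|\ge C_\omega|k|^{-\sigma}$ for all $k\in\mathbb Z^n\setminus\{0\}$ (nonempty only if $\sigma\ge n-1$). For $\omega\in\mathbb R^2$, $\sigma_*(\omega):=\inf\{\sigma>0:\ \omega\in\mathcal D(\sigma,C_\sigma,2)\text{ for some }C_\sigma>0\}$. A probability measure $\mu$ on $\mathbb T^n$ is invariant under a flow $\phi^t$ if $\int f\circ\phi^t\,d\mu=\int f\,d\mu$ for all $f\in C(\mathbb T^n)$, $t\in\mathbb R$. 1-Wasserstein distance: $\mathcal W_1(\mu,\nu):=\sup\{|\int_{\mathbb T^n}f\,d\mu-\int_{\mathbb T^n}f\,d\nu|:\ f\in\mathrm{Lip}(\mathbb T^n,\mathbb R),\ \|\nabla f\|_{L^\infty}\le1\}$. *)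

(* Defs.v *)
From HB Require Import structures.
From mathcomp Require Import all_boot all_order all_algebra.
From mathcomp Require Import all_classical all_reals all_analysis.
From mathcomp Require Import measurable_realfun ess_sup_inf.

Set Implicit Arguments.
Unset Strict Implicit.
Unset Printing Implicit Defensive.

Import Order.TTheory GRing.Theory Num.Theory.
Import numFieldNormedType.Exports.

Local Open Scope classical_set_scope.
Local Open Scope ring_scope.

(* The norm of the library on 'rV[R]_n is the sup norm; every quantitative
   statement below uses the Euclidean norm instead. *)
Definition enorm (R : realType) (n : nat) (x : 'rV[R]_n) : R :=
  Num.sqrt (\sum_i (x 0 i) ^+ 2).

Section torus_def.
Context (R : realType) (n : nat).

Definition torus_rel (x y : 'rV[R]_n) : bool :=
  [forall i, x 0 i - y 0 i \is a Num.int].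

Lemma torus_rel_refl : reflexive torus_rel.
Proof. by move=> x; apply/forallP => i; rewrite subrr. Qed.

Lemma torus_rel_sym : symmetric torus_rel.
Proof.
by move=> x y; apply/forallP/forallP => H i; rewrite -opprB rpredN.
Qed.

Lemma torus_rel_trans : transitive torus_rel.
Proof.
move=> y x z /forallP xy /forallP yz; apply/forallP => i.
by rewrite -(subrK (y 0 i) (x 0 i)) -addrA rpredD.
Qed.

Canonical torus_equiv :=
  EquivRel torus_rel torus_rel_refl torus_rel_sym torus_rel_trans.

(* R^n / Z^n with the quotient topology. *)
Definition torus : Type := quotient_topology {eq_quot torus_equiv}%qT.

HB.instance Definition _ := PointedTopological.on torus.

Definition torus_proj (x : 'rV[R]_n) : torus :=
  (\pi_(quotient_topology {eq_quot torus_equiv}) x)%qT.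

Definition torus_repr (p : torus) : 'rV[R]_n :=
  repr (p : quotient_topology {eq_quot torus_equiv}%qT).

End torus_def.

Definition torus_open (R : realType) (n : nat) : set (set (torus R n)) := open.

(* Borel sigma-algebra of the torus. *)
HB.instance Definition _ (R : realType) (n : nat) :=
  @isMeasurable.Build (sigma_display (@torus_open R n)) (torus R n)
    <<s @torus_open R n >> (@sigma_algebra0 _ setT (@torus_open R n))
    (@sigma_algebraC _ (@torus_open R n))
    (@sigma_algebra_bigcup _ setT (@torus_open R n)).

Section product_probability.
Context (R : realType) d1 d2 (T1 : measurableType d1) (T2 : measurableType d2).
Context (P : probability T1 R) (Q : probability T2 R).

Definition product_prob : set (T1 * T2) -> \bar R := (P \x Q)%E.

HB.instance Definition _ := Measure.on product_prob.

Let product_prob_setT : product_prob setT = 1%E.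
Proof.
rewrite /product_prob -setXTT product_measure1E//.
by rewrite -[RHS]mule1; congr (_ * _)%E; exact: probability_setT.
Qed.

HB.instance Definition _ :=
  Measure_isProbability.Build _ _ _ product_prob product_prob_setT.

End product_probability.

Section lebesgue_torus_def.
Context (R : realType).

Definition tuple_cons n (x : measurableTypeR R * n.-tuple (measurableTypeR R)) :
  n.+1.-tuple (measurableTypeR R) := [tuple of x.1 :: x.2].

Lemma measurable_tuple_cons n : measurable_fun [set: _] (@tuple_cons n).
Proof. exact: measurable_cons. Qed.

HB.instance Definition _ n :=
  isMeasurableFun.Build _ _ _ _ (@tuple_cons n) (@measurable_tuple_cons n).

(* Lebesgue measure on the unit cube [0,1]^n. *)
Fixpoint cube_prob n : probability (n.-tuple (measurableTypeR R)) R :=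
  match n with
  | 0 => dirac [tuple]
  | n'.+1 =>
      distribution (product_prob (uniform_prob (@ltr01 R)) (cube_prob n'))
        (@tuple_cons n')
  end.

Definition tuple_torus n (t : n.-tuple (measurableTypeR R)) : torus R n :=
  torus_proj (\row_i tnth t i).

Lemma measurable_row_open n (W : set 'rV[R]_n) : open W ->
  measurable [set t : n.-tuple (measurableTypeR R) | W (\row_i tnth t i)].
Proof.
move=> oW.
pose B (q : 'rV[rat]_n * nat) : set (n.-tuple (measurableTypeR R)) :=
  \bigcap_(i in [set: 'I_n])
    [set t | ball (ratr (q.1 0 i) : R) (q.2.+1%:R^-1) (tnth t i : R)].
pose D := [set q : 'rV[rat]_n * nat |
  B q `<=` [set t | W (\row_i tnth t i)]].
have -> : [set t : n.-tuple (measurableTypeR R) | W (\row_i tnth t i)] =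
    \bigcup_(q in D) B q.
  apply/seteqP; split; last by move=> t [q Dq Bt]; exact: Dq.
  move=> t /= Wt.
  have : nbhs (\row_i tnth t i : 'rV[R]_n) W by exact: open_nbhs_nbhs.
  move=> /nbhs_ballP[e /= e0 eW].
  have [N Ne] : exists N : nat, (N.+1%:R^-1 : R) < e / 2.
    have /ltr_add_invr[k] : (0 : R) < e / 2 by rewrite divr_gt0.
    by rewrite add0r => ?; exists k.
  have N0 : (0 : R) < N.+1%:R^-1 by rewrite invr_gt0 ltr0n.
  have /boolp.choice[q qt] : forall i : 'I_n, exists q : rat,
      ball (ratr q : R) (N.+1%:R^-1) (tnth t i : R).
    move=> i; have : (tnth t i : R) < (tnth t i : R) + N.+1%:R^-1.
      by rewrite ltrDl.
    move=> /rat_in_itvoo[x]; rewrite in_itv/= => /andP[x1 x2]; exists x.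
    by rewrite /ball/= gtr0_norm ?subr_gt0// ltrBlDl.
  exists (\row_i q i, N); last by move=> i _ /=; rewrite mxE; exact: qt.
  move=> s Bs /=; apply: eW; split=> // i j; rewrite !mxE.
  have /= := Bs j I; rewrite mxE => sj.
  apply: (@ball_splitr _ _ (ratr (q j) : R)).
    exact: le_ball (ltW Ne) _ (qt j).
  exact: le_ball (ltW Ne) _ sj.
rewrite bigcup_mkcond; apply: countable_bigcupT_measurable => [|q]; first exact: countableP.
case: ifP => _; last exact: measurable0.
apply: fin_bigcap_measurable; first exact: finite_finset.
move=> i _.
rewrite -[X in measurable X]setTI; apply: (measurable_tnth i) => //.
exact: measurable_ball.
Qed.

Lemma measurable_tuple_torus n : measurable_fun [set: _] (@tuple_torus n).
Proof.
apply: (@measurability _ _ _ _ _ _ (@torus_open R n)) => //.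
move=> _ [U oU <-]; rewrite setTI.
exact: (@measurable_row_open n (@torus_proj R n @^-1` U)).
Qed.

HB.instance Definition _ n :=
  isMeasurableFun.Build _ _ _ _ (@tuple_torus n) (@measurable_tuple_torus n).

Definition lebesgue_torus n : probability (torus R n) R :=
  distribution (cube_prob n) (@tuple_torus n).

End lebesgue_torus_def.

Section sobolev_norms.
Context (R : realType) (n : nat).

(* A function on the torus, seen as a Z^n-periodic function on R^n. *)
Definition lift (T : Type) (f : torus R n -> T) (x : 'rV[R]_n) : T :=
  f (torus_proj x).

Definition lipschitz_torus (f : torus R n -> R) : Prop := lipschitz (lift f).

(* Euclidean norm of the gradient. The value +oo at points of
   non-differentiability is immaterial for the essential supremum of a
   Lipschitz function: by Rademacher's theorem these points form a null set. *)
Definition grad_norm (f : torus R n -> R) (p : torus R n) : \bar R :=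
  if `[< differentiable (lift f) (torus_repr p) >]
  then (enorm (\row_i 'D_(delta_mx 0 i) (lift f) (torus_repr p)))%:E
  else +oo%E.

Definition grad_Linfty (f : torus R n -> R) : \bar R :=
  ess_sup (lebesgue_torus R n) (grad_norm f).

(* Vector fields on T^n x [-1, 1] are total functions of the parameter, whose
   values are only ever constrained or used for parameters in [-1, 1]. *)
Definition lift_field (V : torus R n -> R -> 'rV[R]_n)
  (z : 'rV[R]_n * R) : 'rV[R]_n := V (torus_proj z.1) z.2.

Definition lipschitz_field (V : torus R n -> R -> 'rV[R]_n) : Prop :=
  [lipschitz lift_field V z | z in [set z | -1 <= z.2 <= 1]].

(* Frobenius norm of the derivative of V in (x, delta), with the same
   convention as for grad_norm. *)
Definition jacobian_norm (V : torus R n -> R -> 'rV[R]_n)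
    (z : torus R n * R) : \bar R :=
  let z' := (torus_repr z.1, z.2) in
  if `[< differentiable (lift_field V) z' >]
  then (Num.sqrt
    (\sum_i enorm ('D_(delta_mx 0 i, 0) (lift_field V) z') ^+ 2
     + enorm ('D_(0, 1) (lift_field V) z') ^+ 2))%:E
  else +oo%E.

Lemma ltrN11 : (-1 : R) < 1.
Proof. exact: lt_trans (ltrN10 _) ltr01. Qed.

(* Normalized Lebesgue measure on T^n x [-1, 1]; only its null sets matter. *)
Definition lebesgue_torus_itv :
    probability (torus R n * measurableTypeR R)%type R :=
  product_prob (lebesgue_torus R n) (uniform_prob ltrN11).

Definition W1infty_norm (V : torus R n -> R -> 'rV[R]_n) : \bar R :=
  (ess_sup lebesgue_torus_itv (fun z => (enorm (V z.1 z.2))%:E)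
   + ess_sup lebesgue_torus_itv (jacobian_norm V))%E.

End sobolev_norms.

Section dynamics.
Context (R : realType) (n : nat).

(* phi is the flow of dx/dt = W(x) on the torus: every orbit lifts to a
   solution of the corresponding ODE in R^n. *)
Definition is_flow (W : torus R n -> 'rV[R]_n)
    (phi : R -> torus R n -> torus R n) : Prop :=
  forall p, exists g : R -> 'rV[R]_n,
    [/\ torus_proj (g 0) = p,
        forall t, phi t p = torus_proj (g t) &
        forall t, is_derive t (1 : R) g (W (torus_proj (g t)))].

(* The flow of a Lipschitz field exists and is unique (Picard-Lindelof), so
   that the existential quantifier over phi denotes the flow of W. *)
Definition flow_invariant (W : torus R n -> 'rV[R]_n)
    (mu : probability (torus R n) R) : Prop :=
  exists2 phi, is_flow W phi &
    forall (f : torus R n -> R) (t : R), continuous f ->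
      \int[mu]_p f (phi t p) = \int[mu]_p f p.

Definition unique_flow_invariant (W : torus R n -> 'rV[R]_n)
    (mu0 : probability (torus R n) R) : Prop :=
  flow_invariant W mu0 /\
  forall mu : probability (torus R n) R, flow_invariant W mu ->
    forall A, measurable A -> mu A = mu0 A.

Definition wasserstein1 (mu nu : probability (torus R n) R) : \bar R :=
  ereal_sup [set `|\int[mu]_p f p - \int[nu]_p f p|%:E | f in
    [set f : torus R n -> R |
      lipschitz_torus f /\ (grad_Linfty f <= 1)%E]].

End dynamics.

Section diophantine.
Context (R : realType).

Definition dotz (n : nat) (k : 'rV[int]_n) (w : 'rV[R]_n) : R :=
  \sum_i (k 0 i)%:~R * w 0 i.

Definition diophantine (sigma c : R) (n : nat) : set 'rV[R]_n :=
  [set w | forall k : 'rV[int]_n, k != 0 ->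
    c * (enorm (map_mx intr k : 'rV[R]_n)) `^ (- sigma) <= `|dotz k w|].

Definition sigma_star (w : 'rV[R]_2) : R :=
  inf [set sigma | 0 < sigma /\ exists2 c, 0 < c & diophantine sigma c w].

(* Some Lipschitz family through the constant field w has, along parameters
   tending to 0, invariant measures at distance at least c * delta `^ a from
   the Lebesgue measure. *)
Definition lower_rate (w : 'rV[R]_2) (c a : R) : Prop :=
  exists (V : torus R 2 -> R -> 'rV[R]_2) (delta : nat -> R)
      (mu : nat -> probability (torus R 2) R),
    [/\ lipschitz_field V,
        forall x, V x 0 = w,
        (forall j, 0 < delta j <= 1) /\ delta j @[j --> \oo] --> (0 : R),
        forall j, flow_invariant (fun x => V x (delta j)) (mu j) &
        forall j, ((c * delta j `^ a)%:E
                   <= wasserstein1 (mu j) (lebesgue_torus R 2))%E].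

End diophantine.

(* Main.v *)
From HB Require Import structures.
From mathcomp Require Import all_boot all_order all_algebra.
From mathcomp Require Import all_classical all_reals all_analysis.
From mathcomp Require Import measurable_realfun ess_sup_inf.
From mathcomp Require Import ring lra zify complex.
Require Import Defs.

(** The upper bound compares an invariant measure [mu] of [V(., delta)] with the
    Lebesgue measure through Fourier coefficients. Along an orbit the character of
    frequency [k] rotates at speed [2 pi (k . V)], which is within [O(delta |k|)] of
    [2 pi (k . w)]; integrating its time derivative against [mu] gives
    [|k . w| |mu^(k)| <= C delta |k|] (lemmas [cos_mode_bound] and
    [sin_mode_bound]). A Lipschitz function [f] is approximated within [O(1 / N)] by
    a trigonometric polynomial of degree [N] ([trig_approxP]), and by Cauchy-Schwarz
    the nonconstant part of this polynomial has [mu]-mean at most [delta] times the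
    square root of [sum |k|^2 |f^(k)|^2] times that of [sum (k . w)^(-2)]. The first
    sum is bounded by Bessel's inequality for the increments of [f]. In the second
    one the numbers [k . w] are separated by a multiple of [N^(- sigma)], as
    differences of frequencies are again frequencies, so the sum is
    [O(N^(2 sigma))] ([sum_separated], [pairing_bound]). The total error
    [1 / N + delta N^sigma] is least for [N = delta^(- 1 / (1 + sigma))]. This holds
    for every [sigma]; for [sigma = 1] the logarithm is bounded below.

    The Fourier analysis is finite: the polynomial is a discrete convolution of
    samples of [f] on a grid with a positive kernel. It shows in passing that a
    measure is determined by its Fourier coefficients ([fourier_unique]), which
    yields the invariance of the Lebesgue measure under translations and the unique
    ergodicity at [delta = 0].

    The hypotheses on [f] and [V] bound derivatives only almost everywhere. They are
    turned into Lipschitz bounds by averaging over starting points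
    ([ae_derivative_bound]): the null sets of bad points vary with time, and are
    invisible to the integral over the starting points.

    For the lower bound, if [|k . w| <= 4 |w| |k|^(-r)], a constant field at distance
    [O(|k|^(-1-r))] from [w] is orthogonal to [k]. Its orbits are closed curves on
    which the character of frequency [k] is constant, so the uniform measure on such
    a curve is at distance at least [1 / (2 pi |k|)] from the Lebesgue measure
    ([lower_rate_of_resonances]). Arbitrarily large such [k] exist for
    [r < sigma_star w] by definition, and for [r = 1] by Dirichlet's theorem. *)

Set Implicit Arguments.
Unset Strict Implicit.
Unset Printing Implicit Defensive.
Import Order.TTheory GRing.Theory Num.Theory.
Import numFieldNormedType.Exports.
Local Open Scope classical_set_scope.
Local Open Scope ring_scope.

(** * Complex exponentials *)

Section ComplexExponential.
Context {R : realType}.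

Definition cis (t : R) : R[i] := (cos (2 * pi * t) +i* sin (2 * pi * t))%C.

Definition normsq (z : R[i]) : R := complex.Re z ^+ 2 + complex.Im z ^+ 2.

Lemma normsqE (z : R[i]) : ((normsq z)%:C = z * conjc z)%C.
Proof.
by case: z => a b; rewrite /normsq /=; apply/eqP; rewrite eq_complex /=; apply/andP; split; apply/eqP; ring.
Qed.

Lemma normsq_ge0 z : 0 <= normsq z.
Proof. by rewrite addr_ge0 ?sqr_ge0. Qed.

Lemma normsqM z w : normsq (z * w) = normsq z * normsq w.
Proof. by case: z => a b; case: w => c d; rewrite /normsq /=; ring. Qed.

Lemma cis0 : cis 0 = 1.
Proof. by rewrite /cis mulr0 cos0 sin0. Qed.

Lemma cisD s t : cis (s + t) = cis s * cis t.
Proof. by rewrite /cis mulrDr cosD sinD; simpc; congr (_ +i* _)%C; ring. Qed.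

Lemma cisN t : cis (- t) = conjc (cis t).
Proof. by rewrite /cis mulrN cosN sinN. Qed.

Lemma cisMn t n : cis (t *+ n) = cis t ^+ n.
Proof. by elim: n => [|n IH]; rewrite ?mulr0n ?cis0// mulrS exprS cisD IH. Qed.

Lemma cis1 : cis 1 = 1.
Proof. by rewrite /cis mulr1 mulrC mulr_natr cos2pi sin2pi. Qed.

Lemma cis_int (t : R) : t \is a Num.int -> cis t = 1.
Proof.
move=> /intrP[k ->]; case: k => n.
  by rewrite -pmulrn cisMn cis1 expr1n.
by rewrite NegzE mulrNz cisN -pmulrn cisMn cis1 expr1n conjc1.
Qed.

Lemma normsq_cis t : normsq (cis t) = 1.
Proof. exact: cos2Dsin2. Qed.

(** With [abs_le_sinpi], the multiplier [cis t - 1] of a translation by [t] is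
    comparable with the distance from [t] to the integers. *)
Lemma normsq_cisB1 t : normsq (cis t - 1) = 4 * sin (pi * t) ^+ 2.
Proof.
have -> : cis t - 1 = ((cos (2 * pi * t) - 1) +i* sin (2 * pi * t))%C.
  by rewrite /cis; simpc.
rewrite /normsq /= (_ : 2 * pi * t = (pi * t) *+ 2); last by rewrite mulr2n; ring.
rewrite cos_mulr2n sin_mulr2n -(mulr_natl (cos _ ^+ 2)) -(mulr_natl (_ * _)).
have := cos2Dsin2 (pi * t); set c := cos _; set s := sin _ => /eqP.
rewrite eq_sym -subr_eq => /eqP c2.
have -> : (2 * c ^+ 2 - 1 - 1) ^+ 2 + (2 * (c * s)) ^+ 2 =
  4 * (c ^+ 2 - 1) ^+ 2 + 4 * c ^+ 2 * s ^+ 2 by ring.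
by rewrite -c2; ring.
Qed.

(** Half of the slope given by Jordan's inequality is enough; it follows from
    the mean value theorem on [[0, pi / 4]] and the duplication formula. *)
Lemma abs_le_sinpi (y : R) : `|y| <= 1 / 2 -> `|y| <= `|sin (pi * y)|.
Proof.
wlog y0 : y / 0 <= y => [hw|].
  case: (leP 0 y) => [/hw //|/ltW y0 yh].
  rewrite -normrN -[leRHS]normrN -sinN -mulrN; apply: hw; rewrite ?oppr_ge0//.
  by rewrite normrN.
rewrite (ger0_norm y0) => yh.
have p0 := @pi_gt0 R; have p2 := @pi_ge2 R.
set a := pi * y / 2.
have a0 : 0 <= a by rewrite /a; nra.
have api : a <= pi / 4 by rewrite /a; nra.
have c4 : cos (pi / 4) ^+ 2 = 1 / 2 :> R.
  have := cos_mulr2n (pi / 4 : R).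
  have -> : (pi / 4) *+ 2 = pi / 2 :> R by rewrite -mulr_natr; field.
  by rewrite cos_pihalf -mulr_natl => H; lra.
have c40 : 0 < cos (pi / 4) :> R by apply: cos_gt0_pihalf; apply/andP; split; lra.
have cle x : 0 <= x <= pi / 4 -> cos (pi / 4) <= cos x :> R.
  move=> /andP[x0 x1]; have [->//|ne] := eqVneq x (pi / 4).
  have x2 : x < pi / 4 by rewrite lt_neqAle ne.
  by apply: ltW; rewrite ltr_cos // in_itv /=; apply/andP; split; lra.
have sa : a * cos (pi / 4) <= sin a.
  have [->|an0] := eqVneq a 0; first by rewrite mul0r sin0.
  have ap : 0 < a by rewrite lt_neqAle eq_sym an0.
  have [c] := MVT ap (fun x _ => is_derive_sin x)
    (continuous_subspaceT (@continuous_sin R)).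
  rewrite in_itv /= => /andP[c0 ca]; rewrite sin0 !subr0 => ->.
  rewrite mulrC ler_wpM2r// cle// (ltW c0)/=; apply: le_trans api; exact: ltW.
have -> : pi * y = a *+ 2 by rewrite /a -mulr_natr; field.
rewrite sin_mulr2n.
have ca := cle a; rewrite a0 api in ca; have {}ca := ca isT.
have sa0 : 0 <= sin a by apply: le_trans sa; rewrite mulr_ge0// ltW.
apply: le_trans (ler_norm _).
have e1 : a * cos (pi / 4) * cos (pi / 4) <= cos a * sin a.
  rewrite mulrC; apply: ler_pM => //; [exact: ltW|by rewrite mulr_ge0// ltW].
have e2 : a * cos (pi / 4) * cos (pi / 4) = a / 2.
  by rewrite -mulrA -expr2 c4; field.
rewrite -mulr_natl; have : y <= a by rewrite /a; nra.
lra.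
Qed.

Lemma sinB_le (a b : R) : `|sin a - sin b| <= `|a - b|.
Proof.
wlog ab : a b / b < a => [hw|].
  case: (ltgtP b a) => [/hw //|/hw|->]; last by rewrite !subrr.
  by rewrite distrC (distrC b).
have [c _ ->] := MVT ab (fun x _ => is_derive_sin x)
  (continuous_subspaceT (@continuous_sin R)).
by rewrite normrM ler_piMl// cos_max.
Qed.

(** The summands are the powers of an [m]-th root of unity that is not [1]. *)
Lemma sum_roots_unity (m : nat) (d : int) : (`|d| < m)%N -> d != 0 ->
  \sum_(j < m) cis (d%:~R * (j%:R / m%:R)) = 0.
Proof.
move=> dm d0.
have m0 : (m%:R : R) != 0 by rewrite pnatr_eq0; case: m dm.
set z := cis (d%:~R / m%:R).
have -> : \sum_(j < m) cis (d%:~R * (j%:R / m%:R)) = \sum_(j < m) z ^+ j.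
  by apply: eq_bigr => j _; rewrite /z -cisMn -(mulr_natr (_ / _)); congr cis; field.
have zm : z ^+ m = 1.
  by rewrite /z -cisMn -(mulr_natr (_ / _)) mulfVK// cis_int// intr_int.
suff zn1 : z - 1 != 0.
  by apply: (mulfI zn1); rewrite -subrX1 zm subrr mulr0.
apply/eqP => z1.
have := normsq_cisB1 (d%:~R / m%:R); rewrite -/z z1 /normsq /= expr0n addr0 => /esym/eqP.
rewrite mulf_eq0 pnatr_eq0 /= expf_eq0 /= => /eqP s0.
have : 0 < `|sin (pi * (d%:~R / m%:R))| :> R; last by rewrite s0 normr0 ltxx.
have e : `|d%:~R| = `|d|%N%:R :> R by rewrite -intr_norm -abszE.
have mp : 0 < m%:R :> R by rewrite lt_neqAle eq_sym m0 ler0n.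
have sg x : `|sin (pi * x)| = `|sin (pi * `|x|)| :> R.
  by case: (ger0P x) => // _; rewrite mulrN sinN normrN.
rewrite sg normrM normfV (ger0_norm (ler0n _ _)) e.
rewrite normr_gt0 gt_eqF//.
apply: sin_gt0_pi; apply/andP; split.
  by rewrite mulr_gt0 ?pi_gt0// divr_gt0// ltr0n absz_gt0.
by rewrite gtr_pMr ?pi_gt0// ltr_pdivrMr// mul1r ltr_nat.
Qed.

End ComplexExponential.

(** * Bessel's inequality on a grid *)

Section Bessel.
Context {R : realType} {J L : finType} (N : R) (phi : L -> J -> R[i]).
Hypothesis phi_orth : forall l l',
  \sum_j phi l j * conjc (phi l' j) = (if l == l' then N%:C else 0)%C.

Lemma normsq_sum (I : finType) (F : I -> R) :
  ((\sum_i F i)%:C = \sum_i (F i)%:C)%C.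
Proof. exact: (rmorph_sum (real_complex R)). Qed.

Lemma conjc_sum (I : finType) (F : I -> R[i]) :
  conjc (\sum_i F i) = \sum_i conjc (F i).
Proof. exact: (rmorph_sum (@conjc R)). Qed.

Lemma conjcM (z w : R[i]) : conjc (z * w) = conjc z * conjc w.
Proof. exact: (rmorphM (@conjc R)). Qed.

Lemma conjcB (z w : R[i]) : conjc (z - w) = conjc z - conjc w.
Proof. exact: (rmorphB (@conjc R)). Qed.

(** The cross terms vanish by orthogonality of the family [phi]. *)
Lemma parseval (b : L -> R[i]) :
  \sum_j normsq (\sum_l b l * phi l j) = N * \sum_l normsq (b l).
Proof.
apply: (@complexI R); rewrite normsq_sum rmorphM /= normsq_sum mulr_sumr.
under eq_bigr => j _ do rewrite normsqE conjc_sum big_distrlr /=.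
rewrite exchange_big /=; apply: eq_bigr => l _.
rewrite exchange_big /= (bigD1 l)//= [X in _ + X]big1 ?addr0.
  under eq_bigr => j _ do rewrite conjcM mulrACA.
  by rewrite -mulr_sumr phi_orth eqxx normsqE mulrC.
move=> l' ll'; under eq_bigr => j _ do rewrite conjcM mulrACA.
by rewrite -mulr_sumr phi_orth eq_sym (negbTE ll') mulr0.
Qed.

(** Expand the square norm of the difference of [g] and its projection onto the
    span of the family. *)
Lemma bessel (g : J -> R[i]) : 0 < N ->
  \sum_l normsq (\sum_j g j * conjc (phi l j)) <= N * \sum_j normsq (g j).
Proof.
move=> N0; pose c l := \sum_j g j * conjc (phi l j).
pose p j := \sum_l ((N^-1)%:C%C * c l) * phi l j.
have normsqZ (a : R) z : normsq (a%:C%C * z) = a ^+ 2 * normsq z.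
  by rewrite normsqM /normsq /=; ring.
have pars : \sum_j normsq (p j) = N^-1 * \sum_l normsq (c l).
  rewrite parseval; under eq_bigr => l _ do rewrite normsqZ.
  by rewrite -mulr_sumr; field; rewrite gt_eqF.
have cross : \sum_j g j * conjc (p j) = ((N^-1 * \sum_l normsq (c l))%:C)%C.
  rewrite rmorphM /= normsq_sum mulr_sumr.
  under eq_bigr => j _ do rewrite conjc_sum mulr_sumr.
  rewrite exchange_big /=; apply: eq_bigr => l _.
  under eq_bigr => j _ do rewrite !conjcM conjc_real mulrCA.
  by rewrite -mulr_sumr -/(c l) normsqE -mulrA (mulrC (conjc _)).
have crossc : \sum_j conjc (g j) * p j = ((N^-1 * \sum_l normsq (c l))%:C)%C.
  apply: (can_inj (@conjcK R)); rewrite conjc_real -cross conjc_sum.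
  by apply: eq_bigr => j _; rewrite conjcM conjcK.
have : 0 <= \sum_j normsq (g j - p j) by apply: sumr_ge0 => j _; exact: normsq_ge0.
suff -> : \sum_j normsq (g j - p j) = \sum_j normsq (g j) - N^-1 * \sum_l normsq (c l).
  by rewrite subr_ge0 ler_pdivrMl.
apply: (@complexI R); rewrite rmorphB /= !normsq_sum.
rewrite -[X in _ - X]addr0 -[X in _ - (_ + X)](subrr (N^-1 * \sum_l normsq (c l))%:C%C).
rewrite -[X in _ + (X - _)]cross -[X in X + (_ - _)]crossc -pars normsq_sum.
rewrite -sumrB -big_split /= -sumrB; apply: eq_bigr => j _.
by rewrite !normsqE conjcB; ring.
Qed.

End Bessel.

Section Grid.
Context {R : realType}.

Lemma dotzDl n (k l : 'rV[int]_n) (x : 'rV[R]_n) :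
  dotz (k + l) x = dotz k x + dotz l x.
Proof.
by rewrite /dotz -big_split /=; apply: eq_bigr => i _; rewrite mxE rmorphD mulrDl.
Qed.

Lemma dotzNl n (k : 'rV[int]_n) (x : 'rV[R]_n) : dotz (- k) x = - dotz k x.
Proof.
by rewrite /dotz -sumrN; apply: eq_bigr => i _; rewrite mxE rmorphN mulNr.
Qed.

Lemma dotzDr n (k : 'rV[int]_n) (x y : 'rV[R]_n) :
  dotz k (x + y) = dotz k x + dotz k y.
Proof.
by rewrite /dotz -big_split /=; apply: eq_bigr => i _; rewrite mxE mulrDr.
Qed.

Lemma dotzZr n (k : 'rV[int]_n) (x : 'rV[R]_n) a : dotz k (a *: x) = a * dotz k x.
Proof.
by rewrite /dotz mulr_sumr; apply: eq_bigr => i _; rewrite mxE mulrCA.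
Qed.

Lemma dotzNr n (k : 'rV[int]_n) (x : 'rV[R]_n) : dotz k (- x) = - dotz k x.
Proof. by rewrite -scaleN1r dotzZr mulN1r. Qed.

Lemma dotz0l n (x : 'rV[R]_n) : dotz 0 x = 0.
Proof. by rewrite /dotz big1// => i _; rewrite mxE mul0r. Qed.

Lemma dotz_delta n (k : 'rV[int]_n) i : dotz k (delta_mx 0 i : 'rV[R]_n) = (k 0 i)%:~R.
Proof.
rewrite /dotz (bigD1 i)//= mxE !eqxx mulr1 big1 ?addr0// => j ji.
by rewrite mxE (negbTE ji) andbF mulr0.
Qed.

Lemma cis_prod n (k : 'rV[int]_n) (x : 'rV[R]_n) :
  cis (dotz k x) = \prod_i cis ((k 0 i)%:~R * x 0 i).
Proof. by rewrite /dotz; elim/big_rec2: _ => [|i y1 y2 _ <-]; rewrite ?cis0// cisD. Qed.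

Definition grid n m (j : {ffun 'I_n -> 'I_m}) : 'rV[R]_n :=
  \row_i ((j i)%:R / m%:R).

Definition freq n M (l l' : {ffun 'I_n -> 'I_M}) : 'rV[int]_n :=
  \row_i ((l i)%:Z - (l' i)%:Z).

Lemma freq_lt n M (l l' : {ffun 'I_n -> 'I_M}) i : (`|freq l l' 0%R i|%N < M)%N.
Proof. by rewrite mxE; have := ltn_ord (l i); have := ltn_ord (l' i); lia. Qed.

Lemma freq_neq0 n M (l l' : {ffun 'I_n -> 'I_M}) : l != l' -> freq l l' != 0.
Proof.
apply: contra_neq => e; apply/ffunP => i; apply: val_inj => /=.
by have := congr1 (fun v : 'rV[int]_n => v 0 i) e; rewrite !mxE; lia.
Qed.

(** All frequencies are differences of indices of one box, so a difference of
    two of them is again such a difference. *)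
Lemma freqD n M (l l' l'' : {ffun 'I_n -> 'I_M}) :
  freq l l' - freq l l'' = freq l'' l'.
Proof. by apply/rowP => i; rewrite !mxE; ring. Qed.

Lemma freqN n M (l l' : {ffun 'I_n -> 'I_M}) : - freq l l' = freq l' l.
Proof. by apply/rowP => i; rewrite !mxE; ring. Qed.

Lemma sum_grid n m (k : 'rV[int]_n) : (forall i, (`|k 0%R i|%N < m)%N) -> k != 0 ->
  \sum_(j : {ffun 'I_n -> 'I_m}) cis (dotz k (grid j)) = 0.
Proof.
move=> km k0.
under eq_bigr => j _ do rewrite cis_prod.
under eq_bigr => j _ do under eq_bigr => i _ do rewrite mxE.
rewrite -(bigA_distr_bigA (fun i (j : 'I_m) => cis ((k 0 i)%:~R * (j%:R / m%:R)))).
have [i ki] : exists i, k 0 i != 0.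
  apply/existsP; apply: contraNT k0; rewrite negb_exists => /forallP h.
  by apply/eqP/rowP => i; rewrite mxE; have := h i; rewrite negbK => /eqP.
by rewrite (bigD1 i)//= sum_roots_unity// mul0r.
Qed.

(** Characters whose frequencies differ by less than [m] in each coordinate stay
    distinct on the grid of mesh [1 / m]. *)
Lemma grid_orth n m M (Mm : (M <= m)%N) (l0 l l' : {ffun 'I_n -> 'I_M}) :
  \sum_(j : {ffun 'I_n -> 'I_m}) cis (dotz (freq l0 l) (grid j)) *
     conjc (cis (dotz (freq l0 l') (grid j))) =
  (if l == l' then (m%:R ^+ n : R)%:C else 0)%C.
Proof.
under eq_bigr => j _ do rewrite -cisN -cisD -dotzNl -dotzDl freqD.
case: eqVneq => [->|ll'].
  have -> : freq l' l' = 0 by apply/rowP => i; rewrite !mxE subrr.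
  under eq_bigr => j _ do rewrite dotz0l cis0.
  rewrite sumr_const card_ffun !card_ord.
  by rewrite -natrX (rmorph_nat (real_complex R)).
apply: sum_grid; last by rewrite freq_neq0// eq_sym.
by move=> i; apply: leq_trans (freq_lt _ _ _) Mm.
Qed.

End Grid.

(** * The Fejer-Korovkin kernel *)

Section Kernel.
Context {R : realType} (M : nat).
Hypothesis M2 : (2 <= M)%N.

(** The sine makes the ratio of the energy [sum (sine_weight l - sine_weight l.+1) ^+ 2] to [sum
    sine_weight l ^+ 2] of order [M ^- 2], as small as possible. *)
Definition sine_weight (l : nat) : R := sin (pi * (l%:R / M%:R)).

Let MR0 : (M%:R : R) != 0.
Proof. by rewrite pnatr_eq0; case: M M2. Qed.

Let MRp : 0 < (M%:R : R).
Proof. by rewrite ltr0n; case: M M2. Qed.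

Lemma sine_weight0 : sine_weight 0 = 0.
Proof. by rewrite /sine_weight mul0r mulr0 sin0. Qed.

Lemma sine_weightM : sine_weight M = 0.
Proof. by rewrite /sine_weight divff// mulr1 sinpi. Qed.

Lemma sine_weight_step l : (sine_weight l - sine_weight l.+1) ^+ 2 <= (pi / M%:R) ^+ 2.
Proof.
rewrite -[leLHS]real_normK ?num_real// ler_sqr ?nnegrE ?divr_ge0 ?pi_ge0//.
apply: le_trans (sinB_le _ _) _; rewrite -mulrBr -mulrBl -natr1.
have -> : pi * ((l%:R - (l%:R + 1)) / M%:R) = - (pi / M%:R) :> R by field.
by rewrite normrN ger0_norm// divr_ge0// pi_ge0.
Qed.

(** The cosines in [sin ^+ 2 = (1 - cos) / 2] sum to zero over the [M]-th roots
    of unity. *)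
Lemma sine_weight_sqr_sum : \sum_(l < M) sine_weight l ^+ 2 = M%:R / 2.
Proof.
have := @sum_roots_unity R M 1 M2 isT.
move=> /(congr1 (@complex.Re R)).
have -> : complex.Re (\sum_(j < M) cis (1%:~R * (j%:R / M%:R)) : R[i]) =
    \sum_(j < M) cos (2 * pi * (j%:R / M%:R)).
  rewrite (raddf_sum (@complex.Re R : Rcomplex R -> R)).
  by apply: eq_bigr => j _; rewrite mul1r.
move=> /= sc.
have e (l : 'I_M) : sine_weight l ^+ 2 = 2^-1 - 2^-1 * cos (2 * pi * (l%:R / M%:R)).
  rewrite /sine_weight sin2cos2.
  have -> : 2 * pi * (l%:R / M%:R) = (pi * (l%:R / M%:R)) *+ 2 :> R.
    by rewrite -(mulr_natl (pi * _)); ring.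
  by rewrite cos_mulr2n -(mulr_natl (cos _ ^+ 2)); field.
rewrite (eq_bigr _ (fun l _ => e l)) big_split /= sumrN -mulr_sumr sc.
by rewrite mulr0 subr0 sumr_const card_ord -(mulr_natr 2^-1) mulrC.
Qed.

Definition trigker (y : R) : R[i] := \sum_(l < M) (sine_weight l)%:C%C * cis (l%:R * y).

(** Summation by parts; there are no boundary terms because the weights vanish
    at [0] and [M]. *)
Lemma trigkerB1 y : (cis y - 1) * trigker y =
  \sum_(l < M) (sine_weight l - sine_weight l.+1)%:C%C * cis (l.+1%:R * y).
Proof.
rewrite mulrBl mul1r /trigker mulr_sumr.
have -> : \sum_(l < M) (sine_weight l)%:C%C * cis (l%:R * y) =
    \sum_(l < M) (sine_weight l.+1)%:C%C * cis (l.+1%:R * y).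
  have h (f : nat -> R[i]) : f 0%N = 0 -> f M = 0 ->
      \sum_(l < M) f l = \sum_(l < M) f l.+1.
    move=> f0 fM; have := erefl (\sum_(l < M.+1) f l).
    by rewrite {1}big_ord_recr big_ord_recl /= f0 fM add0r addr0.
  by apply: (h (fun l => (sine_weight l)%:C%C * cis (l%:R * y))); rewrite ?sine_weight0 ?sine_weightM mul0r.
rewrite -sumrB; apply: eq_bigr => l _.
by rewrite rmorphB /= mulrBl -natr1 mulrDl mul1r cisD; ring.
Qed.

Variable m : nat.
Hypothesis Mm : (M <= m)%N.
Variable x : R.

Let y (j : 'I_m) : R := x - j%:R / m%:R.

(** The offset [x] of the sample points is harmless: it only multiplies the
    characters by constants of modulus one. *)
Lemma line_orth c (l l' : 'I_M) :
  \sum_(j < m) cis ((c + l)%:R * y j) * conjc (cis ((c + l')%:R * y j)) =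
  (if l == l' then (m%:R : R)%:C else 0)%C.
Proof.
under eq_bigr => j _ do rewrite -cisN -cisD.
pose d : int := l'%:Z - l%:Z.
have e (j : 'I_m) : (c + l)%:R * y j - (c + l')%:R * y j =
    - d%:~R * x + d%:~R * (j%:R / m%:R) :> R.
  by rewrite /y /d rmorphB /= -!pmulrn !natrD; ring.
under eq_bigr => j _ do rewrite e cisD.
rewrite -mulr_sumr; case: eqVneq => [ll|ll].
  have d0 : d = 0 by rewrite /d ll subrr.
  under eq_bigr => j _ do rewrite d0 mul0r cis0.
  rewrite sumr_const card_ord d0 oppr0 mul0r cis0 mul1r.
  by rewrite (rmorph_nat (real_complex R)).
rewrite sum_roots_unity ?mulr0// /d.
  have := ltn_ord l; have := ltn_ord l'; lia.
by apply: contra_neq ll => e0; apply: val_inj => /=; lia.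
Qed.

(** Parseval's identity holds for samples because the degree of the kernel is
    less than the number of samples. *)
Lemma trigker_mass : \sum_(j < m) normsq (trigker (y j)) = m%:R * (M%:R / 2).
Proof.
rewrite (parseval (line_orth 0)) -sine_weight_sqr_sum; congr (_ * _).
by apply: eq_bigr => l _; rewrite /normsq /= expr0n addr0.
Qed.

(** Parseval's identity again, applied to the kernel multiplied by [cis y - 1]:
    the second moment is the energy of the weights. *)
Lemma trigker_moment2 :
  \sum_(j < m) sin (pi * y j) ^+ 2 * normsq (trigker (y j)) <= m%:R * 4 / M%:R.
Proof.
have h : \sum_(j < m) 4 * (sin (pi * y j) ^+ 2 * normsq (trigker (y j))) =
    m%:R * \sum_(l < M) (sine_weight l - sine_weight l.+1) ^+ 2.
  under eq_bigr => j _ do rewrite mulrA -normsq_cisB1 -normsqM trigkerB1.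
  rewrite (parseval (line_orth 1)); congr (_ * _).
  by apply: eq_bigr => l _; rewrite /normsq /= expr0n addr0.
have b : \sum_(l < M) (sine_weight l - sine_weight l.+1) ^+ 2 <= 16 / M%:R.
  apply: (@le_trans _ _ (\sum_(l < M) (4 / M%:R) ^+ 2)).
    apply: ler_sum => l _; apply: le_trans (sine_weight_step l) _.
    rewrite ler_sqr ?nnegrE ?divr_ge0 ?pi_ge0// ler_pM2r ?invr_gt0//.
    by have := @pihalf_lt2 R; lra.
  rewrite sumr_const card_ord -(mulr_natr (_ ^+ 2)) le_eqVlt; apply/orP; left.
  by apply/eqP; field.
rewrite -mulr_sumr in h.
have : m%:R * \sum_(l < M) (sine_weight l - sine_weight l.+1) ^+ 2 <= m%:R * (16 / M%:R).
  by rewrite ler_wpM2l.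
rewrite -h; set X := \sum_(j < m) _; lra.
Qed.

(** Cauchy-Schwarz between the mass and the second moment, in the form [|t| <=
    (M t^2 + 1 / M) / 2]. *)
Lemma trigker_moment1 :
  \sum_(j < m) `|sin (pi * y j)| * normsq (trigker (y j)) <=
  m%:R * (M%:R / 2) * (5 / M%:R).
Proof.
apply: (@le_trans _ _ (\sum_(j < m)
   (M%:R / 2 * (sin (pi * y j) ^+ 2 * normsq (trigker (y j))) +
    (2 * M%:R)^-1 * normsq (trigker (y j))))).
  apply: ler_sum => j _; set s := sin _; rewrite mulrA -mulrDl ler_wpM2r ?normsq_ge0//.
  rewrite -(real_normK (num_real s)); set u := `|s|.
  have -> : M%:R / 2 * u ^+ 2 + (2 * M%:R)^-1 =
     u + (M%:R * u - 1) ^+ 2 / (2 * M%:R) by field.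
  by rewrite lerDl divr_ge0// ?sqr_ge0// mulr_ge0.
rewrite big_split /= -!mulr_sumr trigker_mass.
have := trigker_moment2; set X := \sum_(j < m) _ => h.
have : M%:R / 2 * X <= M%:R / 2 * (m%:R * 4 / M%:R) by rewrite ler_wpM2l ?divr_ge0.
have -> : M%:R / 2 * (m%:R * 4 / M%:R) = m%:R * 2 :> R by field.
have -> : (2 * M%:R)^-1 * (m%:R * (M%:R / 2)) = m%:R / 4 :> R by field.
have -> : m%:R * (M%:R / 2) * (5 / M%:R) = m%:R * (5 / 2) :> R by field.
have : 0 <= m%:R :> R by [].
lra.
Qed.

End Kernel.

(** * Approximation by trigonometric polynomials *)

Section Approximation.
Context {R : realType} (n M : nat).
Hypothesis M2 : (2 <= M)%N.
Let m := (2 * M)%N.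
Variables (F : 'rV[R]_n -> R) (L : R).
Hypothesis Fper : forall x z : 'rV[R]_n, (forall i, z 0 i \is a Num.int) -> F (x + z) = F x.
Hypothesis FLip : forall x h : 'rV[R]_n, `|F (x + h) - F x| <= L * \sum_i `|h 0 i|.

Let MRp : 0 < (M%:R : R).
Proof. by rewrite ltr0n; case: M M2. Qed.

Let mRp : 0 < (m%:R : R).
Proof. by rewrite ltr0n /m; case: M M2. Qed.

Let Mm : (M <= m)%N.
Proof. by rewrite /m mul2n -addnn leq_addr. Qed.

Let mass : R := m%:R * (M%:R / 2).

Let mass_gt0 : 0 < mass.
Proof. by rewrite mulr_gt0// divr_gt0. Qed.

(** Distances to the nearest integer are bounded by [|sin|], which is what the
    kernel moments control. *)
Lemma periodic_lip : 0 <= L -> forall x h : 'rV[R]_n,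
  `|F (x + h) - F x| <= L * \sum_i `|sin (pi * h 0 i)|.
Proof.
move=> L0 x h.
(* [z] is the nearest integer vector to [h] *)
pose z : 'rV[R]_n := \row_i (Num.floor (h 0 i + 1 / 2))%:~R.
have zi i : z 0 i \is a Num.int by rewrite mxE intr_int.
have -> : F (x + h) = F (x + (h - z)) by rewrite -[RHS](Fper _ zi) addrA subrK.
apply: le_trans (FLip _ _) _; rewrite ler_wpM2l// ler_sum// => i _.
have zh : `|(h - z) 0 i| <= 1 / 2.
  rewrite !mxE; set t := h 0 i.
  have := floor_le (t + 1 / 2); have := floorD1_gt (t + 1 / 2).
  rewrite intrD; set w := (Num.floor _)%:~R => h1 h2.
  by rewrite ler_norml; apply/andP; split; lra.
apply: le_trans (abs_le_sinpi zh) _.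
have -> : h 0 i = (h - z) 0 i + z 0 i by rewrite !mxE subrK.
rewrite mulrDr sinD.
have zs : sin (pi * z 0 i) = 0 :> R.
  have := normsq_cisB1 (z 0 i); rewrite (cis_int (zi i)) subrr /normsq /= expr0n addr0.
  by move=> /esym/eqP; rewrite mulf_eq0 pnatr_eq0 /= expf_eq0 /= => /eqP.
by rewrite zs mulr0 addr0 normrM (sin0cos1 zs) mulr1.
Qed.

Definition prodker (y : 'rV[R]_n) : R := \prod_i normsq (trigker M (y 0 i)).

(** A discrete convolution: samples on a grid replace the integral, which makes
    the Fourier analysis finite. *)
Definition trig_approx (x : 'rV[R]_n) : R :=
  (mass ^+ n)^-1 *
    \sum_(j : {ffun 'I_n -> 'I_m}) F (grid j) * prodker (x - grid j).

Lemma prodker_ge0 y : 0 <= prodker y.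
Proof. by apply: prodr_ge0 => i _; exact: normsq_ge0. Qed.

Lemma prodker_mass x :
  \sum_(j : {ffun 'I_n -> 'I_m}) prodker (x - grid j) = mass ^+ n.
Proof.
under eq_bigr => j _ do rewrite /prodker; under eq_bigr => j _ do under eq_bigr => i _ do rewrite !mxE.
rewrite -(bigA_distr_bigA (fun i (j : 'I_m) => normsq (trigker M (x 0 i - j%:R / m%:R)))).
transitivity (\prod_(i < n) mass); last by rewrite prodr_const card_ord.
by apply: eq_bigr => i _; exact: trigker_mass.
Qed.

(** The sum over the grid factors, and only the factor of index [i] is not a
    mass. *)
Lemma prodker_moment1 x i :
  \sum_(j : {ffun 'I_n -> 'I_m}) `|sin (pi * (x - grid j) 0 i)| * prodker (x - grid j)
    <= mass ^+ n * (5 / M%:R).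
Proof.
pose G i' (j : 'I_m) : R :=
  (if i' == i then `|sin (pi * (x 0 i - j%:R / m%:R))| else 1) *
  normsq (trigker M (x 0 i' - j%:R / m%:R)).
have -> : \sum_(j : {ffun 'I_n -> 'I_m})
     `|sin (pi * (x - grid j) 0 i)| * prodker (x - grid j) =
  \sum_(j : {ffun 'I_n -> 'I_m}) \prod_i' G i' (j i').
  apply: eq_bigr => j _; rewrite /G big_split /=; congr (_ * _).
    rewrite (bigD1 i)//= eqxx big1 ?mulr1; first by rewrite !mxE.
    by move=> i' /negbTE ->.
  by apply: eq_bigr => i' _; rewrite !mxE.
rewrite -bigA_distr_bigA (bigD1 i)//=.
have -> : \prod_(i' | i' != i) \sum_(j < m) G i' j = mass ^+ n.-1.
  transitivity (\prod_(i' | i' != i) mass); last by rewrite prodr_const cardC1 card_ord.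
  apply: eq_bigr => i' /negbTE i'i; rewrite /mass -(trigker_mass M2 Mm (x 0 i')).
  by apply: eq_bigr => j _; rewrite /G i'i mul1r.
have -> : mass ^+ n = mass * mass ^+ n.-1.
  by rewrite -exprS prednK//; exact: leq_ltn_trans (leq0n i) (ltn_ord i).
rewrite mulrAC ler_wpM2r ?exprn_ge0// ?(ltW mass_gt0)//.
rewrite /G eqxx; exact: trigker_moment1.
Qed.

(** Average the Lipschitz bound against the kernel, which has total mass one and
    first moment [O(1 / M)] in each coordinate. *)
Lemma trig_approxP : 0 <= L -> forall x, `|F x - trig_approx x| <= L * n%:R * (5 / M%:R).
Proof.
move=> L0 x.
have q0 : 0 < mass ^+ n by rewrite exprn_gt0.
have -> : F x - trig_approx x = (mass ^+ n)^-1 *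
    \sum_(j : {ffun 'I_n -> 'I_m}) (F x - F (grid j)) * prodker (x - grid j).
  under eq_bigr => j _ do rewrite mulrBl.
  by rewrite sumrB -mulr_sumr prodker_mass mulrBr mulrCA mulVf ?gt_eqF// mulr1.
rewrite normrM ger0_norm ?invr_ge0 ?(ltW q0)// ler_pdivrMl//.
apply: (@le_trans _ _ (\sum_(j : {ffun 'I_n -> 'I_m}) \sum_i
   L * (`|sin (pi * (x - grid j) 0 i)| * prodker (x - grid j)))).
  apply: le_trans (ler_norm_sum _ _ _) _; apply: ler_sum => j _.
  rewrite normrM (ger0_norm (prodker_ge0 _)) -mulr_sumr -mulr_suml mulrA.
  rewrite ler_wpM2r ?prodker_ge0//.
  rewrite -[X in F X - _](subrKC (grid j) x); exact: periodic_lip.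
rewrite exchange_big /=.
under eq_bigr => i _ do rewrite -mulr_sumr.
rewrite -mulr_sumr -!mulrA mulrCA ler_wpM2l//.
apply: (@le_trans _ _ (\sum_(i < n) (mass ^+ n * (5 / M%:R)))).
  by apply: ler_sum => i _; exact: prodker_moment1.
by rewrite sumr_const card_ord -(mulr_natl (_ * _)) mulrCA.
Qed.

Definition cos_mode (k : 'rV[int]_n) (x : 'rV[R]_n) : R := cos (2 * pi * dotz k x).
Definition sin_mode (k : 'rV[int]_n) (x : 'rV[R]_n) : R := sin (2 * pi * dotz k x).

Definition cos_coef k := \sum_(j : {ffun 'I_n -> 'I_m}) F (grid j) * cos_mode k (grid j).
Definition sin_coef k := \sum_(j : {ffun 'I_n -> 'I_m}) F (grid j) * sin_mode k (grid j).

Definition box_weight (l : {ffun 'I_n -> 'I_M}) : R := \prod_i sine_weight M (l i).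

Lemma box_weight_sqr_sum : \sum_l box_weight l ^+ 2 = (M%:R / 2) ^+ n.
Proof.
under eq_bigr => l _ do rewrite /box_weight -prodrXl.
rewrite -(bigA_distr_bigA (fun i (l : 'I_M) => sine_weight M l ^+ 2)).
transitivity (\prod_(i < n) (M%:R / 2 : R)); last by rewrite prodr_const card_ord.
by apply: eq_bigr => i _; exact: sine_weight_sqr_sum.
Qed.

(** The kernel is the square modulus of a product of one-variable sums, that is,
    of one sum over the box. *)
Lemma prodker_expand y : prodker y =
  \sum_l \sum_l' box_weight l * box_weight l' * cos_mode (freq l l') y.
Proof.
pose S := \sum_(l : {ffun 'I_n -> 'I_M}) (box_weight l)%:C%C *
  cis (dotz (\row_i (l i)%:Z) y).
have -> : prodker y = normsq S.
  have -> : S = \prod_i trigker M (y 0 i).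
    rewrite /trigker bigA_distr_bigA; apply: eq_bigr => l _.
    rewrite cis_prod /box_weight (rmorph_prod (real_complex R)) -big_split /=.
    by apply: eq_bigr => i _; rewrite mxE.
  by rewrite /prodker (big_morph _ normsqM (_ : normsq 1 = 1))// /normsq /= expr1n expr0n addr0.
have reS (I : finType) (f : I -> R[i]) (g : I -> R) :
   (forall i, complex.Re (f i) = g i) -> complex.Re (\sum_i f i) = \sum_i g i.
  move=> fg; rewrite (raddf_sum (@complex.Re R : Rcomplex R -> R)).
  by apply: eq_bigr => i _; exact: fg.
have -> : normsq S = complex.Re (S * conjc S) by rewrite -normsqE.
rewrite /S conjc_sum big_distrlr /=.
apply: (reS) => l; apply: (reS) => l'.
have -> : freq l l' = \row_i (l i)%:Z - \row_i (l' i)%:Z.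
  by apply/rowP => i; rewrite !mxE.
by rewrite /cos_mode dotzDl dotzNl mulrBr cosB /=; ring.
Qed.

(** Expanding the kernel turns the convolution into a Fourier sum whose
    coefficients are the discrete Fourier coefficients of [F]. *)
Lemma trig_approxE x : trig_approx x = (mass ^+ n)^-1 *
  \sum_l \sum_l' box_weight l * box_weight l' *
    (cos_coef (freq l l') * cos_mode (freq l l') x + sin_coef (freq l l') * sin_mode (freq l l') x).
Proof.
congr (_ * _).
under eq_bigr => j _ do rewrite prodker_expand mulr_sumr.
rewrite exchange_big /=; apply: eq_bigr => l _.
under eq_bigr => j _ do rewrite mulr_sumr.
rewrite exchange_big /=; apply: eq_bigr => l' _.
set w := box_weight l * box_weight l'; rewrite /cos_coef /sin_coef !big_distrl /= -big_split /= big_distrr /=.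
apply: eq_bigr => j _.
by rewrite /cos_mode /sin_mode dotzDr dotzNr mulrBr cosB; ring.
Qed.

Lemma cos_coefN k : cos_coef (- k) = cos_coef k.
Proof.
by apply: eq_bigr => j _; rewrite /cos_mode dotzNl mulrN cosN.
Qed.

Lemma sin_coefN k : sin_coef (- k) = - sin_coef k.
Proof.
by rewrite /sin_coef -sumrN; apply: eq_bigr => j _; rewrite /sin_mode dotzNl mulrN sinN mulrN.
Qed.

Let hcoef (G : 'rV[R]_n -> R) k : R[i] :=
  \sum_(j : {ffun 'I_n -> 'I_m}) (G (grid j))%:C%C * conjc (cis (dotz k (grid j))).

Let normsq_hcoef k : normsq (hcoef F k) = cos_coef k ^+ 2 + sin_coef k ^+ 2.
Proof.
have -> : hcoef F k = (cos_coef k -i* sin_coef k)%C.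
  have -> : (cos_coef k -i* sin_coef k)%C = (cos_coef k)%:C%C - 'i%C * (sin_coef k)%:C%C.
    by simpc.
  rewrite /cos_coef /sin_coef !(rmorph_sum (real_complex R)) mulr_sumr -sumrB /=.
  by apply: eq_bigr => j _; rewrite /cis /cos_mode /sin_mode; simpc.
by rewrite /normsq /= sqrrN.
Qed.

Let shift_grid i (G : 'rV[R]_n -> R[i]) :
  (forall x z : 'rV[R]_n, (forall i, z 0 i \is a Num.int) -> G (x + z) = G x) ->
  \sum_(j : {ffun 'I_n -> 'I_m}) G (grid j + (m%:R^-1) *: delta_mx 0 i) =
  \sum_(j : {ffun 'I_n -> 'I_m}) G (grid j).
Proof.
move=> Gper.
pose h (j : {ffun 'I_n -> 'I_m}) : {ffun 'I_n -> 'I_m} :=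
  [ffun i' => if i' == i then ordS (j i') else j i'].
have hi : injective h.
  move=> j j' /ffunP e; apply/ffunP => i'; have := e i'; rewrite !ffunE.
  by case: ifP => // _ /ordS_inj.
rewrite [RHS](reindex_inj hi) /=; apply: eq_bigr => j _.
pose z : 'rV[R]_n := grid j + (m%:R^-1) *: delta_mx 0 i - grid (h j).
have -> : grid j + m%:R^-1 *: delta_mx 0 i = grid (h j) + z by rewrite /z subrKC.
apply: Gper => i'; rewrite !mxE ffunE eqxx /=.
case: eqVneq => [_|_]; last by rewrite mulr0 addr0 subrr.
have -> a b : a / m%:R + m%:R^-1 * 1 - b / m%:R = (a + 1 - b) / m%:R :> R.
  by field; rewrite gt_eqF.
rewrite /ordS /=.
have [jm|jm] := ltnP (j i').+1 m.
  by rewrite modn_small// -natr1 subrr mul0r.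
have -> : (j i').+1 = m by apply/eqP; rewrite eqn_leq jm ltn_ord.
rewrite modnn subr0.
have -> : ((j i')%:R + 1) = m%:R :> R.
  by rewrite natr1; congr _%:R; apply/eqP; rewrite eqn_leq jm ltn_ord.
by rewrite divff ?gt_eqF.
Qed.

(** The difference of [F] along a grid step has Fourier coefficients multiplied
    by [cis (k_i / m) - 1], of modulus at least [2 |k_i| / m], and is at most [L
    / m]. *)
Lemma bessel_grad (l : {ffun 'I_n -> 'I_M}) i : 0 <= L ->
  \sum_l' (freq l l' 0 i)%:~R ^+ 2 *
     (cos_coef (freq l l') ^+ 2 + sin_coef (freq l l') ^+ 2) <=
  (m%:R ^+ n * L / 2) ^+ 2.
Proof.
move=> L0.
pose e : 'rV[R]_n := m%:R^-1 *: delta_mx 0 i.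
pose D x := F (x + e) - F x.
have hD k : hcoef D k = (cis ((k 0 i)%:~R / m%:R) - 1) * hcoef F k.
  have -> : hcoef D k = \sum_(j : {ffun 'I_n -> 'I_m})
      (F (grid j + e))%:C%C * conjc (cis (dotz k (grid j))) - hcoef F k.
    rewrite /hcoef -sumrB; apply: eq_bigr => j _.
    by rewrite rmorphB /= mulrBl.
  rewrite mulrBl mul1r; congr (_ - _).
  have := @shift_grid i (fun x => (F x)%:C%C * conjc (cis (dotz k x))).
  rewrite -/e /hcoef => <-; last first.
    move=> x z zi; rewrite Fper// dotzDr cisD (@cis_int _ (dotz k z)) ?mulr1//.
    by rewrite /dotz rpred_sum// => i' _; rewrite rpredM// intr_int.
  rewrite mulr_sumr; apply: eq_bigr => j _.
  rewrite mulrCA; congr (_ * _).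
  rewrite dotzDr /e dotzZr dotz_delta cisD conjcM (mulrC (_%:~R)) mulrCA.
  by rewrite -normsqE normsq_cis mulr1.
have le1 (k : 'rV[int]_n) : (`|k 0%R i|%N < M)%N ->
    (k 0 i)%:~R ^+ 2 * normsq (hcoef F k) <=
       (m%:R / 2) ^+ 2 * normsq (hcoef D k).
  move=> kM; rewrite hD normsqM mulrA ler_wpM2r ?normsq_ge0// normsq_cisB1.
  have : `|(k 0 i)%:~R / m%:R| <= 1 / 2 :> R.
    rewrite normrM normfV (ger0_norm (ler0n _ m)) ler_pdivrMr// -intr_norm -abszE.
    rewrite /m natrM mulrA div1r mulVf// mul1r -pmulrn ler_nat; exact: ltnW.
  move=> /abs_le_sinpi.
  set s := sin _; rewrite normrM normfV (ger0_norm (ler0n _ m)) ler_pdivrMr// => h.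
  have -> : (m%:R / 2) ^+ 2 * (4 * s ^+ 2) = (`|s| * m%:R) ^+ 2.
    by rewrite (exprMn _ `|s|) real_normK ?num_real//; field.
  rewrite -(real_normK (num_real (k 0 i)%:~R)) ler_sqr ?nnegrE ?mulr_ge0//.
apply: (@le_trans _ _ (\sum_l' (m%:R / 2) ^+ 2 * normsq (hcoef D (freq l l')))).
  by apply: ler_sum => l' _; rewrite -normsq_hcoef le1// freq_lt.
rewrite -mulr_sumr.
have := bessel (grid_orth Mm l) (fun j => (D (grid j))%:C%C) _.
rewrite exprn_gt0// => /(_ isT) B.
apply: (@le_trans _ _ ((m%:R / 2) ^+ 2 * (m%:R ^+ n * \sum_(j : {ffun 'I_n -> 'I_m}) normsq (D (grid j))%:C%C))).
  by rewrite ler_wpM2l ?sqr_ge0.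
apply: (@le_trans _ _ ((m%:R / 2) ^+ 2 * (m%:R ^+ n * \sum_(j : {ffun 'I_n -> 'I_m}) (L / m%:R) ^+ 2))).
  rewrite ler_wpM2l ?sqr_ge0// ler_wpM2l ?exprn_ge0// ler_sum// => j _.
  rewrite /normsq /= expr0n addr0 -(real_normK (num_real (D _))).
  rewrite ler_sqr ?nnegrE ?divr_ge0//; apply: le_trans (FLip _ _) _.
  rewrite ler_wpM2l// (bigD1 i)//= big1 => [|i' ii']; last first.
    by rewrite !mxE (negbTE ii') andbF mulr0 normr0.
  by rewrite !mxE !eqxx mulr1 addr0 ger0_norm// invr_ge0.
rewrite sumr_const card_ffun !card_ord -(mulr_natr (_ ^+ 2)) natrX.
by rewrite le_eqVlt; apply/orP; left; apply/eqP; field; rewrite gt_eqF.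
Qed.

End Approximation.

(** * Small divisors *)

Section Separation.
Context {R : realType}.

Lemma sum_inv_sqr B : \sum_(z < B.+1) ((z.+1)%:R ^+ 2)^-1 <= 2 - (B.+1)%:R^-1 :> R.
Proof.
elim: B => [|B IH]; first by rewrite big_ord_recr big_ord0 /=; lra.
rewrite big_ord_recr /=; apply: le_trans (lerD IH (lexx _)) _.
have b0 : 0 < B.+1%:R :> R by [].
have -> : B.+2%:R = B.+1%:R + 1 :> R by rewrite natr1.
set b : R := B.+1%:R in b0 *.
have b1 : 0 < b + 1 by lra.
rewrite -subr_ge0.
have -> : 2 - (b + 1)^-1 - (2 - b^-1 + ((b + 1) ^+ 2)^-1) =
   (b * (b + 1) ^+ 2)^-1 by field; rewrite !gt_eqF.
by rewrite invr_ge0 mulr_ge0 ?sqr_ge0 ?ltW.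
Qed.

(** The integer parts of [v x / s] are distinct and positive. *)
Lemma sum_separated_pos (I : finType) (A : {set I}) (v : I -> R) (s : R) : 0 < s ->
  (forall x, x \in A -> s <= v x) ->
  (forall x y, x \in A -> y \in A -> x != y -> s <= `|v x - v y|) ->
  \sum_(x in A) (v x ^+ 2)^-1 <= 2 / s ^+ 2.
Proof.
move=> s0 vs vsep.
pose z x := (Num.truncn (v x / s)).-1.
have zP x : x \in A -> (z x).+1%:R <= v x / s < (z x).+2%:R.
  move=> xA; have h : 1 <= v x / s by rewrite ler_pdivlMr// mul1r vs.
  have := truncn_itv (le_trans ler01 h).
  have : (0 < Num.truncn (v x / s))%N by rewrite truncn_gt0.
  by rewrite /z; case: (Num.truncn _).
pose B := \max_(x in A) z x.
have zB x : x \in A -> (z x < B.+1)%N by move=> xA; rewrite ltnS; exact: (leq_bigmax_cond _ xA).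
pose h x : 'I_B.+1 := inord (z x).
have hi : {in A &, injective h}.
  move=> x y xA yA /(congr1 val); rewrite /h /= !inordK ?zB// => zxy.
  apply/eqP; apply/negPn/negP => xy; have := vsep _ _ xA yA xy; apply/negP.
  rewrite -ltNge; have := zP _ xA; have := zP _ yA.
  rewrite zxy !ler_pdivlMr// !ltr_pdivrMr// -!natr1.
  set w : R := (z y)%:R => /andP[h1 h2] /andP[h3 h4].
  by rewrite ltr_norml; apply/andP; split; lra.
apply: (@le_trans _ _ (\sum_(x in A) (s ^+ 2)^-1 * ((h x).+1%:R ^+ 2)^-1)).
  apply: ler_sum => x xA; rewrite -invfM -exprMn.
  have vx : 0 < v x by apply: lt_le_trans s0 (vs _ xA).
  rewrite lef_pV2 ?posrE ?exprn_gt0 ?mulr_gt0// ler_sqr ?nnegrE ?mulr_ge0 ?(ltW s0) ?(ltW vx)//.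
  rewrite /h inordK ?zB//; have /andP[+ _] := zP _ xA.
  by rewrite ler_pdivlMr// mulrC.
rewrite -mulr_sumr mulrC ler_wpM2r ?invr_ge0 ?sqr_ge0//.
rewrite -(big_imset (fun y : 'I_B.+1 => (y.+1%:R ^+ 2)^-1) hi) /=.
apply: (@le_trans _ _ (2 - (B.+1)%:R^-1)); last by rewrite gerBl.
apply: le_trans (sum_inv_sqr B).
rewrite [leRHS](bigID (mem [set h x | x in A]%SET)) /= lerDl.
by apply: sumr_ge0 => i _; rewrite invr_ge0 sqr_ge0.
Qed.

(** Reals separated by [s] from each other and from [0] have at most one
    member, on each side, between consecutive multiples of [s]. *)
Lemma sum_separated (I : finType) (P : pred I) (v : I -> R) (s : R) : 0 < s ->
  (forall x, P x -> s <= `|v x|) ->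
  (forall x y, P x -> P y -> x != y -> s <= `|v x - v y|) ->
  \sum_(x | P x) (v x ^+ 2)^-1 <= 4 / s ^+ 2.
Proof.
move=> s0 vs vsep; rewrite (bigID (fun x => 0 <= v x)) /=.
have -> : 4 / s ^+ 2 = 2 / s ^+ 2 + 2 / s ^+ 2 by lra.
apply: lerD.
  pose A := [set x | P x && (0 <= v x)]%SET.
  rewrite (_ : \sum_(x | _) _ = \sum_(x in A) (v x ^+ 2)^-1); last first.
    by apply: eq_bigl => x; rewrite inE.
  apply: sum_separated_pos => // [x|x y].
    by rewrite inE => /andP[/vs + v0]; rewrite ger0_norm.
  by rewrite !inE => /andP[Px _] /andP[Py _]; exact: vsep.
pose A := [set x | P x && ~~ (0 <= v x)]%SET.
rewrite (_ : \sum_(x | _) _ = \sum_(x in A) ((- v x) ^+ 2)^-1); last first.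
  by apply: eq_big => [x|x _]; [rewrite inE | rewrite sqrrN].
apply: (@sum_separated_pos _ _ (fun x => - v x)) => // [x|x y].
  by rewrite inE -ltNge => /andP[/vs + v0]; rewrite ltr0_norm.
rewrite !inE => /andP[Px _] /andP[Py _] xy.
by rewrite -opprD normrN; exact: vsep.
Qed.

End Separation.

Section Pairing.
Context {R : realType} (n M : nat).
Hypothesis M2 : (2 <= M)%N.
Let m := (2 * M)%N.
Variables (F : 'rV[R]_n -> R).
Hypothesis Fper : forall x z : 'rV[R]_n, (forall i, z 0 i \is a Num.int) -> F (x + z) = F x.
Hypothesis FLip : forall x h : 'rV[R]_n, `|F (x + h) - F x| <= 1 * \sum_i `|h 0 i|.
Variables (w : 'rV[R]_n) (s B : R).
Hypothesis s0 : 0 < s.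
Hypothesis B0 : 0 <= B.
Hypothesis ws : forall k : 'rV[int]_n, k != 0 -> (forall i, (`|k 0%R i|%N < M)%N) ->
  s <= `|dotz k w|.
Variables c d : 'rV[int]_n -> R.
Hypothesis c_le : forall k, `|dotz k w| * `|c k| <= B * \sum_i `|k 0 i|%:~R.
Hypothesis d_le : forall k, `|dotz k w| * `|d k| <= B * \sum_i `|k 0 i|%:~R.
Hypothesis c0 : c 0 = 0.
Hypothesis d0 : d 0 = 0.

Let MRp : 0 < (M%:R : R).
Proof. by rewrite ltr0n; case: M M2. Qed.

Let mRp : 0 < (m%:R : R).
Proof. by rewrite ltr0n /m; case: M M2. Qed.

Let ab k := `|cos_coef M F k| + `|sin_coef M F k|.

Let T (l l' : {ffun 'I_n -> 'I_M}) : R := \sum_i B *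
   (`|freq l l' 0 i|%:~R * ab (freq l l') / `|dotz (freq l l') w|).

Let TC l l' : T l l' = T l' l.
Proof.
apply: eq_bigr => i _; rewrite -freqN dotzNl normrN /ab cos_coefN sin_coefN normrN.
by rewrite [(- freq l' l) 0 i]mxE normrN.
Qed.

Let freq0 (l : {ffun 'I_n -> 'I_M}) : freq l l = 0.
Proof. by apply/rowP => i; rewrite !mxE subrr. Qed.

Let T_bound l : \sum_l' T l l' <= n%:R * B * (3 / 2 * (m%:R ^+ n / s)).
Proof.
rewrite /T exchange_big /=.
apply: (@le_trans _ _ (\sum_(i < n) B * (3 / 2 * (m%:R ^+ n / s)))); last first.
  by rewrite sumr_const card_ord -(mulr_natl (B * _)) mulrA.
apply: ler_sum => i _; rewrite -mulr_sumr ler_wpM2l//.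
set q := m%:R ^+ n; have q0 : 0 < q by rewrite exprn_gt0.
pose X l' := (freq l l' 0 i)%:~R ^+ 2 *
     (cos_coef M F (freq l l') ^+ 2 + sin_coef M F (freq l l') ^+ 2).
pose Y l' : R := if l' == l then 0 else (dotz (freq l l') w ^+ 2)^-1.
(* the weights [2 / (s q)] and [s q / 4] balance the bounds [hX] and [hY] below *)
apply: (@le_trans _ _ (\sum_l' (2 / (s * q) * X l' + s * q / 4 * Y l'))).
  apply: ler_sum => l' _; rewrite /X /Y.
  case: eqVneq => [->|ll'].
    by rewrite freq0 mxE normr0 !mul0r expr0n /= !mul0r !mulr0 addr0.
  set k := freq l l'.
  have kw : s <= `|dotz k w|.
    by apply: ws => [|j]; [rewrite freq_neq0 1?eq_sym | exact: freq_lt].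
  have kw0 : 0 < `|dotz k w| by apply: lt_le_trans kw.
  rewrite -(real_normK (num_real (dotz k w))) -(real_normK (num_real (k 0 i)%:~R)) -intr_norm.
  rewrite -(real_normK (num_real (cos_coef M F k))) -(real_normK (num_real (sin_coef M F k))) /ab.
  set u : R := `|k 0 i|%:~R; set a := `|cos_coef M F k|; set b := `|sin_coef M F k|.
  set D := `|dotz k w| in kw0 *.
  have ab2 : (a + b) ^+ 2 <= 2 * (a ^+ 2 + b ^+ 2).
    by rewrite -subr_ge0 (_ : _ - _ = (a - b) ^+ 2) ?sqr_ge0//; ring.
  apply: (@le_trans _ _ ((s * q)^-1 * (u ^+ 2 * (a + b) ^+ 2) + s * q / 4 * (D ^+ 2)^-1)).
    rewrite -subr_ge0.
    have -> : (s * q)^-1 * (u ^+ 2 * (a + b) ^+ 2) + s * q / 4 * (D ^+ 2)^-1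
      - u * (a + b) / D = (s * q)^-1 * (u * (a + b) - s * q / (2 * D)) ^+ 2.
      by field; rewrite !gt_eqF.
    by rewrite mulr_ge0 ?sqr_ge0// invr_ge0 mulr_ge0 ?ltW.
  rewrite lerD2r.
  have -> : 2 / (s * q) * (u ^+ 2 * (a ^+ 2 + b ^+ 2)) =
     (s * q)^-1 * (u ^+ 2 * (2 * (a ^+ 2 + b ^+ 2))).
    by field; rewrite !gt_eqF.
  rewrite ler_wpM2l ?invr_ge0 ?mulr_ge0 ?(ltW s0) ?(ltW q0)//.
  by rewrite ler_wpM2l// sqr_ge0.
rewrite big_split /= -!mulr_sumr.
have hX : \sum_l' X l' <= (q * 1 / 2) ^+ 2 by apply: bessel_grad.
have hY : \sum_l' Y l' <= 4 / s ^+ 2.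
  have -> : \sum_l' Y l' = \sum_(l' | l' != l) (dotz (freq l l') w ^+ 2)^-1.
    rewrite (bigD1 l)//= /Y eqxx add0r; apply: eq_bigr => l' /negbTE ->.
    by [].
  apply: sum_separated => // [x xl|x y xl yl xy].
    by apply: ws => [|j]; [rewrite freq_neq0 1?eq_sym | exact: freq_lt].
  rewrite -dotzNl -dotzDl freqD.
  by apply: ws => [|j]; [rewrite freq_neq0 1?eq_sym | exact: freq_lt].
have sq0 : 0 < s * q by rewrite mulr_gt0.
apply: (@le_trans _ _ (2 / (s * q) * (q * 1 / 2) ^+ 2 + s * q / 4 * (4 / s ^+ 2))).
  by apply: lerD; rewrite ler_wpM2l ?divr_ge0 ?(ltW sq0).
by rewrite le_eqVlt; apply/orP; left; apply/eqP; field; rewrite !gt_eqF.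
Qed.

(** Cauchy-Schwarz for each fixed [l], between [|k_i| (|a_k| + |b_k|)],
    controlled by [bessel_grad], and [1 / (k . w)], controlled by
    [sum_separated]. The weights are then removed by [2 |x y| <= x ^+ 2 + y ^+
    2]. *)
Lemma pairing_bound :
  `|((m%:R * (M%:R / 2)) ^+ n)^-1 * \sum_(l : {ffun 'I_n -> 'I_M}) \sum_(l' : {ffun 'I_n -> 'I_M}) box_weight l * box_weight l' *
    (cos_coef M F (freq l l') * c (freq l l') + sin_coef M F (freq l l') * d (freq l l'))|
  <= 2 * n%:R * B / s.
Proof.
have mass_gt0 : 0 < (m%:R * (M%:R / 2)) ^+ n :> R.
  by rewrite exprn_gt0// mulr_gt0// divr_gt0.
rewrite normrM ger0_norm ?invr_ge0 ?(ltW mass_gt0)// ler_pdivrMl//.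
apply: (@le_trans _ _ (\sum_(l : {ffun 'I_n -> 'I_M}) \sum_(l' : {ffun 'I_n -> 'I_M}) ((box_weight l ^+ 2 / 2) * T l l' + (box_weight l' ^+ 2 / 2) * T l l'))).
  apply: le_trans (ler_norm_sum _ _ _) _; apply: ler_sum => l _.
  apply: le_trans (ler_norm_sum _ _ _) _; apply: ler_sum => l' _.
  rewrite -mulrDl normrM.
  have [ll'|ll'] := eqVneq l l'.
    rewrite ll' freq0 c0 d0 !mulr0 addr0 normr0 mulr0 mulr_ge0//.
      by rewrite addr_ge0 ?divr_ge0 ?sqr_ge0.
    apply: sumr_ge0 => i _; rewrite !mulr_ge0 ?invr_ge0//; by rewrite ?ler0z ?addr_ge0.
  set k := freq l l'.
  have kw : 0 < `|dotz k w|.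
    apply: lt_le_trans s0 _.
    by apply: ws => [|j]; [rewrite freq_neq0 | exact: freq_lt].
  apply: ler_pM => //.
    rewrite -subr_ge0 -(real_normK (num_real (box_weight l))) -(real_normK (num_real (box_weight l'))) normrM.
    by rewrite (_ : _ - _ = (`|box_weight l| - `|box_weight l'|) ^+ 2 / 2) ?divr_ge0 ?sqr_ge0//; field.
  rewrite /T -/k -mulr_sumr -mulr_suml -mulr_suml -/k.
  apply: le_trans (ler_normD _ _) _; rewrite !normrM /ab.
  set S := \sum_i _.
  have hc : `|c k| <= B * S / `|dotz k w| by rewrite ler_pdivlMr// mulrC c_le.
  have hd : `|d k| <= B * S / `|dotz k w| by rewrite ler_pdivlMr// mulrC d_le.
  have -> : B * (S * (`|cos_coef M F k| + `|sin_coef M F k|) / `|dotz k w|) =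
    `|cos_coef M F k| * (B * S / `|dotz k w|) + `|sin_coef M F k| * (B * S / `|dotz k w|).
    by field; rewrite gt_eqF.
  by apply: lerD; rewrite ler_wpM2l.
under eq_bigr => l _ do rewrite big_split /= -mulr_sumr.
rewrite big_split /= [X in _ + X]exchange_big /=.
under [X in _ + X]eq_bigr => l' _.
  under eq_bigr => l _ do rewrite TC.
  rewrite -mulr_sumr; over.
set q := n%:R * B * (3 / 2 * (m%:R ^+ n / s)).
apply: (@le_trans _ _ (\sum_(l : {ffun 'I_n -> 'I_M}) box_weight l ^+ 2 / 2 * q + \sum_(l : {ffun 'I_n -> 'I_M}) box_weight l ^+ 2 / 2 * q)).
  by apply: lerD; apply: ler_sum => l _; rewrite ler_wpM2l ?divr_ge0 ?sqr_ge0//; exact: T_bound.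
rewrite -!mulr_suml box_weight_sqr_sum// (exprMn _ m%:R) /q.
set a := m%:R ^+ n; set b := (_ / _) ^+ n.
have ab0 : 0 <= a * b * (n%:R * B / s).
  by rewrite !mulr_ge0 ?exprn_ge0 ?divr_ge0 ?invr_ge0 ?(ltW s0).
have -> : b / 2 * (n%:R * B * (3 / 2 * (a / s))) + b / 2 * (n%:R * B * (3 / 2 * (a / s))) =
   3 / 2 * (a * b * (n%:R * B / s)) by field; rewrite gt_eqF.
have -> : a * b * (2 * n%:R * B / s) = 2 * (a * b * (n%:R * B / s)) by field; rewrite gt_eqF.
by rewrite ler_wpM2r//; lra.
Qed.

End Pairing.

(** * Integrals and almost everywhere derivatives *)

Section BoundedIntegrals.
Context d {X : measurableType d} {R : realType}.
Variable mu : {measure set X -> \bar R}.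
Import HBNNSimple.

Lemma integrable_bounded (E : set X) (f : X -> R) (K : R) : measurable E ->
  (mu E < +oo)%E -> measurable_fun E f -> (forall x, E x -> `|f x| <= K) ->
  mu.-integrable E (EFin \o f).
Proof.
move=> mE Eoo mf fK; apply: measurable_bounded_integrable => //.
exists K; split; first exact: num_real.
by move=> k Kk x Ex; apply: le_trans (fK _ Ex) (ltW Kk).
Qed.

(** The integral of a nonnegative function is a supremum over simple functions,
    so it is monotone whether or not the functions are measurable. *)
Lemma le_integral_nonmeasurable (f g : X -> \bar R) :
  (forall x, 0 <= f x)%E -> (forall x, f x <= g x)%E ->
  (\int[mu]_x f x <= \int[mu]_x g x)%E.
Proof.
move=> f0 fg; have g0 x : (0 <= g x)%E by apply: le_trans (f0 x) (fg x).
rewrite !ge0_integralTE//; apply: ereal_sup_le => _ [h hf <-]; exists h => //.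
by move=> x; apply: le_trans (hf x) (fg x).
Qed.

End BoundedIntegrals.

Section ProbabilityIntegrals.
Context d {X : measurableType d} {R : realType} (P : probability X R).

Lemma prob_integrable (f : X -> R) K : measurable_fun setT f ->
  (forall x, `|f x| <= K) -> P.-integrable setT (EFin \o f).
Proof.
move=> mf fK; apply: (@integrable_bounded _ _ _ _ _ _ K) => //.
by rewrite -ge0_fin_numE// fin_num_measure.
Qed.

Lemma prob_Rint_cst r : \int[P]_x r = r.
Proof.
rewrite Rintegral_cst// [X in _ * X](_ : _ = 1) ?mulr1//.
exact: (congr1 fine (probability_setT P)).
Qed.

Lemma prob_Rint_dist (f g : X -> R) e :
  P.-integrable setT (EFin \o f) -> P.-integrable setT (EFin \o g) ->
  (forall x, `|f x - g x| <= e) -> `|\int[P]_x f x - \int[P]_x g x| <= e.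
Proof.
move=> fi gi fg.
have ci : P.-integrable setT (EFin \o (fun=> e)) by exact: finite_measure_integrable_cst.
have fgi : P.-integrable setT (EFin \o (fun x => g x + e)).
  by have := integrableD measurableT gi ci.
have gfi : P.-integrable setT (EFin \o (fun x => f x + e)).
  by have := integrableD measurableT fi ci.
have h1 : \int[P]_x f x <= \int[P]_x (g x + e).
  by apply: le_Rintegral => // x _; have := fg x; rewrite ler_distl => /andP[_].
have h2 : \int[P]_x g x <= \int[P]_x (f x + e).
  apply: le_Rintegral => // x _; have := fg x; rewrite ler_distl => /andP[+ _]; lra.
rewrite RintegralD// prob_Rint_cst in h1; rewrite RintegralD// prob_Rint_cst in h2.
by rewrite ler_distl; apply/andP; split; lra.
Qed.

Lemma le_Rint_nonmeasurable (f g : X -> R) K :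
  (forall x, `|f x| <= K) -> (forall x, `|g x| <= K) -> (forall x, f x <= g x) ->
  \int[P]_x f x <= \int[P]_x g x.
Proof.
move=> fK gK fg.
have bd (h : X -> \bar R) : (forall x, 0 <= h x)%E -> (forall x, h x <= K%:E)%E ->
    (\int[P]_x h x)%E \is a fin_num.
  move=> h0 hK; rewrite ge0_fin_numE ?integral_ge0//.
  apply: le_lt_trans (le_integral_nonmeasurable P h0 hK) _.
  by rewrite integral_cst// [X in (_ * X)%E](_ : _ = 1%E) ?mule1 ?ltry//; exact: probability_setT.
have K0 (x : X) : 0 <= K by exact: le_trans (normr_ge0 _) (fK x).
have pK (h : X -> R) x : (forall x, `|h x| <= K) -> ((EFin \o h)^\+ x <= K%:E)%E.
  move=> hK; rewrite funeposE ge_max lee_fin (le_trans (ler_norm _) (hK x))//=.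
  by rewrite lee_fin (K0 x).
have nK (h : X -> R) x : (forall x, `|h x| <= K) -> ((EFin \o h)^\- x <= K%:E)%E.
  move=> hK; rewrite funenegE ge_max -EFinN lee_fin lee_fin (K0 x) andbT.
  by apply: le_trans (hK x); rewrite -normrN ler_norm.
rewrite /Rintegral.
have fin (h : X -> R) : (forall x, `|h x| <= K) -> (\int[P]_x (h x)%:E)%E \is a fin_num.
  move=> hK; rewrite integralE fin_numB; apply/andP; split; apply: bd => x.
  - exact: funepos_ge0.
  - exact: pK.
  - exact: funeneg_ge0.
  - exact: nK.
apply: fine_le; [exact: fin|exact: fin|].
rewrite integralE [leRHS]integralE; apply: leeB.
  apply: le_integral_nonmeasurable => x; first exact: funepos_ge0.
  by rewrite !funeposE ge_max !le_max lee_fin fg lexx !orbT.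
apply: le_integral_nonmeasurable => x; first exact: funeneg_ge0.
by rewrite !funenegE ge_max !le_max -!EFinN lee_fin lerN2 fg lexx !orbT.
Qed.

End ProbabilityIntegrals.

Section DiniBound.
Context {R : realType}.

(** The supremum of the points of [[0, T]] at which the bound holds belongs to
    this set by continuity, and could be increased if it were less than [T]. *)
Lemma dini_bound (F : R -> R) (T K L : R) : 0 <= T -> F 0 <= 0 ->
  (forall s t, 0 <= s -> s <= t -> t <= T -> `|F t - F s| <= L * (t - s)) ->
  (forall s, 0 <= s -> s < T -> exists2 e, 0 < e & s + e <= T /\ F (s + e) - F s <= K * e) ->
  F T <= K * T.
Proof.
move=> T0 F0 FL step.
pose S := [set t | 0 <= t <= T /\ F t <= K * t].
have S0 : S 0 by split; [rewrite lexx T0 | rewrite mulr0].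
have Sub : ubound S T by move=> t [/andP[]].
have hS : has_sup S by split; [exists 0 | exists T].
set tau := sup S.
have tauT : tau <= T by apply: ge_sup => //; exists 0.
have tau0 : 0 <= tau by apply: ub_le_sup => //; exists T.
have Stau : F tau <= K * tau.
  apply/ler_addgt0Pr => e e0.
  have LK : 0 < `|L| + `|K| + 1 by rewrite ltr_wpDl// addr_ge0.
  have [t [/andP[t0 tT] Ft] tt] := sup_adherent (divr_gt0 e0 LK) hS.
  have ttau : t <= tau by apply: ub_le_sup; [exists T | split; [rewrite t0 tT|]].
  have := FL _ _ t0 ttau tauT.
  rewrite ler_norml => /andP[_ h].
  have dt : 0 <= tau - t by rewrite subr_ge0.
  have h1 : L * (tau - t) <= `|L| * (tau - t) by rewrite ler_wpM2r// ler_norm.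
  have h2 : - K * (tau - t) <= `|K| * (tau - t).
    by rewrite ler_wpM2r// -normrN ler_norm.
  have h3 : (tau - t) * (`|L| + `|K| + 1) <= e.
    rewrite -ler_pdivlMr//; rewrite -/tau in tt; lra.
  nra.
have [tt|] := ltP tau T; last by move=> h; have -> : T = tau by apply/eqP; rewrite eq_le h tauT.
have [e e0 [eT Fe]] := step _ tau0 tt.
have : tau + e <= tau.
  apply: ub_le_sup; first by exists T.
  split; first by rewrite eT andbT addr_ge0// ltW.
  by rewrite mulrDr; lra.
by rewrite gerDl leNgt e0.
Qed.

End DiniBound.

Section DerivativeBound.
Context d {X : measurableType d} {R : realType}.
Variable mu : {measure set X -> \bar R}.
Variables (E : set X) (h : X -> R -> R) (T L M eta : R).
Hypotheses (mE : measurable E) (Eoo : (mu E < +oo)%E).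
Hypotheses (T0 : 0 < T) (eta0 : 0 < eta).
Hypothesis mh : forall t, 0 <= t <= T -> measurable_fun E (h^~ t).
Hypothesis hL : forall x s t, E x -> 0 <= s <= T -> 0 <= t <= T ->
  `|h x t - h x s| <= L * `|t - s|.
Hypothesis hM : forall t, 0 <= t < T ->
  {ae mu, forall x, E x -> derivable (h x) t 1 /\ derive1 (h x) t <= M}.
Hypothesis hgrow : forall x, E x -> M * T + eta <= h x T - h x 0.

Let c := fine (mu E).

Let c0 : 0 <= c.
Proof. by rewrite /c fine_ge0. Qed.

Let F t := \int[mu]_(x in E) (h x t - h x 0).

Let integ (f : X -> R) K : measurable_fun E f ->
  (forall x, E x -> `|f x| <= K) -> mu.-integrable E (EFin \o f).
Proof. exact: integrable_bounded. Qed.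

Let Rcst r : \int[mu]_(x in E) r = r * c.
Proof. by rewrite Rintegral_cst. Qed.

Let mhB s t : 0 <= s <= T -> 0 <= t <= T -> measurable_fun E (fun x => h x t - h x s).
Proof. by move=> hs ht; apply: measurable_funB; exact: mh. Qed.


Let iB s t : 0 <= s <= T -> 0 <= t <= T ->
  mu.-integrable E (EFin \o (fun x => h x t - h x s)).
Proof.
move=> hs ht; apply: (@integ _ (L * `|t - s|)); first exact: mhB.
by move=> x Ex; exact: hL.
Qed.

Let TT : 0 <= T <= T. Proof. by rewrite lexx (ltW T0). Qed.
Let T00 : 0 <= (0 : R) <= T. Proof. by rewrite lexx (ltW T0). Qed.

Let FB s t : 0 <= s <= T -> 0 <= t <= T -> F t - F s = \int[mu]_(x in E) (h x t - h x s).
Proof.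
move=> hs ht; rewrite /F -RintegralB//; [|exact: iB|exact: iB].
by apply: eq_Rintegral => x _; ring.
Qed.

Let L0 : E !=set0 -> 0 <= L.
Proof.
move=> [x Ex]; have := hL Ex T00 TT; rewrite subr0 (gtr0_norm T0).
by move=> /(le_trans (normr_ge0 _)); rewrite pmulr_lge0.
Qed.

Let step e s : 0 < e -> 0 <= s -> s < T ->
  exists2 r, 0 < r & s + r <= T /\ F (s + r) - F s <= (M * c + e) * r.
Proof.
move=> e0 s0 sT.
pose r n : R := (T - s) / n.+1%:R.
have Ts : 0 < T - s by rewrite subr_gt0.
have r0 n : 0 < r n by rewrite divr_gt0.
have rT n : s + r n <= T.
  rewrite -lerBrDl /r ler_pdivrMr// ler_peMr ?(ltW Ts)//.
  by rewrite ler1n.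
have hs : 0 <= s <= T by rewrite s0 (ltW sT).
have hr n : 0 <= s + r n <= T by rewrite rT addr_ge0// ltW.
pose q n x := (h x (s + r n) - h x s) / r n.
(* the quotients may have no measurable limit, but their truncations from below
   by [M] converge to the constant [M] *)
pose g n x := Num.max (q n x) M.
have mq n : measurable_fun E (q n).
  by apply: measurable_funM; [exact: mhB|exact: measurable_cst].
have qL n x : E x -> `|q n x| <= L.
  move=> Ex; rewrite normrM normfV (gtr0_norm (r0 n)) ler_pdivrMr//.
  have := hL Ex hs (hr n).
  by rewrite (addrC s) addrK (gtr0_norm (r0 n)).
have mg n : measurable_fun E (g n).
  by apply: measurable_maxr => //; exact: measurable_cst.
have gL n x : E x -> `|g n x| <= L + `|M|.
  move=> Ex; have := qL n x Ex; rewrite /g maxEle.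
  case: ifP => _ ?; first by rewrite lerDr; apply: L0; exists x.
  by rewrite ler_wpDr.
have rcvg : r n @[n --> \oo] --> 0.
  rewrite -(mulr0 (T - s)); apply: cvgM; first exact: cvg_cst.
  exact: cvg_harmonic.
have gM : {ae mu, forall x, E x -> (EFin \o g n) x @[n --> \oo] --> (M%:E : \bar R)}.
  have hM' := hM (introT andP (conj s0 sT)).
  apply: filterS hM' => x /[apply] -[dx dM].
  have rd : r n @[n --> \oo] --> (0 : R)^'.
    move=> A /= /rcvg hA; have {}hA : \forall n \near \oo, r n != 0 -> A (r n) by exact: hA.
    change (\forall n \near \oo, A (r n)); apply: filterS hA => n; apply.
    by rewrite gt_eqF.
  have qc : q n x @[n --> \oo] --> derive1 (h x) s.
    have -> : (fun n => q n x) =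
        (fun y => y^-1 *: (h x (y + s) - h x s)) \o r.
      by apply/funext => n; rewrite /q /= (addrC s) mulrC.
    apply: cvg_comp rd _; rewrite derive1E /derive /=.
    under eq_fun do rewrite -[X in h x (X + s)]mulr1.
    exact: dx.
  have -> : M = Num.max (derive1 (h x) s) M by rewrite max_r.
  have gc : g n x @[n --> \oo] --> Num.max (derive1 (h x) s) M.
    exact: (cvg_comp (q^~ x) (id \max cst M) qc
      (@continuous_max _ _ id (cst M) _ cvg_id (cvg_cst _))).
  by apply/cvg_EFin; [near=> n | exact: gc].
have ig : mu.-integrable E (EFin \o (fun=> L + `|M|)).
  by apply: (@integ _ `|L + `|M| |).
have [|||_ _ cv] := @dominated_convergence _ X R mu E mE (fun n => EFin \o g n)
  (fun=> M%:E) (EFin \o (fun=> L + `|M|)) _ _ gM ig _.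
- by move=> n; apply/measurable_EFinP.
- by [].
- by apply: aeW => x n Ex; rewrite /= lee_fin gL.
have gint n : mu.-integrable E (EFin \o g n) by apply: integ (mg n) (gL n).
have qint n : mu.-integrable E (EFin \o q n) by apply: integ (mq n) (qL n).
have {}cv : (\int[mu]_(x in E) g n x) @[n --> \oo] --> M * c.
  by rewrite -Rcst; apply: fine_cvg; rewrite fineK//; apply: integrable_fin_num => //;
    exact: (@integ _ `|M|).
have /cvgr_lt/(_ (M * c + e)) : (\int[mu]_(x in E) g n x) @[n --> \oo] --> M * c by [].
rewrite ltrDl => /(_ e0)[n _ /(_ n (leqnn n))] /= hn.
exists (r n) => //; split; first exact: rT.
rewrite FB//.
have -> : \int[mu]_(x in E) (h x (s + r n) - h x s) = r n * \int[mu]_(x in E) q n x.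
  rewrite -RintegralZl//; apply: eq_Rintegral => x _.
  by rewrite /q mulrC divfK// gt_eqF.
rewrite mulrC ler_wpM2r ?(ltW (r0 n))//; apply: le_trans (ltW hn).
by apply: le_Rintegral => // x Ex; rewrite /g le_max lexx.
Unshelve. all: by end_near. Qed.

(** At a fixed time the derivative may fail to exist on a null set of points,
    which moves with time. Integrating over [E] hides these sets: by dominated
    convergence the integral of [h x t] grows at rate at most [M * mu E],
    whereas it grows by at least [(M * T + eta) * mu E] in total. *)
Lemma ae_derivative_bound : mu E = 0.
Proof.
have F0 : F 0 = 0 by rewrite /F; under eq_Rintegral do rewrite subrr; rewrite Rcst mul0r.
have muE : (mu E)%E = c%:E by rewrite /c fineK// ge0_fin_numE.
have grow : (M * T + eta) * c <= F T.
  rewrite -Rcst /F; apply: le_Rintegral => //; last exact: iB.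
  exact: (@integ _ `|M * T + eta|).
have up e : 0 < e -> F T <= (M * c + e) * T.
  move=> e0; apply: (@dini_bound _ F T _ (L * c)) => //; first exact: ltW.
  - by rewrite F0.
  - move=> s t s0 st tT.
    have hs : 0 <= s <= T by rewrite s0 (le_trans st).
    have ht : 0 <= t <= T by rewrite tT (le_trans s0).
    rewrite FB//; apply: le_trans (le_normr_Rintegral mE (iB hs ht)) _.
    rewrite -mulrA (mulrC c) mulrA -Rcst; apply: le_Rintegral => //.
    + apply: (@integ _ (L * `|t - s|)); first exact: measurableT_comp (mhB hs ht).
      by move=> x Ex; rewrite normr_id hL.
    + exact: (@integ _ `|L * (t - s)|).
    + by move=> x Ex; apply: le_trans (hL Ex hs ht) _; rewrite (ger0_norm (_ : 0 <= t - s)) ?subr_ge0.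
  - by move=> s s0 sT; exact: step.
rewrite muE; have [c1|->//] : 0 < c \/ c = 0.
  by move: c0; rewrite le_eqVlt => /orP[/eqP <-|]; [right|left].
have ec : 0 < eta * c / (2 * T) by rewrite divr_gt0 ?mulr_gt0.
have := le_trans grow (up _ ec).
have -> : (M * c + eta * c / (2 * T)) * T = M * c * T + eta * c / 2 by field; rewrite gt_eqF.
by move=> hle; exfalso; have := mulr_gt0 eta0 c1; lra.
Qed.

End DerivativeBound.

(** * Characters on the unit cube *)

Section CubeCharacters.
Context {R : realType}.

Lemma sin_period (k : int) (b : R) : sin (2 * pi * k%:~R + b) = sin b.
Proof.
have := cis_int (intr_int R k) => /(congr1 (@complex.Im R)) /= s0.
have := cis_int (intr_int R k) => /(congr1 (@complex.Re R)) /= c1.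
by rewrite sinD s0 c1 mul0r mul1r add0r.
Qed.

Lemma measurable_onecos d (T : measurableType d) (f : T -> R) :
  measurable_fun setT f -> measurable_fun setT (fun x => (1 + cos (f x))%:E).
Proof.
move=> mf; apply/measurable_EFinP; apply: measurable_funD => //.
by apply: (measurableT_comp _ mf); exact: continuous_measurable_fun (@continuous_cos R).
Qed.

Lemma onecos_ge0 (x : R) : 0 <= 1 + cos x.
Proof. by have := cos_geN1 x; lra. Qed.

(** Adding [1] keeps the integrand nonnegative, so that Tonelli applies. *)
Lemma integral_uniform_onecos (k : int) (b : R) : k != 0 ->
  (\int[uniform_prob (@ltr01 R)]_x (1 + cos (2 * pi * (k%:~R * x) + b))%:E = 1)%E.
Proof.
move=> k0; pose a : R := 2 * pi * k%:~R.
have a0 : a != 0 by rewrite !mulf_neq0 ?intr_eq0// gt_eqF ?pi_gt0.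
have aE x : 2 * pi * (k%:~R * x) = a * x by rewrite /a mulrA.
under eq_integral do rewrite aE.
have clin : continuous (fun x : R => a * x + b).
  by move=> x; apply: cvgD; [apply: cvgM; [exact: cvg_cst|exact: cvg_id]|exact: cvg_cst].
have cf : continuous (fun x => 1 + cos (a * x + b)).
  move=> x; apply: cvgD; first exact: cvg_cst.
  by apply: continuous_comp; [exact: clin|exact: continuous_cos].
have mf := measurable_onecos (continuous_measurable_fun clin).
rewrite (integral_uniform _ mf); last by move=> x; rewrite lee_fin onecos_ge0.
rewrite subr0 invr1 mul1e.
pose F x := x + a^-1 * sin (a * x + b).
have dF (x : R) : is_derive x (1 : R) F (1 + cos (a * x + b)).
  have d1 : is_derive x (1 : R) (fun x : R => a * x + b) a.
    by apply: is_derive_eq; rewrite addr0 -[X in _ = X]mulr1.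
  have d2 : is_derive x (1 : R) (fun x => sin (a * x + b)) (cos (a * x + b) * a).
    exact: (@is_derive1_comp _ (@sin R) (fun x => a * x + b)).
  rewrite /F; apply: is_derive_eq.
  rewrite -[a^-1 *: _]/(a^-1 * _) [a^-1 * _]mulrC mulfK//.
rewrite (@continuous_FTC2 _ _ F) //; last 3 first.
- exact: continuous_subspaceT.
- split.
  + by move=> x _; case: (dF x).
  + apply: cvg_at_right_filter; apply: differentiable_continuous.
    by apply/derivable1_diffP; case: (dF 0).
  + apply: cvg_at_left_filter; apply: differentiable_continuous.
    by apply/derivable1_diffP; case: (dF 1).
- by move=> x _; rewrite derive1E; case: (dF x).
rewrite -EFinB; congr (_%:E).
by rewrite /F mulr0 add0r mulr1 /a sin_period add0r addrK.
Qed.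

Definition cube_dot n (k : 'rV[int]_n) (t : n.-tuple (measurableTypeR R)) : R :=
  \sum_i (k 0 i)%:~R * tnth t i.

Lemma measurable_cube_dot n (k : 'rV[int]_n) b :
  measurable_fun setT (fun t => 2 * pi * cube_dot k t + b).
Proof.
apply: measurable_funD => //; apply: measurable_funM => //.
apply: measurable_sum => i; apply: measurable_funM => //; exact: measurable_tnth.
Qed.

(** Induction on the dimension: integrate first in the remaining variables if
    one of them occurs, else in the first variable. *)
Lemma integral_cube_onecos n (k : 'rV[int]_n) (b : R) : k != 0 ->
  (\int[cube_prob R n]_t (1 + cos (2 * pi * cube_dot k t + b))%:E = 1)%E.
Proof.
elim: n k b => [|n IH] k b k0.
  by case/eqP: k0; apply/rowP => -[].
pose k' : 'rV[int]_n := \row_i k 0 (fintype.lift ord0 i).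
have cube_dotE x t : cube_dot k (tuple_cons (x, t)) = (k 0 ord0)%:~R * x + cube_dot k' t.
  rewrite /cube_dot big_ord_recl /=; congr (_ + _).
  by apply: eq_bigr => i _; rewrite mxE tnthS.
rewrite /= (ge0_integral_distribution _ (measurable_onecos (measurable_cube_dot k b))); last first.
  by move=> y; rewrite lee_fin onecos_ge0.
have mf : measurable_fun setT (fun z : measurableTypeR R * n.-tuple (measurableTypeR R) =>
    (1 + cos (2 * pi * cube_dot k (tuple_cons z) + b))%:E).
  apply: measurable_onecos; apply: (measurableT_comp (measurable_cube_dot k b)).
  exact: measurable_tuple_cons.
have f0 z : (0 <= (1 + cos (2 * pi * cube_dot k (@tuple_cons R n z) + b))%:E)%E.
  by rewrite lee_fin onecos_ge0.
have [k'0|k'0] := eqVneq k' 0.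
  have kn0 : k 0 ord0 != 0.
    apply: contra_neq k0 => e; apply/rowP => i; rewrite [RHS]mxE.
    case: (unliftP ord0 i) => [j|] ->; last exact: e.
    by have := congr1 (fun v : 'rV[int]_n => v 0 j) k'0; rewrite !mxE.
  rewrite [LHS](@fubini_tonelli2 _ _ _ _ _ (uniform_prob (@ltr01 R)) (cube_prob R n) _ mf f0).
  rewrite /fubini_G.
  under eq_integral => t _.
    under eq_integral => x _ do rewrite /= cube_dotE mulrDr -addrA.
    rewrite integral_uniform_onecos//; over.
  by rewrite integral_cst// mul1e; exact: probability_setT.
rewrite [LHS](@fubini_tonelli1 _ _ _ _ _ (uniform_prob (@ltr01 R)) (cube_prob R n) _ mf f0).
rewrite /fubini_F.
under eq_integral => x _.
  under eq_integral => t _ do rewrite /= cube_dotE mulrDr addrAC (addrC _ (2 * pi * cube_dot k' t)).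
  rewrite IH//; over.
by rewrite integral_cst// mul1e; exact: probability_setT.
Qed.

End CubeCharacters.

(** * The torus *)

Section TorusBasics.
Context {R : realType} {n : nat}.
Local Notation proj := (@torus_proj R n).

Lemma torus_reprK (p : torus R n) : torus_proj (torus_repr p) = p.
Proof. exact: (@reprK _ (quotient_topology {eq_quot torus_equiv R n}%qT) p). Qed.

Lemma torus_projP (x y : 'rV[R]_n) :
  torus_proj x = torus_proj y <-> forall i, x 0 i - y 0 i \is a Num.int.
Proof.
split.
  by move/(@eqquotP _ _ {eq_quot torus_equiv R n}%qT) => /forallP.
move=> h; apply/(@eqquotP _ _ {eq_quot torus_equiv R n}%qT); exact/forallP.
Qed.

Lemma torus_projD (x z : 'rV[R]_n) : (forall i, z 0 i \is a Num.int) ->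
  torus_proj (x + z) = torus_proj x.
Proof. by move=> zi; apply/torus_projP => i; rewrite mxE addrAC subrr add0r. Qed.

Lemma torus_repr_proj (x : 'rV[R]_n) :
  exists2 z : 'rV[R]_n, (forall i, z 0 i \is a Num.int) &
    torus_repr (torus_proj x) = x + z.
Proof.
exists (torus_repr (torus_proj x) - x); last by rewrite subrKC.
move=> i; rewrite !mxE; move: i; apply/torus_projP; exact: torus_reprK.
Qed.

Lemma continuous_torus_proj : continuous proj.
Proof. exact: (@pi_continuous _ {eq_quot torus_equiv R n}%qT). Qed.

Lemma continuous_torusP (U : topologicalType) (f : torus R n -> U) :
  continuous f <-> continuous (f \o proj).
Proof. exact: (@quotient_continuous _ {eq_quot torus_equiv R n}%qT). Qed.

Lemma liftK (T : Type) (F : 'rV[R]_n -> T) x :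
  (forall x z : 'rV[R]_n, (forall i, z 0 i \is a Num.int) -> F (x + z) = F x) ->
  F (torus_repr (torus_proj x)) = F x.
Proof. by move=> Fper; have [z zi ->] := torus_repr_proj x; exact: Fper. Qed.

Lemma measurable_torus_open (U : set (torus R n)) : open U -> measurable U.
Proof. by move=> oU; exact: sub_sigma_algebra. Qed.

Lemma continuous_torus_measurable (f : torus R n -> R) :
  continuous f -> measurable_fun setT f.
Proof.
move=> /continuousP cf; apply: (measurability _ (RGenOpens.measurableE R)).
move=> _ [_ [a [b ->]] <-]; rewrite setTI; apply: measurable_torus_open.
apply: cf; exact: interval_open.
Qed.

Definition torus_shift (v : 'rV[R]_n) (p : torus R n) : torus R n :=
  torus_proj (torus_repr p + v).

Lemma torus_shiftE v x : torus_shift v (torus_proj x) = torus_proj (x + v).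
Proof.
rewrite /torus_shift; have [z zi ->] := torus_repr_proj x.
by rewrite addrAC (torus_projD _ zi).
Qed.

Lemma continuous_torus_shift v : continuous (torus_shift v).
Proof.
apply/continuous_torusP.
have -> : torus_shift v \o proj = proj \o (fun x => x + v).
  by apply/funext => x /=; rewrite torus_shiftE.
have cadd : continuous (fun x : 'rV[R]_n => x + v).
  by move=> x; exact: (continuousD (@cvg_id _ _) (cvg_cst _)).
move=> x; exact: (@continuous_comp _ _ _ (fun x : 'rV[R]_n => x + v : 'rV[R]_n) proj x (cadd x)
  (@continuous_torus_proj _)).
Qed.

Lemma measurable_torus_shift v : measurable_fun setT (torus_shift v).
Proof.
apply: (@measurability _ _ _ _ _ _ (@torus_open R n)) => //.
move=> _ [U oU <-]; rewrite setTI; apply: measurable_torus_open.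
by have /continuousP := continuous_torus_shift (v := v); exact.
Qed.

Lemma dotz_int (k : 'rV[int]_n) (z : 'rV[R]_n) :
  (forall i, z 0 i \is a Num.int) -> dotz k z \is a Num.int.
Proof. by move=> zi; apply: rpred_sum => i _; rewrite rpredM// intr_int. Qed.

Lemma cos_mode_per k (x z : 'rV[R]_n) : (forall i, z 0 i \is a Num.int) ->
  cos_mode k (x + z) = cos_mode k x.
Proof.
move=> /(dotz_int k)/cis_int; rewrite /cos_mode dotzDr mulrDr cosD => -[-> ->].
by rewrite mulr1 mulr0 subr0.
Qed.

Lemma sin_mode_per k (x z : 'rV[R]_n) : (forall i, z 0 i \is a Num.int) ->
  sin_mode k (x + z) = sin_mode k x.
Proof.
move=> /(dotz_int k)/cis_int; rewrite /sin_mode dotzDr mulrDr sinD => -[-> ->].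
by rewrite mulr1 mulr0 addr0.
Qed.

Definition torus_cos (k : 'rV[int]_n) (p : torus R n) : R := cos_mode k (torus_repr p).
Definition torus_sin (k : 'rV[int]_n) (p : torus R n) : R := sin_mode k (torus_repr p).

Lemma torus_cosE k x : torus_cos k (torus_proj x) = cos_mode k x.
Proof. by apply: (liftK (F := cos_mode k)) => ? ?; exact: cos_mode_per. Qed.

Lemma torus_sinE k x : torus_sin k (torus_proj x) = sin_mode k x.
Proof. by apply: (liftK (F := sin_mode k)) => ? ?; exact: sin_mode_per. Qed.

Lemma continuous_dotz (k : 'rV[int]_n) : continuous (dotz k : 'rV[R]_n -> R).
Proof.
apply: continuous_big => [|i _ x]; first exact: add_continuous.
exact: (continuousM (cvg_cst _) (@coord_continuous _ _ _ _ _ x)).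
Qed.

Lemma continuous_cos_mode k : continuous (@cos_mode R n k).
Proof.
move=> x; apply: (continuous_comp (f := fun x => 2 * pi * dotz k x)).
  exact: (continuousM (cvg_cst _) (@continuous_dotz k x)).
exact: continuous_cos.
Qed.

Lemma continuous_sin_mode k : continuous (@sin_mode R n k).
Proof.
move=> x; apply: (continuous_comp (f := fun x => 2 * pi * dotz k x)).
  exact: (continuousM (cvg_cst _) (@continuous_dotz k x)).
exact: continuous_sin.
Qed.

Lemma continuous_torus_cos k : continuous (torus_cos k).
Proof.
apply/continuous_torusP; rewrite (_ : _ \o _ = cos_mode k); first exact: continuous_cos_mode.
by apply/funext => x /=; rewrite torus_cosE.
Qed.

Lemma continuous_torus_sin k : continuous (torus_sin k).
Proof.
apply/continuous_torusP; rewrite (_ : _ \o _ = sin_mode k); first exact: continuous_sin_mode.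
by apply/funext => x /=; rewrite torus_sinE.
Qed.

Variable mu : probability (torus R n) R.

Lemma integrable_torus_cos k : mu.-integrable setT (EFin \o torus_cos k).
Proof.
apply: (@prob_integrable _ _ _ mu _ 1); last by move=> x; exact: cos_max.
by apply: continuous_torus_measurable; exact: continuous_torus_cos.
Qed.

Lemma integrable_torus_sin k : mu.-integrable setT (EFin \o torus_sin k).
Proof.
apply: (@prob_integrable _ _ _ mu _ 1); last by move=> x; exact: sin_max.
by apply: continuous_torus_measurable; exact: continuous_torus_sin.
Qed.

Lemma int_torus_cos0 : \int[mu]_p torus_cos 0 p = 1.
Proof.
rewrite -[RHS](prob_Rint_cst mu); apply: eq_Rintegral => p _.
by rewrite /torus_cos /cos_mode dotz0l mulr0 cos0.
Qed.

Lemma int_torus_sin0 : \int[mu]_p torus_sin 0 p = 0.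
Proof.
rewrite -[RHS](prob_Rint_cst mu); apply: eq_Rintegral => p _.
by rewrite /torus_sin /sin_mode dotz0l mulr0 sin0.
Qed.

(** Continuous functions on the torus are bounded, being determined by their
    values on the compact unit cube. *)
Lemma torus_bounded (f : torus R n -> R) : continuous f -> exists K, forall p, `|f p| <= K.
Proof.
move=> /continuous_torusP cf.
pose cube := [set x : 'rV[R]_n | forall i, `[0, 1]%classic (x 0 i)].
have ccube : compact cube.
  exact: (@rV_compact R n (fun=> `[0, 1]%classic) (fun=> @segment_compact R 0 1)).
have : compact ((f \o proj) @` cube).
  by apply: continuous_compact => //; exact: (continuous_subspaceT cf).
move=> /compact_bounded [K [_ hK]]; exists (K + 1) => p.
apply: (hK (K + 1)); first by rewrite ltrDl.
exists (\row_i (torus_repr p 0 i - (Num.floor (torus_repr p 0 i))%:~R)).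
  move=> i; rewrite mxE /= in_itv /=.
  set t := torus_repr p 0 i; have := floor_itv t; rewrite intrD.
  set w := (Num.floor t)%:~R => /andP[h1 h2]; apply/andP; split; lra.
rewrite /= -[in RHS](torus_reprK p); congr f; apply/torus_projP => i.
by rewrite mxE addrAC subrr add0r rpredN intr_int.
Qed.

Lemma integrable_continuous_torus (f : torus R n -> R) :
  continuous f -> mu.-integrable setT (EFin \o f).
Proof.
move=> cf; have [K fK] := torus_bounded cf.
exact: (prob_integrable mu (continuous_torus_measurable cf) fK).
Qed.

End TorusBasics.

(** * Fourier coefficients of measures *)

Section IntegralTools.
Context d {X : measurableType d} {R : realType}.

Lemma Rintegral_lincomb (mu : {measure set X -> \bar R}) (I : Type) (s : seq I)
    (f : I -> X -> R) :
  (forall i, mu.-integrable setT (EFin \o f i)) ->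
  mu.-integrable setT (EFin \o (fun x => \sum_(i <- s) f i x)) /\
  \int[mu]_x (\sum_(i <- s) f i x) = \sum_(i <- s) \int[mu]_x f i x.
Proof.
move=> fi; elim: s => [|i s [IHi IHe]].
  split; last by rewrite big_nil; under eq_Rintegral do rewrite big_nil; rewrite Rintegral_cst// mul0r.
  have -> : EFin \o (fun x => \sum_(i <- [::]) f i x) = cst 0%E.
    by apply/funext => x /=; rewrite big_nil.
  exact: integrable0.
split.
  have := integrableD measurableT (fi i) IHi.
  congr (_.-integrable _ _); apply/funext => x /=; by rewrite big_cons.
under eq_Rintegral do rewrite big_cons.
by rewrite RintegralD// big_cons IHe.
Qed.

Lemma Rintegral_distribution d' (Y : measurableType d') (P : probability X R)
    (phi : {mfun X >-> Y}) (f : Y -> R) K : measurable_fun setT f ->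
  (forall y, `|f y| <= K) ->
  \int[distribution P phi]_y f y = \int[P]_x f (phi x).
Proof.
move=> mf fK; rewrite /Rintegral integral_distribution//; first exact/measurable_EFinP.
apply: (@prob_integrable _ _ _ P (fun x => f (phi x)) K) => //.
exact: measurableT_comp.
Qed.

End IntegralTools.

Section LebesgueCoefficients.
Context {R : realType} {n : nat}.

Lemma lebesgue_torus_onecos (k : 'rV[int]_n) (b : R) (f : torus R n -> R) :
  k != 0 -> continuous f ->
  (forall t : n.-tuple (measurableTypeR R),
    f (tuple_torus t) = cos (2 * pi * cube_dot k t + b)) ->
  \int[lebesgue_torus R n]_p f p = 0.
Proof.
move=> k0 cf fE.
rewrite /lebesgue_torus.
have [K fK] := torus_bounded cf.
rewrite (Rintegral_distribution _ _ (continuous_torus_measurable cf) fK).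
under eq_Rintegral do rewrite fE.
have mc : measurable_fun setT (fun t : n.-tuple (measurableTypeR R) => cos (2 * pi * cube_dot k t + b)).
  by apply: (measurableT_comp _ (measurable_cube_dot k b)); exact: continuous_measurable_fun (@continuous_cos R).
have ic := prob_integrable (cube_prob R n) mc (fun t => cos_max _).
have i1 : (cube_prob R n).-integrable setT (EFin \o (fun=> 1)).
  exact: finite_measure_integrable_cst.
have := integral_cube_onecos b k0 => /(congr1 fine).
rewrite -[fine _]/(\int[cube_prob R n]_t (1 + cos (2 * pi * cube_dot k t + b))).
rewrite RintegralD// (prob_Rint_cst (cube_prob R n)) /= => /eqP.
by rewrite -subr_eq0 addrAC subrr add0r => /eqP.
Qed.

Lemma dotz_tuple (k : 'rV[int]_n) (t : n.-tuple (measurableTypeR R)) :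
  dotz k (\row_i tnth t i) = cube_dot k t.
Proof. by apply: eq_bigr => i _; rewrite mxE. Qed.

Lemma lebesgue_torus_cos k : k != 0 -> \int[lebesgue_torus R n]_p torus_cos k p = 0.
Proof.
move=> k0; apply: (lebesgue_torus_onecos (b := 0) k0 (continuous_torus_cos (k := k))) => t.
by rewrite /tuple_torus torus_cosE /cos_mode dotz_tuple addr0.
Qed.

Lemma lebesgue_torus_sin k : k != 0 -> \int[lebesgue_torus R n]_p torus_sin k p = 0.
Proof.
move=> k0; apply: (lebesgue_torus_onecos (b := - (pi / 2)) k0 (continuous_torus_sin (k := k))) => t.
by rewrite /tuple_torus torus_sinE /sin_mode dotz_tuple cosBpihalf.
Qed.

End LebesgueCoefficients.

Section FourierTransport.
Context {R : realType} {n : nat}.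
Implicit Types mu nu : probability (torus R n) R.

(** The sum norm makes the condition additive over coordinate directions. *)
Definition sumnorm_lip (L : R) (f : torus R n -> R) :=
  forall x h : 'rV[R]_n, `|lift f (x + h) - lift f x| <= L * \sum_i `|h 0 i|.

Lemma lift_per (f : torus R n -> R) (x z : 'rV[R]_n) :
  (forall i, z 0 i \is a Num.int) -> lift f (x + z) = lift f x.
Proof. by move=> zi; rewrite /lift torus_projD. Qed.

Lemma lip_continuous (L : R) (f : torus R n -> R) : sumnorm_lip L f -> continuous f.
Proof.
move=> fL; apply/continuous_torusP => x.
apply/(@cvgrPdist_le _ R^o _ (nbhs (x : 'rV[R]_n)) (nbhs_filter (x : 'rV[R]_n))) => e e0.
pose r := e / (`|L| * n%:R + 1).
have q0 : 0 < `|L| * n%:R + 1 by rewrite ltr_wpDl// mulr_ge0.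
have r0 : 0 < r by rewrite divr_gt0.
apply/nbhs_ballP; exists r => //= y [_ yx].
rewrite distrC -[y](subrKC x) /=; apply: le_trans (fL _ _) _.
apply: (@le_trans _ _ (`|L| * (n%:R * r))).
  apply: (@le_trans _ _ (`|L| * \sum_i `|(y - x) 0 i|)).
    by rewrite ler_wpM2r ?sumr_ge0// ler_norm.
  rewrite ler_wpM2l//; apply: (@le_trans _ _ (\sum_(i < n) r)).
    by apply: ler_sum => i _; rewrite !mxE distrC ltW//; exact: yx.
  by rewrite sumr_const card_ord mulr_natl.
by rewrite mulrA /r mulrA ler_pdivrMr// mulrC ler_wpM2l ?(ltW e0)// lerDl.
Qed.

(** The integral of [trig_approx] with respect to [mu]. *)
Definition fourier_mean (M : nat) (F : 'rV[R]_n -> R) mu : R :=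
  (((2 * M)%N%:R * (M%:R / 2)) ^+ n)^-1 *
  \sum_(l : {ffun 'I_n -> 'I_M}) \sum_(l' : {ffun 'I_n -> 'I_M}) box_weight l * box_weight l' *
    (cos_coef M F (freq l l') * \int[mu]_p torus_cos (freq l l') p +
     sin_coef M F (freq l l') * \int[mu]_p torus_sin (freq l l') p).

(** Integrate the uniform approximation: the mean depends on the measure through
    its Fourier coefficients only. *)
Lemma fourier_meanP (M : nat) (L : R) (f : torus R n -> R) mu :
  (2 <= M)%N -> 0 <= L -> sumnorm_lip L f ->
  `|\int[mu]_p f p - fourier_mean M (lift f) mu| <= L * n%:R * (5 / M%:R).
Proof.
move=> M2 L0 fL.
pose g (ll : {ffun 'I_n -> 'I_M} * {ffun 'I_n -> 'I_M}) (p : torus R n) : R :=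
  box_weight ll.1 * box_weight ll.2 * (cos_coef M (lift f) (freq ll.1 ll.2) * torus_cos (freq ll.1 ll.2) p +
     sin_coef M (lift f) (freq ll.1 ll.2) * torus_sin (freq ll.1 ll.2) p).
pose c : R := (((2 * M)%N%:R * (M%:R / 2)) ^+ n)^-1.
have iZ (a : R) (h : torus R n -> R) : mu.-integrable setT (EFin \o h) ->
    mu.-integrable setT (EFin \o (fun p => a * h p)).
  by move=> ih; have := integrableZl measurableT a ih.
have iab ll : mu.-integrable setT (EFin \o (fun p =>
   cos_coef M (lift f) (freq ll.1 ll.2) * torus_cos (freq ll.1 ll.2) p +
     sin_coef M (lift f) (freq ll.1 ll.2) * torus_sin (freq ll.1 ll.2) p)).
  have := integrableD measurableT
    (iZ (cos_coef M (lift f) (freq ll.1 ll.2)) _ (integrable_torus_cos mu (freq ll.1 ll.2)))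
    (iZ (sin_coef M (lift f) (freq ll.1 ll.2)) _ (integrable_torus_sin mu (freq ll.1 ll.2))).
  by [].
have ig ll : mu.-integrable setT (EFin \o g ll) by apply: iZ; exact: iab.
have [isum esum] := Rintegral_lincomb (index_enum _) ig.
have -> : fourier_mean M (lift f) mu = \int[mu]_p (c * \sum_ll g ll p).
  rewrite RintegralZl// esum /fourier_mean -/c pair_big /=; congr (_ * _).
  apply: eq_bigr => ll _; rewrite /g RintegralZl//; congr (_ * _).
  rewrite RintegralD ?RintegralZl//.
  - exact: integrable_torus_sin.
  - exact: integrable_torus_cos.
  - apply: iZ; exact: integrable_torus_cos.
  - apply: iZ; exact: integrable_torus_sin.
apply: prob_Rint_dist.
- exact/integrable_continuous_torus/lip_continuous/fL.
- exact: iZ.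
move=> p; have := trig_approxP M2 (@lift_per f) fL L0 (torus_repr p).
rewrite {1}/lift torus_reprK trig_approxE//.
rewrite pair_big /=; exact.
Qed.

End FourierTransport.

Section FourierUniqueness.
Context {R : realType} {n : nat}.
Variables mu nu : probability (torus R n) R.
Hypothesis eq_cos : forall k, \int[mu]_p torus_cos k p = \int[nu]_p torus_cos k p.
Hypothesis eq_sin : forall k, \int[mu]_p torus_sin k p = \int[nu]_p torus_sin k p.

Lemma fourier_unique_lip (L : R) (f : torus R n -> R) : 0 <= L -> sumnorm_lip L f ->
  \int[mu]_p f p = \int[nu]_p f p.
Proof.
move=> L0 fL; apply/eqP; rewrite -subr_eq0 -normr_le0; apply/ler_addgt0Pr => e e0.
rewrite add0r.
(* [10 = 5 + 5], one error term of [fourier_meanP] for each measure *)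
pose K := L * n%:R * 10.
have K0 : 0 <= K by rewrite !mulr_ge0.
pose M := (Num.truncn (K / e)).+2.
have KM : K / M%:R <= e.
  rewrite ler_pdivrMr// mulrC -ler_pdivrMr//; apply: le_trans (ltW (truncnS_gt _)) _.
  by rewrite ler_nat.
have h1 := fourier_meanP mu (isT : (2 <= M)%N) L0 fL.
have h2 := fourier_meanP nu (isT : (2 <= M)%N) L0 fL.
have e12 : fourier_mean M (lift f) mu = fourier_mean M (lift f) nu.
  congr (_ * _); apply: eq_bigr => l _; apply: eq_bigr => l' _.
  by rewrite eq_cos eq_sin.
rewrite e12 in h1; apply: le_trans KM.
have -> : K / M%:R = L * n%:R * (5 / M%:R) + L * n%:R * (5 / M%:R) by rewrite /K; field; rewrite pnatr_eq0.
apply: le_trans (ler_distD (fourier_mean M (lift f) nu) _ _) _.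
by apply: lerD => //; rewrite distrC.
Qed.

Let dist (C : set 'rV[R]_n) (x : 'rV[R]_n) : R :=
  inf [set \sum_i `|x 0 i - y 0 i| | y in C].

Let dist_lb (C : set 'rV[R]_n) (x : 'rV[R]_n) : lbound [set \sum_i `|x 0 i - y 0 i| | y in C] (0 : R).
Proof. by move=> _ [y _ <-]; apply: sumr_ge0. Qed.

Let dist_ge0 C x : C !=set0 -> 0 <= dist C x.
Proof.
move=> [y Cy]; apply: lb_le_inf; last exact: dist_lb.
by exists (\sum_i `|x 0 i - y 0 i|), y.
Qed.

Let dist_lip C x h : C !=set0 -> dist C (x + h) <= dist C x + \sum_i `|h 0 i|.
Proof.
move=> C0; rewrite -lerBlDr; apply: lb_le_inf.
  by case: C0 => y Cy; exists (\sum_i `|x 0 i - y 0 i|), y.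
move=> _ [y Cy <-]; rewrite lerBlDr.
apply: (@le_trans _ _ (\sum_i `|(x + h) 0 i - y 0 i|)).
  apply: ge_inf; last by exists y.
  by exists 0; exact: dist_lb.
rewrite -big_split /=; apply: ler_sum => i _.
by rewrite mxE addrAC ler_normD.
Qed.

(** Open sets generate the sigma-algebra, and the indicator of an open set is
    the limit of the Lipschitz functions [min 1 (m d)], where [d] is the
    distance to the complement. *)
Lemma fourier_unique A : measurable A -> mu A = nu A.
Proof.
apply: (measure_unique (@torus_open R n) (fun=> setT)) => //.
- by move=> U V; exact: openI.
- by move=> _; exact: openT.
- by rewrite bigcup_const.
- move=> U oU; have [->|] := eqVneq U setT.
    transitivity (1%E : \bar R); first exact: probability_setT.
    by apply: esym; exact: probability_setT.
  move=> /eqP/eqP UT; pose W := @torus_proj R n @^-1` U.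
  have oW : open W by have /continuousP := @continuous_torus_proj R n; exact.
  have C0 : ~` W !=set0.
    have /setTPn [p Up] := UT; exists (torus_repr p) => /=.
    by rewrite /W /= torus_reprK.
  pose D := dist (~` W).
  have Dper (x z : 'rV[R]_n) : (forall i, z 0 i \is a Num.int) -> D (x + z) = D x.
    have le1 (y w : 'rV[R]_n) : (forall i, w 0 i \is a Num.int) -> D y <= D (y + w).
      move=> wi; apply: lb_le_inf.
        by case: C0 => c Cc; exists (\sum_i `|(y + w) 0 i - c 0 i|), c.
      move=> _ [c Cc <-]; apply: ge_inf; first by exists 0; exact: dist_lb.
      exists (c - w).
        move=> /= h; apply: Cc; rewrite /W /=.
        rewrite -(@torus_projD R n c (- w))// => i; by rewrite mxE rpredN.
      by apply: eq_bigr => i _; rewrite !mxE; congr (`|_|); ring.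
    move=> zi; apply/eqP; rewrite eq_le le1// andbT.
    have := le1 (x + z) (- z); rewrite addrK; apply => i; by rewrite mxE rpredN.
  pose g (m : nat) (p : torus R n) : R := Num.min 1 (m%:R * D (torus_repr p)).
  have gE m (x : 'rV[R]_n) : lift (g m) x = Num.min 1 (m%:R * D x).
    by rewrite /lift /g (liftK (F := D)).
  have g0 m p : 0 <= g m p.
    by rewrite /g le_min ler01 mulr_ge0// dist_ge0.
  have g1 m p : g m p <= 1 by rewrite /g ge_min lexx.
  have Dl (x h : 'rV[R]_n) : `|D (x + h) - D x| <= \sum_i `|h 0 i|.
    rewrite ler_distl lerBlDr dist_lip// andbT.
    have := dist_lip (x + h) (- h) C0; rewrite addrK => /le_trans; apply.
    by rewrite lerD2l ler_sum// => i _; rewrite mxE normrN.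
  have gl m : sumnorm_lip m%:R (g m).
    move=> x h; rewrite !gE.
    apply: (@le_trans _ _ `|m%:R * D (x + h) - m%:R * D x|); last first.
      by rewrite -mulrBr normrM ger0_norm// ler_wpM2l.
    set a := _ * D (x + h); set b := _ * D x.
    case: (leP 1 a) => a1; case: (leP 1 b) => b1; rewrite ?subrr ?normr0//.
    + by rewrite (ger0_norm (_ : 0 <= 1 - b)) ?(ger0_norm (_ : 0 <= a - b)); lra.
    + by rewrite (ler0_norm (_ : a - 1 <= 0)) ?(ler0_norm (_ : a - b <= 0)); lra.
  have lim (P : probability (torus R n) R) :
      (\int[P]_p (g m p)%:E)%E @[m --> \oo] --> P U.
    have -> : P U = (\int[P]_p (\1_U p)%:E)%E by rewrite integral_indic ?setIT//; exact: measurable_torus_open.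
    have i1 : P.-integrable setT (EFin \o (fun=> 1)).
      exact: finite_measure_integrable_cst.
    have mg m : measurable_fun setT (fun p => (g m p)%:E).
      by apply/measurable_EFinP; apply: continuous_torus_measurable; exact: (lip_continuous (gl m)).
    have mU : measurable_fun setT (fun p => (\1_U p)%:E : \bar R).
      by apply/measurable_EFinP; apply: measurable_indic; exact: measurable_torus_open.
    have cv : {ae P, forall p, setT p -> (fun m => (g m p)%:E) @ \oo --> ((\1_U p)%:E : \bar R)}.
      apply: aeW => p _; apply/cvg_EFin; first by near=> m.
      have [Up|Up] := pselect (U p); last first.
        rewrite indicE memNset//; apply: cvg_near_cst; near=> m.
        suff h : g m p = 0 by rewrite /= h.
        have D0 : D (torus_repr p) = 0.
          apply/eqP; rewrite eq_le dist_ge0// andbT; apply: ge_inf.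
            by exists 0; exact: dist_lb.
          exists (torus_repr p); first by rewrite /W /= torus_reprK.
          by rewrite big1// => i _; rewrite subrr normr0.
        by rewrite /g D0 mulr0 minEle ler10.
      rewrite indicE mem_set//; apply: cvg_near_cst.
      have : nbhs (torus_repr p) W.
        by apply: open_nbhs_nbhs; split=> //; rewrite /W /= torus_reprK.
      move=> /nbhs_ballP[e /= e0 eW].
      have De : e <= D (torus_repr p).
        apply: lb_le_inf; first by case: C0 => y Cy; exists (\sum_i `|torus_repr p 0 i - y 0 i|), y.
        move=> _ [y Cy <-]; rewrite leNgt; apply/negP => lte; apply: Cy; apply: eW.
        split => // i j; rewrite (ord1 i) -ball_normE /=.
        by apply: le_lt_trans lte; rewrite (bigD1 j)//= lerDl sumr_ge0.
      near=> m; rewrite /= /g; apply/min_idPl.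
      apply: (@le_trans _ _ (m%:R * e)); last by rewrite ler_wpM2l.
      rewrite -ler_pdivrMr// mul1r; apply: ltW.
      by near: m; exact: nbhs_infty_gtr.
    have bd : {ae P, forall p m, setT p -> (`|(g m p)%:E| <= (EFin \o (fun=> 1%R)) p)%E}.
      by apply: aeW => p m _; rewrite /= lee_fin ger0_norm.
    by have [_ _ +] := dominated_convergence measurableT mg mU cv i1 bd.
  apply: (cvg_unique _ (lim mu)) => //.
  rewrite (_ : (fun m => _) = fun m => (\int[nu]_p (g m p)%:E)%E); first exact: lim.
  apply/funext => m.
  have gi (P : probability (torus R n) R) : (\int[P]_p (g m p)%:E)%E \is a fin_num.
    by apply: integrable_fin_num => //; apply: integrable_continuous_torus; exact: (lip_continuous (gl m)).
  by rewrite -(fineK (gi mu)) -(fineK (gi nu)); congr (_%:E); exact: (fourier_unique_lip _ (gl m)).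
- move=> _; rewrite -ge0_fin_numE//; exact: fin_num_measure.
Unshelve. all: by end_near. Qed.

End FourierUniqueness.

(** * Translations of the torus *)

Section Translations.
Context {R : realType} {n : nat}.

HB.instance Definition _ (v : 'rV[R]_n) :=
  isMeasurableFun.Build _ _ _ _ (torus_shift v) (@measurable_torus_shift R n v).

Lemma torus_cos_shift (k : 'rV[int]_n) (v : 'rV[R]_n) p : torus_cos k (torus_shift v p) =
  cos_mode k v * torus_cos k p - sin_mode k v * torus_sin k p.
Proof.
rewrite -(torus_reprK p) torus_shiftE !torus_cosE torus_sinE /cos_mode /sin_mode dotzDr mulrDr cosD.
by rewrite mulrC (mulrC (sin _)).
Qed.

Lemma torus_sin_shift (k : 'rV[int]_n) (v : 'rV[R]_n) p : torus_sin k (torus_shift v p) =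
  cos_mode k v * torus_sin k p + sin_mode k v * torus_cos k p.
Proof.
rewrite -(torus_reprK p) torus_shiftE !torus_cosE !torus_sinE /cos_mode /sin_mode dotzDr mulrDr sinD.
by rewrite mulrC; congr (_ + _); rewrite mulrC.
Qed.

Lemma int_torus_cos_shift (mu : probability (torus R n) R) k v :
  \int[distribution mu (torus_shift v)]_p torus_cos k p =
  cos_mode k v * \int[mu]_p torus_cos k p - sin_mode k v * \int[mu]_p torus_sin k p.
Proof.
rewrite (Rintegral_distribution _ _ (continuous_torus_measurable (@continuous_torus_cos R n k)) (fun p => cos_max _)).
under eq_Rintegral do rewrite torus_cos_shift.
have i1 : mu.-integrable setT (EFin \o (fun p => cos_mode k v * torus_cos k p)).
  by have := integrableZl measurableT (cos_mode k v) (integrable_torus_cos mu k).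
have i2 : mu.-integrable setT (EFin \o (fun p => sin_mode k v * torus_sin k p)).
  by have := integrableZl measurableT (sin_mode k v) (integrable_torus_sin mu k).
rewrite (RintegralB measurableT i1 i2) (RintegralZl _ measurableT (integrable_torus_cos mu k)).
by rewrite (RintegralZl _ measurableT (integrable_torus_sin mu k)).
Qed.

Lemma int_torus_sin_shift (mu : probability (torus R n) R) k v :
  \int[distribution mu (torus_shift v)]_p torus_sin k p =
  cos_mode k v * \int[mu]_p torus_sin k p + sin_mode k v * \int[mu]_p torus_cos k p.
Proof.
rewrite (Rintegral_distribution _ _ (continuous_torus_measurable (@continuous_torus_sin R n k)) (fun p => sin_max _)).
under eq_Rintegral do rewrite torus_sin_shift.
have i1 : mu.-integrable setT (EFin \o (fun p => cos_mode k v * torus_sin k p)).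
  by have := integrableZl measurableT (cos_mode k v) (integrable_torus_sin mu k).
have i2 : mu.-integrable setT (EFin \o (fun p => sin_mode k v * torus_cos k p)).
  by have := integrableZl measurableT (sin_mode k v) (integrable_torus_cos mu k).
rewrite (RintegralD measurableT i1 i2) (RintegralZl _ measurableT (integrable_torus_sin mu k)).
by rewrite (RintegralZl _ measurableT (integrable_torus_cos mu k)).
Qed.

(** The Fourier coefficient of index [k] is only rotated by a translation, so a
    translation that fixes every character with a nonzero coefficient preserves
    the measure. *)
Lemma shift_invariant (mu : probability (torus R n) R) v :
  (forall k, dotz k v = 0 \/ \int[mu]_p torus_cos k p = 0 /\ \int[mu]_p torus_sin k p = 0) ->
  forall A, measurable A -> mu (torus_shift v @^-1` A) = mu A.
Proof.
move=> h A mA; apply: (@fourier_unique R n (distribution mu (torus_shift v)) mu) => // k;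
  rewrite ?int_torus_cos_shift ?int_torus_sin_shift; case: (h k) => [e|[-> ->]];
  rewrite ?mulr0 ?subr0 ?addr0// /cos_mode /sin_mode e mulr0 cos0 sin0 !mul0r ?mul1r ?subr0 ?addr0//.
Qed.

Lemma is_derive_line (x v : 'rV[R]_n) (t : R) :
  is_derive t (1 : R) (fun s : R => x + s *: v) v.
Proof.
have dl : is_derive t (1 : R) (fun s : R => s *: v) v.
  have df : differentiable (fun s : R => s *: v) t by have [] := is_diff_scalel t v.
  apply: DeriveDef; first exact: diff_derivable.
  by rewrite deriveE// diff_val scale1r.
by have := is_deriveD (is_derive_cst x t 1) dl; rewrite add0r.
Qed.

Lemma resonant_flow_invariant (mu : probability (torus R n) R) (w : 'rV[R]_n) :
  (forall k, dotz k w = 0 \/ \int[mu]_p torus_cos k p = 0 /\ \int[mu]_p torus_sin k p = 0) ->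
  flow_invariant (fun=> w) mu.
Proof.
move=> h; exists (fun t p => torus_shift (t *: w) p).
  move=> p; exists (fun t => torus_repr p + t *: w); split => //.
    by rewrite scale0r addr0 torus_reprK.
  move=> t; exact: is_derive_line.
move=> f t cf.
have [K fK] := torus_bounded cf.
rewrite -(Rintegral_distribution mu (torus_shift (t *: w)) (continuous_torus_measurable cf) fK).
congr fine; apply: eq_measure_integral => A mA _.
apply: (@shift_invariant mu (t *: w) _ A mA) => k; rewrite dotzZr.
by case: (h k) => [->|?]; [left; rewrite mulr0|right].
Qed.

Lemma lebesgue_shift v A : measurable A ->
  lebesgue_torus R n (torus_shift v @^-1` A) = lebesgue_torus R n A.
Proof.
apply: shift_invariant => k; have [->|k0] := eqVneq k 0; [left|right].
  exact: dotz0l.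
by rewrite lebesgue_torus_cos ?lebesgue_torus_sin.
Qed.

Lemma lebesgue_flow_invariant (w : 'rV[R]_n) :
  flow_invariant (fun=> w) (lebesgue_torus R n).
Proof.
apply: resonant_flow_invariant => k; have [->|k0] := eqVneq k 0; [left|right].
  exact: dotz0l.
by rewrite lebesgue_torus_cos ?lebesgue_torus_sin.
Qed.

Lemma negligible_shift v A : (lebesgue_torus R n).-negligible A ->
  (lebesgue_torus R n).-negligible (torus_shift v @^-1` A).
Proof.
move=> [B [mB B0 AB]]; exists (torus_shift v @^-1` B); split.
- by rewrite -[X in measurable X]setTI; exact: (measurable_torus_shift v).
- by rewrite -B0; exact: lebesgue_shift.
- by move=> p; exact: AB.
Qed.

(** The translates of a nonempty open set by rational vectors cover the torus,
    and there are countably many of them. *)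
Lemma lebesgue_open_pos (U : set (torus R n)) : open U -> U !=set0 ->
  lebesgue_torus R n U != 0%E.
Proof.
move=> oU [p Up]; apply/eqP => U0.
pose ratv (q : 'rV[rat]_n) : 'rV[R]_n := \row_i ratr (q 0 i).
pose ratn j := ratv (odflt 0 (@unpickle 'rV[rat]_n j)).
have cover : \bigcup_j (torus_shift (ratn j) @^-1` U) = setT.
  apply/seteqP; split => // p' _.
  pose W := @torus_proj R n @^-1` U.
  have oW : open W by have /continuousP := @continuous_torus_proj R n; exact.
  have : nbhs (torus_repr p) W.
    by apply: open_nbhs_nbhs; split=> //; rewrite /W /= torus_reprK.
  move=> /nbhs_ballP[e /= e0 eW].
  have /boolp.choice[q qt] : forall i : 'I_n, exists q : rat,
      `|torus_repr p 0 i - (torus_repr p' 0 i + ratr q)| < e.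
    move=> i; have : torus_repr p 0 i - torus_repr p' 0 i < torus_repr p 0 i - torus_repr p' 0 i + e.
      by rewrite ltrDl.
    move=> /rat_in_itvoo[x]; rewrite in_itv/= => /andP[x1 x2]; exists x.
    by rewrite ltr_norml; apply/andP; split; lra.
  exists (pickle (\row_i q i)) => //=; rewrite /ratn pickleK; apply: eW; split => // i j.
  by rewrite (ord1 i) -ball_normE /= !mxE; exact: qt.
have : (lebesgue_torus R n).-negligible [set: torus R n].
  rewrite -cover; apply: negligible_bigcup => j; apply: negligible_shift.
  by apply/negligibleP; first exact: measurable_torus_open.
move=> /(measure_negligible measurableT) /eqP.
by rewrite [X in X == _](_ : _ = 1%E) ?onee_eq0//; exact: probability_setT.
Qed.

End Translations.

(** * Lipschitz functions of one variable *)

Section LineLipschitz.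
Context {R : realType}.

Lemma lebesgue_translation (t : R) (A : set (measurableTypeR R)) : measurable A ->
  lebesgue_measure ((fun s : measurableTypeR R => s + t) @^-1` A) = lebesgue_measure A :> \bar R.
Proof.
move=> mA.
have mt : measurable_fun setT ((fun s : measurableTypeR R => s + t) : measurableTypeR R -> measurableTypeR R).
  by apply: measurable_funD.
pose tr : {mfun measurableTypeR R >-> measurableTypeR R} :=
  HB.pack ((fun s : measurableTypeR R => s + t) : measurableTypeR R -> measurableTypeR R)
    (isMeasurableFun.Build _ _ _ _ _ mt).
apply/esym; apply: (@lebesgue_measure_unique R (pushforward lebesgue_measure tr)) => //.
move=> _ [[a b] _ <-] /=; rewrite /pushforward /=.
have -> : (fun s : R => s + t) @^-1` `]a, b]%classic = `](a - t), (b - t)]%classic.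
  by apply/seteqP; split => s /=; rewrite !in_itv /= ltrBlDr lerBrDr.
rewrite !lebesgue_measure_itv /= !lte_fin ltrD2r; case: ifP => // _.
by rewrite -!EFinB; congr (_%:E); ring.
Qed.

(** If the slope between [s0] and [s1] were too large, it would be too large
    between [s] and [s + T] for all [s] in a short interval on the left of [s0],
    against [ae_derivative_bound]. *)
Lemma lip_ae_slope (g : R -> R) (L M a s0 s1 b : R) :
  (forall s t, `|g t - g s| <= L * `|t - s|) ->
  {ae lebesgue_measure, forall s, a < s < b -> derivable g s 1 /\ derive1 g s <= M} ->
  a < s0 -> s0 < s1 -> s1 <= b -> g s1 - g s0 <= M * (s1 - s0).
Proof.
move=> gL gM as0 s01 s1b; rewrite leNgt; apply/negP => hlt.
pose T := s1 - s0; pose eta := (g s1 - g s0 - M * T) / 4.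
have T0 : 0 < T by rewrite subr_gt0.
have eta0 : 0 < eta by rewrite divr_gt0// subr_gt0.
pose r := eta / (`|L| + 1).
have L1 : 0 < `|L| + 1 by rewrite ltr_wpDl.
have r0 : 0 < r by rewrite divr_gt0.
pose a' := Num.max a (s0 - r).
have a's0 : a' < s0 by rewrite /a' gt_max as0/= gtrBl.
have aa' : a <= a' by rewrite /a' le_max lexx.
have ra' : s0 - r <= a' by rewrite /a' le_max lexx orbT.
pose E : set (measurableTypeR R) := `]a', s0[%classic.
have cg : continuous g.
  move=> x; apply/cvgrPdist_le => e e0; apply/nbhs_ballP.
  exists (e / (`|L| + 1)); first by rewrite /= divr_gt0.
  move=> y; rewrite /ball /= => xy; apply: le_trans (gL _ _) _.
  apply: (@le_trans _ _ ((`|L| + 1) * `|x - y|)).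
    by rewrite ler_wpM2r// (le_trans (ler_norm _))// lerDl.
  by rewrite mulrC -ler_pdivlMr// ltW.
have lE : lebesgue_measure (E : set R) = (s0 - a')%:E :> \bar R.
  by rewrite /E lebesgue_measure_itv /= lte_fin a's0 EFinB.
suff E0 : lebesgue_measure E = 0%E.
  have : (s0 - a')%:E = 0%E :> \bar R := etrans (esym lE) E0.
  by move=> /eqP; rewrite eqe subr_eq0 gt_eqF.
apply: (@ae_derivative_bound _ _ _ _ E (fun s t => g (s + t)) T L M eta) => //.
  - exact: measurable_itv.
  - exact: (eq_ind_r (fun x => (x < +oo)%E) (ltry _) lE).
  - move=> t _; apply: measurable_funTS; apply: continuous_measurable_fun => s.
    apply: (continuous_comp (f := fun s => s + t)); last exact: cg.
    exact: (continuousD (@cvg_id _ _) (cvg_cst _)).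
  - move=> s u v _ _ _; apply: le_trans (gL _ _) _.
    by rewrite opprD addrACA subrr add0r.
  - move=> t /andP[t0 tT]; have [N [mN N0 hN]] := gM.
    exists ((fun s : measurableTypeR R => s + t) @^-1` N); split.
    + rewrite -[X in measurable X]setTI.
      have mt : measurable_fun setT ((fun s : measurableTypeR R => s + t) : measurableTypeR R -> measurableTypeR R).
        by apply: measurable_funD.
      exact: mt.
    + by rewrite -N0; exact: lebesgue_translation.
    + move=> s /= hs; apply: hN => /= hst; apply: hs => Es.
      move: Es; rewrite /E /= in_itv /= => /andP[s_1 s_2].
      have st : a < s + t < b by rewrite /T in tT; apply/andP; split; lra.
      have [dst dle] := hst st.
      have e : (fun h : R => h^-1 *: (((fun u => g (s + u)) \o shift t) (h *: (1 : R)) - g (s + t))) =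
          (fun h : R => h^-1 *: ((g \o shift (s + t)) (h *: (1 : R)) - g (s + t))).
        by apply/funext => h /=; rewrite addrCA.
      split; first by rewrite /derivable e.
      by move: dle; rewrite !derive1E /derive e.
  - move=> s; rewrite /E /= in_itv /= => /andP[s_1 s_2].
    have h1 := gL s0 s; have h2 := gL (s0 + T) (s + T).
    rewrite addr0; have e1 : s + T - (s0 + T) = s - s0 by ring.
    rewrite e1 in h2.
    have d : `|s - s0| <= r by rewrite ltr0_norm ?subr_lt0//; lra.
    have d' : L * `|s - s0| <= eta.
      apply: (@le_trans _ _ ((`|L| + 1) * r)); last by rewrite mulrC divfK// gt_eqF.
      apply: (@le_trans _ _ ((`|L| + 1) * `|s - s0|)).
        by rewrite ler_wpM2r// (le_trans (ler_norm _))// lerDl.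
      by rewrite ler_wpM2l// ltW.
    have e2 : s0 + T = s1 by rewrite /T subrKC.
    rewrite e2 in h2; move: (le_trans h1 d') (le_trans h2 d').
    rewrite !ler_norml => /andP[k1 k2] /andP[k3 k4].
    have : g s1 - g s0 - M * T = 4 * eta by rewrite /eta; field.
    lra.
Qed.

End LineLipschitz.

(** * Lipschitz functions on the torus *)

Section GradientBounds.
Context {R : realType} {n : nat}.

Lemma lipschitzE (V W : normedModType R) (f : V -> W) (D : set V) :
  [lipschitz f x | x in D] ->
  exists2 L : R, 0 <= L & forall x y, D x -> D y -> `|f x - f y| <= L * `|x - y|.
Proof.
move=> [L0 [_ h]]; pose L := `|L0| + 1.
exists L; first by rewrite addr_ge0.
move=> x y Dx Dy; apply: (h L _ (x, y)) => //.
by rewrite /L ltr_pwDr// ler_norm.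
Qed.

(** If the increment along [T *: v] were too large at one point, it would be so
    on a nonempty open set, which has positive measure, against
    [ae_derivative_bound]; translations preserve the null set of bad points. *)
Lemma torus_directional_bound (f : torus R n -> R) (v : 'rV[R]_n) (M : R) :
  lipschitz_torus f ->
  {ae lebesgue_torus R n, forall p, derivable (lift f) (torus_repr p) v /\
     'D_v (lift f) (torus_repr p) <= M} ->
  forall x T, 0 <= T -> lift f (x + T *: v) - lift f x <= M * T.
Proof.
move=> /lipschitzE[L L0 fL] fM x T.
rewrite le_eqVlt => /orP[/eqP <-|T0]; first by rewrite scale0r addr0 subrr mulr0.
rewrite leNgt; apply/negP => hlt.
pose eta := (lift f (x + T *: v) - lift f x - M * T) / 2.
have eta0 : 0 < eta by rewrite divr_gt0// subr_gt0.
pose h (p : torus R n) (t : R) := f (torus_shift (t *: v) p).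
have cf : continuous f.
  apply/continuous_torusP => y.
  apply/(@cvgrPdist_le _ R^o _ (nbhs (y : 'rV[R]_n)) (nbhs_filter (y : 'rV[R]_n))) => e e0.
  have L1 : 0 < L + 1 by rewrite ltr_wpDl.
  apply/nbhs_ballP; exists (e / (L + 1)); first by rewrite /= divr_gt0.
  move=> z; rewrite -ball_normE /= => yz; apply: le_trans (fL _ _ I I) _.
  apply: (@le_trans _ _ ((L + 1) * `|y - z|)).
    by rewrite ler_wpM2r// lerDl.
  by rewrite mulrC -ler_pdivlMr// ltW.
have ch t : continuous (h^~ t).
  move=> p; apply: (@continuous_comp _ _ _ (torus_shift (t *: v)) f); last exact: cf.
  exact: continuous_torus_shift.
pose E := [set p | M * T + eta < h p T - h p 0].
have oE : open E.
  have -> : E = (fun p => h p T - h p 0) @^-1` [set y | M * T + eta < y] by [].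
  apply: open_comp; last exact: open_gt.
  by move=> p _; exact: (@cvgB _ R^o _ _ _ (h^~ T) (h^~ 0) _ _ (ch T p) (ch 0 p)).
have hE t y : h (torus_proj y) t = lift f (y + t *: v) by rewrite /h torus_shiftE.
have E0 : E !=set0.
  exists (torus_proj x); rewrite /E /= !hE scale0r addr0.
  have : lift f (x + T *: v) - lift f x - M * T = 2 * eta by rewrite /eta; field.
  lra.
have /eqP := lebesgue_open_pos oE E0; apply.
apply: (@ae_derivative_bound _ _ _ _ E h T (L * `|v|) M eta) => //.
- exact: measurable_torus_open.
- by rewrite -ge0_fin_numE// fin_num_measure//; exact: measurable_torus_open.
- by move=> t _; apply: measurable_funTS; apply: continuous_torus_measurable; exact: ch.
- move=> p s t _ _ _; rewrite -(torus_reprK p) !hE.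
  apply: le_trans (fL _ _ I I) _.
  by rewrite opprD addrACA subrr add0r -scalerBl normrZ -mulrA (mulrC `|v|).
- move=> t _; have [N [mN N0 hN]] := fM.
  exists (torus_shift (t *: v) @^-1` N); split.
  + by rewrite -[X in measurable X]setTI; exact: (measurable_torus_shift (t *: v)).
  + by rewrite -N0; exact: lebesgue_shift.
  move=> p /= hp; apply: hN => /= -[dv dM]; apply: hp => _.
  have [z zi zE] := torus_repr_proj (torus_repr p + t *: v).
  have e : (fun u : R => u^-1 *: ((h p \o shift t) (u *: (1 : R)) - h p t)) =
     (fun u : R => u^-1 *: ((lift f \o shift (torus_repr (torus_shift (t *: v) p))) (u *: v) -
        lift f (torus_repr (torus_shift (t *: v) p)))).
    apply/funext => u; have -> : u *: (1 : R) = u by exact: mulr1.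
    rewrite /= {1 2}/h /torus_shift -!/(lift f _) zE (addrA (u *: v)) !(@lift_per _ _ f _ _ zi).
    by rewrite scalerDl (addrC (u *: v)) -addrA (addrC (t *: v)).
  split; first by rewrite /derivable e.
  by move: dM; rewrite derive1E /derive e.
- by move=> p /ltW.
Qed.

Lemma coord_sumnorm_lip (f : torus R n -> R) :
  (forall i x t, `|lift f (x + t *: delta_mx 0 i) - lift f x| <= `|t|) -> sumnorm_lip 1 f.
Proof.
move=> fi x h; rewrite mul1r.
have sumE (s : seq 'I_n) : `|lift f (x + \sum_(i <- s) h 0 i *: delta_mx 0 i) - lift f x|
    <= \sum_(i <- s) `|h 0 i|.
  elim: s => [|i s IH]; first by rewrite !big_nil addr0 subrr normr0.
  rewrite !big_cons addrCA addrC.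
  apply: le_trans (ler_distD (lift f (x + \sum_(i <- s) h 0 i *: delta_mx 0 i)) _ _) _.
  by apply: lerD.
by rewrite {1}[h]row_sum_delta.
Qed.

(** Coordinate directions suffice, since constants depending on the dimension
    are harmless. *)
Lemma grad_Linfty_sumnorm_lip (f : torus R n -> R) : lipschitz_torus f ->
  (grad_Linfty f <= 1)%E -> sumnorm_lip 1 f.
Proof.
move=> fL /ess_supP fG; apply: coord_sumnorm_lip => i.
have deriv p : (grad_norm f p <= 1)%E ->
    differentiable (lift f) (torus_repr p) /\
    `|'D_(delta_mx 0 i) (lift f) (torus_repr p)| <= 1.
  rewrite /grad_norm; case: ifPn => [/asboolP df|]; last by rewrite leye_eq.
  rewrite lee_fin => hle; split => //; apply: le_trans hle.
  rewrite /enorm -sqrtr_sqr ler_sqrt ?sumr_ge0//; last by move=> j _; rewrite sqr_ge0.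
  by rewrite (bigD1 i)//= mxE lerDl sumr_ge0// => j _; rewrite sqr_ge0.
have up x t : 0 <= t -> lift f (x + t *: delta_mx 0 i) - lift f x <= t.
  rewrite -[X in _ -> _ <= X]mul1r; apply: torus_directional_bound => //.
  apply: filterS fG => p /deriv[df dle]; split; first exact: diff_derivable.
  exact: le_trans (ler_norm _) dle.
have dn x t : 0 <= t -> lift f (x + t *: - delta_mx 0 i) - lift f x <= t.
  rewrite -[X in _ -> _ <= X]mul1r; apply: torus_directional_bound => //.
  apply: filterS fG => p /deriv[df dle]; split; first exact: diff_derivable.
  rewrite deriveE// linearN -deriveE//; apply: le_trans dle.
  by rewrite -normrN ler_norm.
have both x t : 0 <= t -> `|lift f (x + t *: delta_mx 0 i) - lift f x| <= t.
  move=> t0; rewrite ler_norml up// andbT lerNl opprB.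
  by have := dn (x + t *: delta_mx 0 i) t t0; rewrite scalerN addrK.
move=> x t; case: (leP 0 t) => [t0|/ltW t0]; first by rewrite (ger0_norm t0) both.
have := both (x + t *: delta_mx 0 i) (- t); rewrite oppr_ge0 t0 => /(_ isT).
by rewrite scaleNr addrK distrC (ler0_norm t0).
Qed.

End GradientBounds.

(** * Lipschitz families of vector fields *)

Section FieldBound.
Context {R : realType} {n : nat}.
Variables (V : torus R n -> R -> 'rV[R]_n) (M : R).
Hypothesis VL : lipschitz_field V.
Hypothesis VM : W1infty_norm V = M%:E.

Let good (z : torus R n * R) := (jacobian_norm V z <= M%:E)%E.

Let goodP (z : torus R n * R) c : good z ->
  derivable (fun s => V z.1 s 0 c) z.2 1 /\ `|'D_1 (fun s => V z.1 s 0 c) z.2| <= M.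
Proof.
rewrite /good /jacobian_norm; case: ifPn => [/asboolP df|]; last by rewrite leye_eq.
set z' := (torus_repr z.1, z.2) in df *.
have dV : derivable (lift_field V) z' ((0 : 'rV[R]_n), (1 : R)) by exact: diff_derivable.
have e : (fun h : R => h^-1 *: ((V z.1 \o shift z.2) (h *: (1 : R)) - V z.1 z.2)) =
    (fun h : R => h^-1 *: ((lift_field V \o shift z') (h *: ((0 : 'rV[R]_n), (1 : R))) - lift_field V z')).
  by apply/funext => h; rewrite /lift_field /= scaler0 add0r torus_reprK.
have dVz : derivable (V z.1) z.2 1 by rewrite /derivable e.
have DVz : 'D_1 (V z.1) z.2 = 'D_((0 : 'rV[R]_n), (1 : R)) (lift_field V) z' by rewrite /derive e.
rewrite lee_fin => hle; split; first exact: ((derivable_mxP _ _ _).1 dVz 0 c).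
have -> : 'D_1 (fun s => V z.1 s 0 c) z.2 = 'D_((0 : 'rV[R]_n), (1 : R)) (lift_field V) z' 0 c.
  by rewrite -DVz derive_mx// mxE.
apply: le_trans hle; set D := 'D_((0 : 'rV[R]_n), (1 : R)) (lift_field V) z'.
have s0 : 0 <= \sum_i enorm ('D_((delta_mx 0 i : 'rV[R]_n), (0 : R)) (lift_field V) z') ^+ 2.
  by apply: sumr_ge0 => i _; rewrite sqr_ge0.
have d0 : 0 <= \sum_i D 0 i ^+ 2 by apply: sumr_ge0 => i _; rewrite sqr_ge0.
apply: (@le_trans _ _ (enorm D)).
  rewrite -sqrtr_sqr /enorm ler_sqrt// (bigD1 c)//= lerDl.
  by apply: sumr_ge0 => j _; rewrite sqr_ge0.
rewrite -[leLHS](ger0_norm (sqrtr_ge0 _)) -sqrtr_sqr ler_sqrt ?addr_ge0 ?sqr_ge0//.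
by rewrite lerDr.
Qed.

Let ae_good : {ae lebesgue_torus_itv R n, forall z, good z}.
Proof.
suff : (ess_sup (lebesgue_torus_itv R n) (jacobian_norm V) <= M%:E)%E by move/ess_supP.
rewrite -VM /W1infty_norm leeDr//.
apply: ess_sup_gee; last by apply: aeW => z /=; rewrite lee_fin sqrtr_ge0.
by rewrite [X in (_ < X)%E](_ : _ = 1%E) ?lte01//; exact: probability_setT.
Qed.

Let ae_line : {ae lebesgue_torus R n, forall p, {ae lebesgue_measure, forall s : R, -1 < s < 1 -> good (p, s)}}.
Proof.
have [N [mN N0 hN]] := ae_good.
pose U : probability (measurableTypeR R) R := uniform_prob (@ltrN11 R).
have mU : measurable_fun setT (fun p : torus R n => U (xsection N p)).
  exact: measurable_fun_xsection.
have : ae_eq (lebesgue_torus R n) setT (fun p : torus R n => U (xsection N p)) (cst 0%E).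
  apply/(ae_eq_integral_abs _ measurableT mU); rewrite -[RHS]N0.
  by apply: eq_integral => p _; rewrite gee0_abs.
apply: filterS => p /(_ I) Up.
exists (xsection N p `&` `]-1, 1[%classic); split.
- by apply: measurableI; [exact: measurable_xsection | exact: measurable_itv].
- move: Up => /= Up.
  have := Up; rewrite /U /= /uniform_prob integral_uniform_pdf.
  have mI : measurable (xsection N p `&` `[(-1 : R), 1]%classic).
    by apply: measurableI; [exact: measurable_xsection | exact: measurable_itv].
  rewrite (eq_integral (fun=> (2^-1)%:E)); last first.
    move=> s; rewrite inE /= => -[_]; rewrite in_itv /= /uniform_pdf => ->.
    by congr (_%:E); congr (_^-1); ring.
  rewrite integral_cst// => /eqP; rewrite mule_eq0 eqe invr_eq0 pnatr_eq0 /= => /eqP h0.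
  apply/eqP; rewrite -measure_le0 -h0; apply: le_measure; rewrite ?inE//.
  - by apply: measurableI; [exact: measurable_xsection | exact: measurable_itv].
  - by apply: setIS => s /=; rewrite !in_itv /= => /andP[/ltW -> /ltW ->].
- move=> s /= hs; split; last by rewrite /= in_itv /=; apply: contrapT => h; apply: hs => /h.
  rewrite /xsection /= inE; apply: hN => /= hg; apply: hs => _; exact: hg.
Qed.

(** By Fubini, for almost every [p] the derivative in the parameter is bounded
    almost everywhere, so that [lip_ae_slope] applies; the other points are
    limits of these. *)
Lemma field_bound (delta : R) : 0 <= delta <= 1 ->
  forall p c, `|V p delta 0 c - V p 0 0 c| <= M * delta.
Proof.
move=> /andP[]; rewrite le_eqVlt => /orP[/eqP <-|d0] d1 p c.
  by rewrite subrr normr0 mulr0.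
have [L L0 hL] := lipschitzE VL.
have VLc x y (s t : R) i : -1 <= s <= 1 -> -1 <= t <= 1 ->
    `|V (torus_proj x) s 0 i - V (torus_proj y) t 0 i| <= L * Num.max `|x - y| `|s - t|.
  move=> hs ht.
  have := hL (x, s) (y, t) hs ht; rewrite /lift_field /= => h.
  apply: le_trans h; rewrite [leRHS]/Num.Def.normr /= mx_normrE.
  by apply: le_trans (le_bigmax _ _ (0, i)); rewrite !mxE.
(* nothing is known of [V] outside parameters in [[-1, 1]] *)
pose clip (s : R) := Num.max (-1) (Num.min 1 s).
have clipI s : -1 <= clip s <= 1.
  rewrite /clip le_max lexx /= ge_max ge_min lexx /= andbT; lra.
have clip_id (s : R) : -1 <= s <= 1 -> clip s = s.
  by move=> /andP[s1 s2]; rewrite /clip min_r// max_r.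
have clipL s t : `|clip s - clip t| <= `|s - t|.
  rewrite /clip; case: (leP 1 s) => h1; case: (leP 1 t) => h2;
  rewrite ?(max_r (_ : -1 <= 1)) ?subrr ?normr0//; try lra.
  + case: (leP (-1) t) => h3; rewrite !ger0_norm; lra.
  + case: (leP (-1) s) => h3; rewrite !ler0_norm; lra.
  + case: (leP (-1) t) => h3; case: (leP (-1) s) => h4; rewrite ?subrr ?normr0//.
    * by rewrite !ler0_norm; lra.
    * by rewrite !ger0_norm; lra.
have line q : {ae lebesgue_measure, forall s : R, -1 < s < 1 -> good (q, s)} ->
    `|V q delta 0 c - V q 0 0 c| <= M * delta.
  move=> hq.
  pose g (s : R) : R := V q (clip s) 0 c.
  have gL s t : `|g t - g s| <= L * `|t - s|.
    rewrite /g -(torus_reprK q); apply: le_trans (VLc _ _ _ _ _ (clipI _) (clipI _)) _.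
    by rewrite subrr normr0 max_r// ler_wpM2l.
  have near_g (s : R) : -1 < s < 1 -> {near s, (fun t => V q t 0 c) =1 g}.
    move=> s1; have : s \in `]-1, 1[ by rewrite in_itv.
    move=> /near_in_itvoo; apply: filterS => t; rewrite in_itv /= => /andP[t1 t2].
    by rewrite /g clip_id// !ltW.
  have gd (s : R) : -1 < s < 1 -> good (q, s) -> derivable g s (1 : R) /\ `|'D_1 g s| <= M.
    move=> s1 /(goodP c)[/= dV DV]; split.
      exact: near_eq_derivable (near_g _ s1) dV.
    by rewrite -(near_eq_derive _ (near_g _ s1)).
  have gE (s : R) : 0 <= s <= 1 -> V q s 0 c = g s.
    by move=> /andP[s1 s2]; rewrite /g clip_id//; apply/andP; split; lra.
  rewrite !gE ?lexx ?ler01 ?(ltW d0)//.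
  have up : g delta - g 0 <= M * (delta - 0).
    apply: (@lip_ae_slope _ g L M (-1) 0 delta 1) => //.
    have [N [mN N0 hN]] := hq; exists N; split => // s /= hs; apply: hN => /= hq'.
    apply: hs => s1; have [dg Dg] := gd s s1 (hq' s1).
    by split => //; rewrite derive1E; apply: le_trans (ler_norm _) Dg.
  have dn : - g delta - - g 0 <= M * (delta - 0).
    apply: (@lip_ae_slope _ (fun s => - g s) L M (-1) 0 delta 1) => //.
      by move=> s t; rewrite -opprD normrN.
    have [N [mN N0 hN]] := hq; exists N; split => // s /= hs; apply: hN => /= hq'.
    apply: hs => s1; have [dg Dg] := gd s s1 (hq' s1).
    split; first exact: derivableN.
    by rewrite derive1E deriveN//; apply: le_trans Dg; rewrite -normrN ler_norm.
  rewrite subr0 in up dn; rewrite ler_norml; apply/andP; split; lra.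
rewrite leNgt; apply/negP => hlt.
pose E := [set q | M * delta < `|V q delta 0 c - V q 0 0 c|].
have contV (s : R) : -1 <= s <= 1 -> continuous (fun q => V q s 0 c).
  move=> hs; apply/continuous_torusP => y.
  apply/(@cvgrPdist_le _ R^o _ (nbhs (y : 'rV[R]_n)) (nbhs_filter (y : 'rV[R]_n))) => e e0.
  have L1 : 0 < L + 1 by rewrite ltr_wpDl.
  apply/nbhs_ballP; exists (e / (L + 1)); first by rewrite /= divr_gt0.
  move=> z; rewrite -ball_normE /= => yz; apply: le_trans (VLc _ _ _ _ _ hs hs) _.
  rewrite subrr normr0 max_l//.
  apply: (@le_trans _ _ ((L + 1) * `|y - z|)); first by rewrite ler_wpM2r// lerDl.
  by rewrite mulrC -ler_pdivlMr// ltW.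
have hd : -1 <= delta <= 1 by apply/andP; split; lra.
have h0 : -1 <= (0 : R) <= 1 by apply/andP; split; lra.
have oE : open E.
  have -> : E = (fun q => `|V q delta 0 c - V q 0 0 c|) @^-1` [set y | M * delta < y] by [].
  apply: open_comp; last exact: open_gt.
  move=> q _.
  have cB : (fun q => V q delta 0 c - V q 0 0 c) x @[x --> q] --> V q delta 0 c - V q 0 0 c.
    exact: (@cvgB _ R^o _ _ _ (fun q => V q delta 0 c) (fun q => V q 0 0 c) _ _ (contV _ hd q) (contV _ h0 q)).
  exact: (@cvg_norm R R^o _ _ _ _ _ cB).
have E0 : E !=set0 by exists p.
have /eqP := lebesgue_open_pos oE E0; apply.
apply/negligibleP; first exact: measurable_torus_open.
apply: negligibleS ae_line => q /=; rewrite /E /= => hq hline.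
by have := line q hline; rewrite leNgt hq.
Qed.

End FieldBound.

(** * Fourier coefficients of invariant measures *)

Section InvariantModes.
Context {R : realType} {n : nat}.
Variables (W : torus R n -> 'rV[R]_n) (w : 'rV[R]_n) (B : R).
Hypothesis WB : forall p i, `|W p 0 i - w 0 i| <= B.
Variable mu : probability (torus R n) R.
Hypothesis mu_inv : flow_invariant W mu.

Lemma dotz_le (k : 'rV[int]_n) (x : 'rV[R]_n) (b : R) : (forall i, `|x 0 i| <= b) ->
  `|dotz k x| <= b * \sum_i `|k 0 i|%:~R.
Proof.
move=> xb; rewrite /dotz mulr_sumr; apply: le_trans (ler_norm_sum _ _ _) _.
by apply: ler_sum => i _; rewrite normrM -intr_norm mulrC ler_wpM2r// ler0z.
Qed.

Let S (k : 'rV[int]_n) : R := \sum_i `|k 0 i|%:~R.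

Let S_ge0 k : 0 <= S k.
Proof. by apply: sumr_ge0 => i _; rewrite ler0z. Qed.

Let dotzW k p : `|dotz k (W p) - dotz k w| <= B * S k.
Proof.
rewrite -dotzNr -dotzDr; apply: dotz_le => i; by rewrite !mxE.
Qed.

Lemma is_derive_dotz (k : 'rV[int]_n) (g : R -> 'rV[R]_n) (t : R) (dg : 'rV[R]_n) :
  is_derive t (1 : R) g dg -> is_derive t (1 : R) (fun s => dotz k (g s)) (dotz k dg).
Proof.
move=> [dgt Dg].
have di i : is_derive t (1 : R) (fun s => (k 0 i)%:~R * g s 0 i) ((k 0 i)%:~R * dg 0 i).
  have d1 : is_derive t (1 : R) (fun s => g s 0 i) (dg 0 i).
    apply: DeriveDef; first exact: ((derivable_mxP _ _ _).1 dgt 0 i).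
    by rewrite -Dg derive_mx// mxE.
  by have := @is_deriveZ _ _ _ (fun s => g s 0 i) (k 0 i)%:~R t 1 _ d1.
have := @is_derive_sum _ _ _ n (fun i s => (k 0 i)%:~R * g s 0 i) t 1 _ di.
by rewrite fct_sumE.
Qed.

Section Phase.
Variables (k : 'rV[int]_n) (a : R).

Let u p := cos a * torus_sin k p + sin a * torus_cos k p.
Let v p := cos a * torus_cos k p - sin a * torus_sin k p.

Let uE x : u (torus_proj x) = sin (2 * pi * dotz k x + a).
Proof. by rewrite /u torus_sinE torus_cosE sinD mulrC (mulrC (sin a)). Qed.

Let vE x : v (torus_proj x) = cos (2 * pi * dotz k x + a).
Proof. by rewrite /v torus_sinE torus_cosE cosD mulrC (mulrC (sin a)). Qed.

Let iu : mu.-integrable setT (EFin \o u).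
Proof.
have h1 := integrableZl measurableT (cos a) (integrable_torus_sin mu k).
have h2 := integrableZl measurableT (sin a) (integrable_torus_cos mu k).
exact: (integrableD measurableT h1 h2).
Qed.

Let iv : mu.-integrable setT (EFin \o v).
Proof.
have h1 := integrableZl measurableT (cos a) (integrable_torus_cos mu k).
have h2 := integrableZl measurableT (sin a) (integrable_torus_sin mu k).
exact: (integrableB measurableT h1 h2).
Qed.

Let cu : continuous u.
Proof.
move=> p; exact: (@cvgD _ R^o _ _ _ (fun p => cos a * torus_sin k p) (fun p => sin a * torus_cos k p) _ _
  (@cvgM R _ _ _ (fun=> cos a) (torus_sin k) _ _ (cvg_cst _) (@continuous_torus_sin _ _ k p))
  (@cvgM R _ _ _ (fun=> sin a) (torus_cos k) _ _ (cvg_cst _) (@continuous_torus_cos _ _ k p))).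
Qed.

Let kappa := dotz k w.
Let K := 2 * pi * (`|kappa| + B * S k).

Let along (g : R -> 'rV[R]_n) (t : R) : 0 < t ->
  (forall s, is_derive s (1 : R) g (W (torus_proj (g s)))) ->
  2 * pi * t * (kappa * v (torus_proj (g 0)) - (`|kappa| * (K * t) + B * S k)) <=
  u (torus_proj (g t)) - u (torus_proj (g 0)).
Proof.
move=> t0 dg.
have p0 := @pi_gt0 R.
have dtheta s : is_derive s (1 : R) (fun s => 2 * pi * dotz k (g s) + a)
    (2 * pi * dotz k (W (torus_proj (g s)))).
  have d1 := is_derive_dotz k (dg s).
  have d2 := @is_deriveZ _ _ _ (fun s => dotz k (g s)) (2 * pi) s 1 _ d1.
  have d3 := is_deriveD d2 (is_derive_cst a s (1 : R)).
  by rewrite addr0 in d3.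
have dsin s : is_derive s (1 : R) (fun s => sin (2 * pi * dotz k (g s) + a))
    (cos (2 * pi * dotz k (g s) + a) * (2 * pi * dotz k (W (torus_proj (g s))))).
  exact: (@is_derive1_comp _ (@sin R) (fun s => 2 * pi * dotz k (g s) + a)).
have cont (f : R -> R) df (b : R) : (forall s, is_derive s (1 : R) f (df s)) ->
    {within `[0, b], continuous f}.
  move=> fd; apply: continuous_subspaceT => s.
  apply: differentiable_continuous; apply/derivable1_diffP.
  by case: (fd s).
have [s s_in] := MVT t0 (fun s _ => dsin s) (cont _ _ _ dsin).
move: s_in; rewrite in_itv /= => /andP[s0 st]; rewrite subr0.
rewrite -!uE -!vE => ->.
have [r _] := MVT s0 (fun s _ => dtheta s) (cont _ _ _ dtheta).
rewrite subr0 => hr.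
have vs : `|v (torus_proj (g s)) - v (torus_proj (g 0))| <= K * t.
  rewrite !vE -!sinDpihalf; apply: le_trans (sinB_le _ _) _.
  rewrite opprD addrACA subrr addr0 hr normrM (gtr0_norm s0).
  apply: ler_pM => //; [exact: ltW | | exact: ltW].
  rewrite normrM (gtr0_norm (_ : 0 < 2 * pi)) ?mulr_gt0// /K.
  apply: ler_wpM2l; first by rewrite mulr_ge0 ?(ltW p0).
  rewrite -[X in `|X| <= _](subrKC kappa); apply: le_trans (ler_normD _ _) _.
  by rewrite lerD2l; exact: dotzW.
set q := torus_proj (g s) in vs *; set q0 := torus_proj (g 0) in vs *.
have v1 : `|v q| <= 1 by rewrite /q vE cos_max.
rewrite [leRHS](_ : _ = 2 * pi * t * (v q * dotz k (W q))); last by ring.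
rewrite ler_wpM2l ?mulr_ge0 ?(ltW p0) ?(ltW t0)//.
have -> : v q * dotz k (W q) = kappa * v q0 + kappa * (v q - v q0) + v q * (dotz k (W q) - kappa).
  by ring.
have h1 : - (`|kappa| * (K * t)) <= kappa * (v q - v q0).
  rewrite lerNl -mulrN; apply: le_trans (ler_norm _) _.
  by rewrite normrM normrN ler_wpM2l.
have h2 : - (B * S k) <= v q * (dotz k (W q) - kappa).
  rewrite lerNl -mulNr; apply: le_trans (ler_norm _) _.
  rewrite normrM normrN -[leRHS]mul1r; apply: ler_pM => //; exact: dotzW.
lra.
Qed.

(** The time derivative of [u] along an orbit is [2 pi (k . W) v], where [k . W]
    is within [B * S k] of [k . w]. By invariance the integral of [u] does not
    change along the flow, so the integral of [(k . w) v] is small. The flow at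
    time [t] is not known to be measurable, hence the use of
    [le_Rint_nonmeasurable]; letting [t] go to [0] removes the variation of [v]
    along orbits. *)
Lemma phase_mode_bound : kappa * \int[mu]_p v p <= B * S k.
Proof.
have [phi flow inv] := mu_inv.
have p0 := @pi_gt0 R.
have B0 : 0 <= `|kappa| * K.
  rewrite mulr_ge0// mulr_ge0 ?mulr_ge0 ?(ltW p0)// addr_ge0//.
  by have := dotzW k (torus_proj 0); apply: le_trans.
apply/ler_addgt0Pr => e e0.
pose t := e / (`|kappa| * K + 1).
have q0 : 0 < `|kappa| * K + 1 by rewrite ltr_wpDl.
have t0 : 0 < t by rewrite divr_gt0.
pose r := `|kappa| * (K * t) + B * S k.
have rle : r <= B * S k + e.
  rewrite /r addrC lerD2l mulrA /t mulrA ler_pdivrMr// mulrC.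
  by rewrite ler_wpM2l ?(ltW e0)// lerDl.
apply: le_trans rle; rewrite -subr_le0.
pose f p := u p + 2 * pi * t * (kappa * v p - r).
have u1 p : `|u p| <= 1 by rewrite -(torus_reprK p) uE sin_max.
have v1 p : `|v p| <= 1 by rewrite -(torus_reprK p) vE cos_max.
pose Q := 1 + `|2 * pi * t| * (`|kappa| + `|r|).
have Q1 : 1 <= Q by rewrite lerDl mulr_ge0 ?addr_ge0.
have fQ p : `|f p| <= Q.
  apply: le_trans (ler_normD _ _) _; apply: lerD => //.
  rewrite normrM ler_wpM2l//; apply: le_trans (ler_normB _ _) _.
  by rewrite lerD2r normrM ler_piMr.
have fu p : f p <= u (phi t p).
  have [g [g0 gt dg]] := flow p.
  have := along t0 dg; rewrite g0 -(gt t) /f /r; lra.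
have := le_Rint_nonmeasurable mu fQ (fun p => le_trans (u1 (phi t p)) Q1) fu.
rewrite inv//.
have i1 : mu.-integrable setT (EFin \o (fun=> r)) by exact: finite_measure_integrable_cst.
have iw : mu.-integrable setT (EFin \o (fun p => kappa * v p)).
  exact: (integrableZl measurableT kappa iv).
have iwr : mu.-integrable setT (EFin \o (fun p => kappa * v p - r)).
  exact: (integrableB measurableT iw i1).
have iww : mu.-integrable setT (EFin \o (fun p => 2 * pi * t * (kappa * v p - r))).
  exact: (integrableZl measurableT (2 * pi * t) iwr).
rewrite /f (RintegralD measurableT iu iww) (RintegralZl _ measurableT iwr).
rewrite (RintegralB measurableT iw i1) (RintegralZl _ measurableT iv) (prob_Rint_cst mu).
by rewrite gerDl pmulr_rle0// mulr_gt0// mulr_gt0.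
Qed.

End Phase.

(** The phases [0] and [pi] give the two signs. *)
Lemma cos_mode_bound k : `|dotz k w| * `|\int[mu]_p torus_cos k p| <= B * S k.
Proof.
rewrite -normrM ler_norml; apply/andP; split.
  have := phase_mode_bound k pi; rewrite cospi sinpi.
  under eq_Rintegral do rewrite mul0r subr0.
  rewrite RintegralZl//; last exact: integrable_torus_cos.
  lra.
have := phase_mode_bound k 0; rewrite cos0 sin0.
by under eq_Rintegral do rewrite mul0r subr0 mul1r.
Qed.

Lemma sin_mode_bound k : `|dotz k w| * `|\int[mu]_p torus_sin k p| <= B * S k.
Proof.
rewrite -normrM ler_norml; apply/andP; split.
  have := phase_mode_bound k (pi / 2); rewrite cos_pihalf sin_pihalf.
  under eq_Rintegral do rewrite mul0r mul1r sub0r -mulN1r.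
  rewrite RintegralZl//; last exact: integrable_torus_sin.
  lra.
have := phase_mode_bound k (- (pi / 2)); rewrite cosN sinN cos_pihalf sin_pihalf.
by under eq_Rintegral do rewrite mul0r mulN1r opprK add0r.
Qed.

End InvariantModes.

(** * The upper bound *)

Section UpperBound.
Context {R : realType}.

(** The Lebesgue measure has the same Fourier mean up to the nonzero modes of
    [mu], which [pairing_bound] estimates. *)
Lemma transport_bound n (mu : probability (torus R n) R) (w : 'rV[R]_n) (B s : R) (N : nat)
    (f : torus R n -> R) :
  (2 <= N)%N -> 0 < s -> 0 <= B ->
  (forall k : 'rV[int]_n, k != 0 -> (forall i, (`|k 0%R i|%N < N)%N) -> s <= `|dotz k w|) ->
  (forall k, `|dotz k w| * `|\int[mu]_p torus_cos k p| <= B * \sum_i `|k 0 i|%:~R) ->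
  (forall k, `|dotz k w| * `|\int[mu]_p torus_sin k p| <= B * \sum_i `|k 0 i|%:~R) ->
  sumnorm_lip 1 f ->
  `|\int[mu]_p f p - \int[lebesgue_torus R n]_p f p| <= n%:R * (10 / N%:R) + 2 * n%:R * B / s.
Proof.
move=> N2 s0 B0 ws mc ms fL.
pose leb := lebesgue_torus R n.
pose c k := \int[mu]_p torus_cos k p - \int[leb]_p torus_cos k p.
pose d k := \int[mu]_p torus_sin k p - \int[leb]_p torus_sin k p.
have c0 : c 0 = 0 by rewrite /c !int_torus_cos0 subrr.
have d0 : d 0 = 0 by rewrite /d !int_torus_sin0 subrr.
have S0 (k : 'rV[int]_n) : 0 <= \sum_i `|k 0 i|%:~R :> R.
  by apply: sumr_ge0 => i _; rewrite ler0z.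
have cle k : `|dotz k w| * `|c k| <= B * \sum_i `|k 0 i|%:~R.
  have [->|k0] := eqVneq k 0; first by rewrite c0 normr0 mulr0 mulr_ge0.
  by rewrite /c lebesgue_torus_cos// subr0.
have dle k : `|dotz k w| * `|d k| <= B * \sum_i `|k 0 i|%:~R.
  have [->|k0] := eqVneq k 0; first by rewrite d0 normr0 mulr0 mulr_ge0.
  by rewrite /d lebesgue_torus_sin// subr0.
have h1 := fourier_meanP mu N2 ler01 fL.
have h2 := fourier_meanP leb N2 ler01 fL.
have h3 := pairing_bound N2 (@lift_per R n f) fL s0 B0 ws cle dle c0 d0.
have e3 : fourier_mean N (lift f) mu - fourier_mean N (lift f) leb =
    (((2 * N)%N%:R * (N%:R / 2)) ^+ n)^-1 *
    \sum_(l : {ffun 'I_n -> 'I_N}) \sum_(l' : {ffun 'I_n -> 'I_N}) box_weight l * box_weight l' *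
    (cos_coef N (lift f) (freq l l') * c (freq l l') + sin_coef N (lift f) (freq l l') * d (freq l l')).
  rewrite /fourier_mean -mulrBr; congr (_ * _).
  rewrite -sumrB; apply: eq_bigr => l _; rewrite -sumrB; apply: eq_bigr => l' _.
  by rewrite /c /d; ring.
rewrite -e3 in h3.
apply: le_trans (ler_distD (fourier_mean N (lift f) mu) _ _) _.
rewrite [leRHS](_ : _ = 1 * n%:R * (5 / N%:R) + (2 * n%:R * B / s + 1 * n%:R * (5 / N%:R))); last first.
  have N0 : 0 < N%:R :> R by rewrite ltr0n; case: N N2 {h1 h2 h3 e3 ws}.
  by field; rewrite !gt_eqF.
apply: lerD => //.
apply: le_trans (ler_distD (fourier_mean N (lift f) leb) _ _) _.
by apply: lerD => //; rewrite distrC.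
Qed.

Lemma wasserstein_le n (mu nu : probability (torus R n) R) (c : R) :
  (forall f, sumnorm_lip 1 f -> `|\int[mu]_p f p - \int[nu]_p f p| <= c) ->
  (wasserstein1 mu nu <= c%:E)%E.
Proof.
move=> h; apply: ge_ereal_sup => _ [f [fL fG] <-]; rewrite lee_fin; apply: h.
exact: grad_Linfty_sumnorm_lip.
Qed.

Lemma enorm_gt0 n (k : 'rV[int]_n) : k != 0 -> 0 < enorm (map_mx intr k : 'rV[R]_n).
Proof.
move=> k0; rewrite /enorm sqrtr_gt0.
have [i ki] : exists i, k 0 i != 0.
  apply/existsP; apply: contraNT k0; rewrite negb_exists => /forallP h.
  by apply/eqP/rowP => i; rewrite mxE; have := h i; rewrite negbK => /eqP.
rewrite (bigD1 i)//= ltr_wpDr//; first by apply: sumr_ge0 => j _; rewrite sqr_ge0.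
by rewrite mxE exprn_even_gt0//= intr_eq0.
Qed.

Lemma enorm_le n (k : 'rV[int]_n) (N : nat) : (forall i, (`|k 0%R i|%N < N)%N) ->
  enorm (map_mx intr k : 'rV[R]_n) <= Num.sqrt n%:R * N%:R.
Proof.
move=> kN; rewrite -(ger0_norm (ler0n R N)) -sqrtr_sqr -sqrtrM// /enorm ler_sqrt; last first.
  by rewrite mulr_ge0// sqr_ge0.
rewrite mulr_natl -[X in _ *+ X]card_ord -sumr_const; apply: ler_sum => i _.
rewrite mxE -(real_normK (num_real (k 0 i)%:~R)) ler_sqr ?nnegrE//.
by rewrite -intr_norm -abszE -pmulrn ler_nat ltnW.
Qed.

Lemma diophantine_box n (sigma c : R) (w : 'rV[R]_n) (N : nat) : 0 < sigma -> 0 < c ->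
  diophantine sigma c w ->
  forall k : 'rV[int]_n, k != 0 -> (forall i, (`|k 0%R i|%N < N)%N) ->
  c * (Num.sqrt n%:R * N%:R) `^ (- sigma) <= `|dotz k w|.
Proof.
move=> s0 c0 dw k k0 kN; apply: le_trans (dw k k0).
rewrite ler_wpM2l ?(ltW c0)// !powRN.
have e0 := enorm_gt0 k0; have ele := enorm_le kN.
rewrite lef_pV2 ?posrE ?powR_gt0//; last exact: lt_le_trans ele.
by apply: ge0_ler_powR => //; rewrite ?nnegrE ?(ltW s0)// ?(ltW e0)// (le_trans (ltW e0)).
Qed.

(** The two error terms [1 / N] and [delta * N `^ sigma] are balanced by
    [N ~ delta `^ (- 1 / (1 + sigma))]. *)
Lemma balanced_cutoff (sigma delta : R) : 0 < sigma -> 0 < delta <= 1 ->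
  exists N : nat, [/\ (2 <= N)%N, N%:R^-1 <= delta `^ (1 / (1 + sigma)) &
    delta * N%:R `^ sigma <= 3 `^ sigma * delta `^ (1 / (1 + sigma))].
Proof.
move=> s0 /andP[d0 d1]; set a := 1 / (1 + sigma).
have s1 : 0 < 1 + sigma by rewrite addr_gt0.
have a0 : 0 < a by rewrite divr_gt0.
have x0 : 0 < delta `^ a by rewrite powR_gt0.
have x1 : delta `^ a <= 1.
  have : delta `^ a <= 1 `^ a by apply: ge0_ler_powR; rewrite ?nnegrE ?(ltW a0) ?(ltW d0).
  by rewrite powR1.
pose y := (delta `^ a)^-1.
have y1 : 1 <= y by rewrite invf_ge1.
(* [.+2] ensures [2 <= N] as well as [y <= N] *)
pose N := (Num.truncn y).+2.
have Ny : N%:R <= 3 * y.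
  have /andP[h _] := truncn_itv (le_trans ler01 y1).
  by rewrite /N -!natr1; lra.
have yN : y <= N%:R.
  by apply: le_trans (ltW (truncnS_gt y)) _; rewrite ler_nat.
have N0 : 0 < N%:R :> R by [].
exists N; split => //.
  by rewrite -[leRHS]invrK lef_pV2 ?posrE ?invr_gt0.
apply: (@le_trans _ _ (delta * (3 * y) `^ sigma)).
  rewrite ler_wpM2l ?(ltW d0)//; apply: ge0_ler_powR; rewrite ?nnegrE ?(ltW s0)//.
  by rewrite mulr_ge0// (le_trans ler01).
rewrite powRM// ?(le_trans ler01 y1)// mulrCA ler_wpM2l ?powR_ge0//.
rewrite /y -powRN -powRrM -{1}(powRr1 (ltW d0)) -powRD; last by rewrite (gt_eqF d0) implybT.
rewrite le_eqVlt; apply/orP; left; apply/eqP; congr (_ `^ _).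
by rewrite /a; field; rewrite gt_eqF.
Qed.

Lemma upper_rate n (sigma c M : R) (w : 'rV[R]_n) (V : torus R n -> R -> 'rV[R]_n) (delta : R)
    (mu : probability (torus R n) R) :
  (0 < n)%N -> 0 < sigma -> 0 < c -> diophantine sigma c w -> lipschitz_field V ->
  (forall x, V x 0 = w) -> W1infty_norm V = M%:E -> 0 < delta <= 1 ->
  flow_invariant (fun x => V x delta) mu ->
  (wasserstein1 mu (lebesgue_torus R n) <=
    ((10 * n%:R + 2 * n%:R * `|M| / c * (Num.sqrt n%:R * 3) `^ sigma) *
     delta `^ (1 / (1 + sigma)))%:E)%E.
Proof.
move=> n0 s0 c0 dw VL V0 VM dd inv; have /andP[d0 d1] := dd.
have [N [N2 N1 Ns]] := balanced_cutoff s0 dd.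
apply: wasserstein_le => f fL.
set x := delta `^ _ in N1 Ns *.
have N0 : 0 < N%:R :> R by rewrite ltr0n; case: N N2 {N1 Ns}.
have q0 : 0 < Num.sqrt n%:R * N%:R :> R by rewrite mulr_gt0// sqrtr_gt0 ltr0n.
pose B := `|M| * delta.
have B0 : 0 <= B by rewrite mulr_ge0// ltW.
have WB p i : `|V p delta 0 i - w 0 i| <= B.
  rewrite -(V0 p); apply: le_trans (field_bound VL VM _ p i) _.
    by rewrite d1 (ltW d0).
  by rewrite ler_wpM2r ?(ltW d0)// ler_norm.
pose s := c * (Num.sqrt n%:R * N%:R) `^ (- sigma).
have sp : 0 < s by rewrite mulr_gt0// powR_gt0.
have := transport_bound N2 sp B0 (diophantine_box s0 c0 dw)
  (cos_mode_bound WB inv) (sin_mode_bound WB inv) fL.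
move=> /le_trans; apply.
rewrite [leRHS]mulrDl; apply: lerD.
  by rewrite -mulrA [leLHS]mulrCA ler_wpM2l// ler_wpM2l.
rewrite /s powRN invfM invrK /B.
have -> : 2 * n%:R * (`|M| * delta) * (c^-1 * (Num.sqrt n%:R * N%:R) `^ sigma) =
   2 * n%:R * `|M| / c * (Num.sqrt n%:R `^ sigma * (delta * N%:R `^ sigma)).
  by rewrite powRM// ?sqrtr_ge0//; ring.
rewrite powRM// ?sqrtr_ge0// -(mulrA (2 * n%:R * `|M| / c)) ler_wpM2l//.
  by rewrite mulr_ge0 ?invr_ge0 ?(ltW c0)// mulr_ge0.
by rewrite -[leRHS]mulrA ler_wpM2l// powR_ge0.
Qed.

(** For [B = 0] the mode bounds say that the nonzero Fourier coefficients
    vanish. *)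
Lemma diophantine_unique n (sigma c : R) (w : 'rV[R]_n) (V : torus R n -> R -> 'rV[R]_n) :
  0 < c -> diophantine sigma c w -> (forall x, V x 0 = w) ->
  unique_flow_invariant (fun x => V x 0) (lebesgue_torus R n).
Proof.
move=> c0 dw V0; have -> : (fun x => V x 0) = (fun=> w) by apply/funext.
split; first exact: lebesgue_flow_invariant.
move=> mu inv; have WB (p : torus R n) i : `|w 0 i - w 0 i| <= (0 : R) by rewrite subrr normr0.
have kw (k : 'rV[int]_n) : k != 0 -> 0 < `|dotz k w|.
  by move=> k0; apply: lt_le_trans (dw k k0); rewrite mulr_gt0// powR_gt0// enorm_gt0.
have coef (x y : R) : 0 < x -> x * `|y| <= 0 -> y = 0.
  by move=> x0; rewrite pmulr_rle0// normr_le0 => /eqP.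
apply: fourier_unique => k; have [->|k0] := eqVneq k 0; rewrite ?int_torus_cos0 ?int_torus_sin0//.
  rewrite lebesgue_torus_cos//; apply: (coef _ _ (kw _ k0)).
  by have := cos_mode_bound WB inv k; rewrite mul0r.
rewrite lebesgue_torus_sin//; apply: (coef _ _ (kw _ k0)).
by have := sin_mode_bound WB inv k; rewrite mul0r.
Qed.

Lemma ln_half_le (delta : R) : 0 < delta <= 1 / 2 -> ln 2 <= `|ln delta|.
Proof.
move=> /andP[d0 d1]; rewrite -normrN -lnV ?posrE//; apply: le_trans (ler_norm _).
rewrite ler_ln ?posrE ?invr_gt0// -[leLHS]invrK lef_pV2 ?posrE ?invr_gt0//.
by rewrite -div1r.
Qed.

End UpperBound.

(** * Characters and closed orbits *)

Section CharacterTest.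
Context {R : realType} {n : nat}.
Variables (k : 'rV[int]_n) (k0 : k != 0).

Let nk : R := enorm (map_mx intr k : 'rV[R]_n).
Let nk0 : 0 < nk. Proof. exact: enorm_gt0. Qed.
Let c : R := (2 * pi * nk)^-1.
Let c0 : 0 < c. Proof. by rewrite invr_gt0 !mulr_gt0 ?pi_gt0. Qed.
Let f (p : torus R n) : R := c * torus_cos k p.
Let fE x : lift f x = c * cos_mode k x. Proof. by rewrite /lift /f torus_cosE. Qed.

Let cos_mode_lip (x y : 'rV[R]_n) : `|cos_mode k x - cos_mode k y| <= 2 * pi * (`|x - y| * \sum_i `|k 0 i|%:~R).
Proof.
rewrite /cos_mode -!sinDpihalf; apply: le_trans (sinB_le _ _) _.
rewrite opprD addrACA subrr addr0 -mulrBr -dotzNr -dotzDr.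
rewrite normrM (gtr0_norm (_ : 0 < 2 * pi)) ?mulr_gt0 ?pi_gt0//.
rewrite ler_wpM2l ?mulr_ge0 ?pi_ge0//; apply: dotz_le => i.
rewrite [leRHS]/Num.Def.normr /= mx_normrE.
exact: (le_bigmax _ (fun ij => `|(x - y) ij.1 ij.2|) (0, i)).
Qed.

Lemma differentiable_dotz (x : 'rV[R]_n) : differentiable (dotz k : 'rV[R]_n -> R) x.
Proof.
have lin : linear (dotz k : 'rV[R]_n -> R).
  by move=> a u v; rewrite dotzDr dotzZr.
pose L : {linear 'rV[R]_n -> R} := HB.pack (dotz k : 'rV[R]_n -> R) (GRing.isLinear.Build _ _ _ _ _ lin).
have -> : (dotz k : 'rV[R]_n -> R) = L by [].
by apply: linear_differentiable; exact: continuous_dotz.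
Qed.

Let f_diff x : differentiable (lift f) x.
Proof.
have -> : lift f = (fun t => c * cos (2 * pi * t)) \o dotz k by apply/funext => y; rewrite fE.
apply: differentiable_comp; first exact: differentiable_dotz.
apply/derivable1_diffP; apply: derivableM; first exact: derivable_cst.
have d1 : is_derive (dotz k x) (1 : R) (fun t => 2 * pi * t) (2 * pi).
  by have := @is_deriveZ _ _ _ id (2 * pi) (dotz k x) 1 _ (is_derive_id _ _); rewrite [_ *: 1]mulr1.
have := @is_derive1_comp _ (@cos R) (fun t => 2 * pi * t) (dotz k x) _ _ (is_derive_cos _) d1.
by case.
Qed.

Let f_deriv x i : 'D_(delta_mx 0 i) (lift f) x = - (c * (2 * pi) * sin_mode k x) * (k 0 i)%:~R.
Proof.
pose u h := c * cos (2 * pi * (dotz k x + h * (k 0 i)%:~R)).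
have e : (fun h : R => h^-1 *: ((lift f \o shift x) (h *: delta_mx 0 i) - lift f x)) =
   (fun h : R => h^-1 *: ((u \o shift 0) (h *: (1 : R)) - u 0)).
  apply/funext => h; rewrite /= !fE /cos_mode /u mul0r !addr0 dotzDr dotzZr dotz_delta.
  have -> : h *: (1 : R) = h by exact: mulr1.
  by rewrite (addrC (dotz k x)).
have -> : 'D_(delta_mx 0 i) (lift f) x = 'D_1 u 0 by rewrite /derive e.
have d1 : is_derive (0 : R) (1 : R) (fun h => 2 * pi * (dotz k x + h * (k 0 i)%:~R))
    (2 * pi * (k 0 i)%:~R).
  have d2 := @is_deriveZ _ _ _ id (k 0 i)%:~R (0 : R) (1 : R) _ (is_derive_id _ _).
  have d3 := is_deriveD (is_derive_cst (dotz k x) (0 : R) (1 : R)) d2.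
  have := @is_deriveZ _ _ _ _ (2 * pi) _ _ _ d3.
  rewrite add0r [_ *: 1]mulr1 => d4.
  by under eq_fun do rewrite (mulrC _ (k 0 i)%:~R).
have d5 := @is_derive1_comp _ (@cos R) (fun h => 2 * pi * (dotz k x + h * (k 0 i)%:~R)) 0 _ _
  (is_derive_cos _) d1.
have := @is_deriveZ _ _ _ _ c _ _ _ d5.
rewrite mul0r addr0 => -[_ Du].
rewrite [LHS]Du -[LHS]/(c * (- sin_mode k x * (2 * pi * (k 0 i)%:~R))); ring.
Qed.

Let f_grad : (grad_Linfty f <= 1)%E.
Proof.
apply/ess_supP; apply: aeW => p; rewrite /grad_norm; case: ifPn => [_|/asboolP[]]; last exact: f_diff.
set x := torus_repr p.
have -> : enorm (\row_i 'D_(delta_mx 0 i) (lift f) x) = c * (2 * pi) * `|sin_mode k x| * nk.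
  rewrite /enorm /nk /enorm.
  under eq_bigr => i _ do rewrite mxE f_deriv exprMn sqrrN.
  rewrite -mulr_sumr sqrtrM ?sqr_ge0// sqrtr_sqr normrM ger0_norm ?mulr_ge0 ?pi_ge0 ?(ltW c0)//.
  by congr (_ * Num.sqrt _); apply: eq_bigr => i _; rewrite mxE.
have -> : c * (2 * pi) * `|sin_mode k x| * nk = `|sin_mode k x|.
  have p0 : pi != 0 :> R by rewrite gt_eqF ?pi_gt0.
  have n0 : nk != 0 by rewrite gt_eqF.
  by rewrite /c; move: (pi : R) p0 nk n0 `|_| => P P0 N N0 z; field; rewrite N0 P0.
by rewrite lee_fin sin_max.
Qed.

(** The character of index [k], scaled to gradient norm at most one, has
    Lebesgue mean zero. *)
Lemma wasserstein_ge (mu : probability (torus R n) R) : \int[mu]_p torus_cos k p = 1 ->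
  (((2 * pi * nk)^-1)%:E <= wasserstein1 mu (lebesgue_torus R n))%E.
Proof.
move=> mu1; apply: ereal_sup_ubound; exists f.
  split => //; exists (c * (2 * pi * \sum_i `|k 0 i|%:~R)); split; first exact: num_real.
  move=> b cb [x y] _ /=; apply: (@le_trans _ _ (c * (2 * pi * \sum_i `|k 0 i|%:~R) * `|x - y|)).
    rewrite !fE -mulrBr normrM (gtr0_norm c0) -mulrA ler_wpM2l ?(ltW c0)//.
    by apply: le_trans (cos_mode_lip _ _) _; rewrite (mulrC `|x - y|) mulrA.
  by rewrite ler_wpM2r// ltW.
rewrite /f !RintegralZl ?integrable_torus_cos// lebesgue_torus_cos// mu1 mulr0 subr0 mulr1.
by rewrite gtr0_norm.
Qed.

End CharacterTest.

Section ClosedOrbit.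
Context {R : realType} {n : nat}.
Variable q : 'rV[int]_n.

Let qr : 'rV[R]_n := map_mx intr q.
Let orbit_map (s : measurableTypeR R) : torus R n := torus_proj (s *: qr).

Let measurable_orbit : measurable_fun setT orbit_map.
Proof.
apply: (@measurability _ _ _ _ _ _ (@torus_open R n)) => //.
move=> _ [U oU <-]; rewrite setTI.
have co : continuous (orbit_map : R -> torus R n).
  move=> s; apply: (@continuous_comp _ _ _ (fun s : R => s *: qr) (@torus_proj R n)).
    exact: scalel_continuous.
  exact: continuous_torus_proj.
by apply: open_measurable; have /continuousP := co; exact.
Qed.

HB.instance Definition _ := isMeasurableFun.Build _ _ _ _ orbit_map measurable_orbit.

Definition closed_orbit : probability (torus R n) R :=
  distribution (uniform_prob (@ltr01 R)) orbit_map.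

Let dotz_orbit (k : 'rV[int]_n) : dotz k qr = (\sum_i k 0 i * q 0 i)%:~R.
Proof.
by rewrite /dotz rmorph_sum; apply: eq_bigr => i _; rewrite mxE rmorphM.
Qed.

Let int_onecos (f : torus R n -> R) (j : int) (b : R) : j != 0 -> continuous f ->
  (forall s, f (orbit_map s) = cos (2 * pi * (j%:~R * s) + b)) ->
  \int[closed_orbit]_p f p = 0.
Proof.
move=> j0 cf fE; have [K fK] := torus_bounded cf.
rewrite (Rintegral_distribution _ _ (continuous_torus_measurable cf) fK).
under eq_Rintegral do rewrite fE.
have mc : measurable_fun setT (fun s : measurableTypeR R => cos (2 * pi * (j%:~R * s) + b)).
  apply: (measurableT_comp (f := @cos R)); first exact: continuous_measurable_fun (@continuous_cos R).
  by apply: measurable_funD => //; apply: measurable_funM => //; apply: measurable_funM.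
have ic := prob_integrable (uniform_prob (@ltr01 R)) mc (fun t => cos_max _).
have i1 : (uniform_prob (@ltr01 R)).-integrable setT (EFin \o (fun=> 1)).
  exact: finite_measure_integrable_cst.
have := integral_uniform_onecos b j0 => /(congr1 fine).
rewrite -[fine _]/(\int[uniform_prob (@ltr01 R)]_s (1 + cos (2 * pi * (j%:~R * s) + b))).
rewrite RintegralD// (prob_Rint_cst (uniform_prob (@ltr01 R))) /= => /eqP.
by rewrite -subr_eq0 addrAC subrr add0r => /eqP.
Qed.

(** On the curve, the character of index [k] has frequency [k . q]. *)
Lemma closed_orbit_coef (k : 'rV[int]_n) : dotz k qr != 0 ->
  \int[closed_orbit]_p torus_cos k p = 0 /\ \int[closed_orbit]_p torus_sin k p = 0.
Proof.
rewrite dotz_orbit intr_eq0 => j0; split.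
  apply: (int_onecos (b := 0) j0 (@continuous_torus_cos _ _ k)) => s.
  by rewrite /orbit_map torus_cosE /cos_mode dotzZr dotz_orbit addr0 (mulrC s).
apply: (int_onecos (b := - (pi / 2)) j0 (@continuous_torus_sin _ _ k)) => s.
by rewrite /orbit_map torus_sinE /sin_mode dotzZr dotz_orbit cosBpihalf (mulrC s).
Qed.

Lemma closed_orbit_torus_cos (k : 'rV[int]_n) : dotz k qr = 0 ->
  \int[closed_orbit]_p torus_cos k p = 1.
Proof.
move=> k0; rewrite (Rintegral_distribution _ _ (continuous_torus_measurable (@continuous_torus_cos R n k)) (fun p => cos_max _)).
rewrite -[RHS](prob_Rint_cst (uniform_prob (@ltr01 R))).
apply: eq_Rintegral => s _.
by rewrite /= /orbit_map torus_cosE /cos_mode dotzZr k0 !mulr0 cos0.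
Qed.

Lemma closed_orbit_invariant (tau : R) : flow_invariant (fun=> tau *: qr) closed_orbit.
Proof.
apply: resonant_flow_invariant => k; rewrite dotzZr.
have [->|kq] := eqVneq (dotz k qr) 0; first by left; rewrite mulr0.
by right; exact: closed_orbit_coef.
Qed.

End ClosedOrbit.

(** * Resonances and the lower bound *)

Section LowerBound.
Context {R : realType}.

Lemma powRN_le1 (x r : R) : 1 <= x -> 0 <= r -> x `^ (- r) <= 1.
Proof. by move=> x1 r0; have := ler_powR x1 (_ : - r <= 0); rewrite powRr0 oppr_le0; exact. Qed.

Lemma sum2E (F : 'I_2 -> R) : \sum_i F i = F ord0 + F ord_max.
Proof.
rewrite big_ord_recl big_ord1; congr (_ + F _); exact: val_inj.
Qed.

Definition perp (T : zmodType) (x : 'rV[T]_2) : 'rV[T]_2 :=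
  \row_i (if i == ord0 then - x 0 ord_max else x 0 ord0).

Lemma enorm_sqr n (x : 'rV[R]_n) : enorm x ^+ 2 = \sum_i x 0 i ^+ 2.
Proof. by rewrite /enorm sqr_sqrtr// sumr_ge0// => i _; rewrite sqr_ge0. Qed.

Lemma enorm_ge0 n (x : 'rV[R]_n) : 0 <= enorm x.
Proof. exact: sqrtr_ge0. Qed.

Local Notation kn k := (enorm (map_mx intr k : 'rV[R]_2)).

Lemma dotz_perp_sqr (k : 'rV[int]_2) (w : 'rV[R]_2) :
  dotz k w ^+ 2 + dotz k (perp w) ^+ 2 = kn k ^+ 2 * enorm w ^+ 2.
Proof. by rewrite !enorm_sqr /dotz !sum2E !mxE /=; ring. Qed.

(** The kernel of a nonzero linear form on the plane is a line. *)
Lemma orthogonal_perp (k : 'rV[int]_2) (w : 'rV[R]_2) : k != 0 -> dotz k w = 0 ->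
  w = (dotz k (- perp w) / kn k ^+ 2) *: map_mx intr (perp k).
Proof.
move=> k0 kw.
have n0 : kn k ^+ 2 != 0 by rewrite expf_neq0// gt_eqF// enorm_gt0.
have kwE : (k 0 ord0)%:~R * w 0 ord0 + (k 0 ord_max)%:~R * w 0 ord_max = 0 by rewrite -kw /dotz sum2E.
apply/rowP => i; rewrite !mxE; apply: (mulfI n0).
rewrite [RHS]mulrA [X in _ = X * _]mulrC divfK// enorm_sqr dotzNr /dotz !sum2E !mxE /=.
have [->|i0] := eqVneq i ord0.
  rewrite rmorphN /=.
  set a := (k 0 ord0)%:~R in kwE *; set b := (k 0 ord_max)%:~R in kwE *.
  have -> : (a ^+ 2 + b ^+ 2) * w 0 ord0 =
     a * (a * w 0 ord0 + b * w 0 ord_max) + b * (b * w 0 ord0 - a * w 0 ord_max) by ring.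
  by rewrite kwE mulr0 add0r; ring.
have -> : i = ord_max by apply: val_inj; case: i i0 => [[|[|]]].
set a := (k 0 ord0)%:~R in kwE *; set b := (k 0 ord_max)%:~R in kwE *.
have -> : (a ^+ 2 + b ^+ 2) * w 0 ord_max =
   b * (a * w 0 ord0 + b * w 0 ord_max) - a * (b * w 0 ord0 - a * w 0 ord_max) by ring.
by rewrite kwE mulr0 add0r; ring.
Qed.

Lemma enorm_ge1 n (k : 'rV[int]_n) : k != 0 -> 1 <= enorm (map_mx intr k : 'rV[R]_n).
Proof.
move=> k0; have [i ki] : exists i, k 0 i != 0.
  apply/existsP; apply: contraNT k0; rewrite negb_exists => /forallP h.
  by apply/eqP/rowP => i; rewrite mxE; have := h i; rewrite negbK => /eqP.
rewrite -(ler_sqr (x := 1)) ?nnegrE ?enorm_ge0// expr1n enorm_sqr (bigD1 i)//=.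
rewrite -[X in X <= _]addr0; apply: lerD; last by apply: sumr_ge0 => j _; rewrite sqr_ge0.
rewrite mxE -(real_normK (num_real (k 0 i)%:~R)) -intr_norm -[X in X <= _](expr1n _ 2).
by rewrite ler_sqr ?nnegrE ?ler0z// -[X in X <= _]/(1%:~R) ler_int -gtz0_ge1 normr_gt0.
Qed.

(** For a resonance [k], the constant field [w + delta *: e] with [delta = - (k
    . w) / (k . e)] is orthogonal to [k], so its orbits are closed and the
    uniform measure on one of them is invariant; the character of index [k]
    equals [1] on it. The sign of [e = eps *: perp w] is chosen so that [delta >
    0] for infinitely many [k], and one has [delta <= 8 |k|^(-1-r)] because [|k
    . perp w|] is comparable with [|k| |w|]. *)
Lemma lower_rate_of_resonances (w : 'rV[R]_2) (r : R) : 1 <= r -> 0 < enorm w ->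
  (forall k : 'rV[int]_2, k != 0 -> dotz k w != 0) ->
  (forall N : R, exists k : 'rV[int]_2, [/\ k != 0, N <= kn k &
     `|dotz k w| <= 4 * enorm w * kn k `^ (- r)]) ->
  lower_rate w (16 * pi)^-1 (1 / (1 + r)).
Proof.
move=> r1 w0 irr res.
have p0 := @pi_gt0 R.
pose good (eps N : R) (k : 'rV[int]_2) := [/\ k != 0, N <= kn k,
  `|dotz k w| <= 4 * enorm w * kn k `^ (- r) & dotz k w * (eps * dotz k (perp w)) < 0].
have r0 : 0 < r by apply: lt_le_trans r1.
have perp_big k : k != 0 -> 8 <= kn k -> `|dotz k w| <= 4 * enorm w * kn k `^ (- r) ->
    kn k * enorm w / 2 <= `|dotz k (perp w)|.
  move=> k0 k8 kw; have kp := enorm_gt0 (R := R) k0.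
  (* [8 <= |k|] makes [k . w] at most half of [|k| |w|] *)
  have small : `|dotz k w| <= kn k * enorm w / 2.
    apply: le_trans kw _; apply: (@le_trans _ _ (4 * enorm w * 1)).
      by rewrite ler_wpM2l ?mulr_ge0 ?enorm_ge0// powRN_le1 ?enorm_ge1 ?ltW.
    by nra.
  rewrite -ler_sqr ?nnegrE ?mulr_ge0 ?enorm_ge0// real_normK ?num_real//.
  have := dotz_perp_sqr k w; rewrite -(real_normK (num_real (dotz k w))) => e.
  have : `|dotz k w| ^+ 2 <= (kn k * enorm w / 2) ^+ 2.
    by rewrite ler_sqr ?nnegrE// ?mulr_ge0 ?enorm_ge0.
  have : 0 <= (kn k * enorm w) ^+ 2 by rewrite sqr_ge0.
  have e1 : kn k ^+ 2 * enorm w ^+ 2 = (kn k * enorm w) ^+ 2 by rewrite exprMn.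
  rewrite e1 in e; rewrite !expr_div_n; lra.
have [eps [eps1 epsP]] : exists eps : R, `|eps| = 1 /\ forall N, exists k, good eps N k.
  have [h|/existsNP[N0 h]] := pselect (forall N, exists k, good 1 N k).
    by exists 1; rewrite normr1.
  exists (-1); split; first by rewrite normrN1.
  move=> N; have [k [k0 kN kw]] := res (Num.max 8 (Num.max N N0)).
  move: kN; rewrite !ge_max => /and3P[k8 kN kN0].
  exists k; split => //; rewrite mulN1r mulrN oppr_lt0.
  have := perp_big k k0 k8 kw => kb.
  have kp : 0 < `|dotz k (perp w)|.
    by apply: lt_le_trans kb; rewrite divr_gt0// mulr_gt0// enorm_gt0.
  have pw0 : dotz k (perp w) != 0 by rewrite -normr_gt0.
  rewrite lt_neqAle eq_sym mulf_neq0 ?irr//= leNgt; apply/negP => neg; apply: h.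
  by exists k; split => //; rewrite mul1r.
have /boolp.choice[K KP] : forall j : nat, exists k, good eps (8 + j%:R) k by move=> j; exact: epsP.
pose e := eps *: perp w.
pose delta j := - dotz (K j) w / dotz (K j) e.
have dK j : 0 < delta j /\ delta j <= 8 * kn (K j) `^ (- (1 + r)).
  have [k0 kN kw neg] := KP j.
  have kp := enorm_gt0 (R := R) k0.
  have k8 : 8 <= kn (K j) by apply: le_trans kN; rewrite lerDl.
  have kb := perp_big _ k0 k8 kw.
  have eE : dotz (K j) e = eps * dotz (K j) (perp w) by rewrite /e dotzZr.
  have dpos : 0 < delta j.
    rewrite /delta eE mulNr oppr_gt0.
    have q0 : eps * dotz (K j) (perp w) != 0.
      by apply: contraTneq neg => ->; rewrite mulr0 ltxx.
    have -> : dotz (K j) w / (eps * dotz (K j) (perp w)) =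
       dotz (K j) w * (eps * dotz (K j) (perp w)) / (eps * dotz (K j) (perp w)) ^+ 2.
      by move: (eps * _) q0 => x x0; field.
    by rewrite pmulr_llt0// invr_gt0 exprn_even_gt0.
  split => //; rewrite -(gtr0_norm dpos) /delta normrM normrN normfV eE normrM eps1 mul1r.
  have nb : 0 < kn (K j) * enorm w / 2 by rewrite divr_gt0// mulr_gt0.
  rewrite ler_pdivrMr; last exact: lt_le_trans kb.
  apply: le_trans kw _.
  apply: (@le_trans _ _ (8 * kn (K j) `^ (- (1 + r)) * (kn (K j) * enorm w / 2))); last first.
    by rewrite ler_wpM2l// mulr_ge0 ?powR_ge0.
  rewrite opprD powRD; last by rewrite (gt_eqF kp) implybT.
  rewrite powR_inv1 ?(ltW kp)// le_eqVlt; apply/orP; left; apply/eqP; field.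
  by rewrite gt_eqF.
have dle j : delta j <= 8 / kn (K j).
  have [k0 kN _ _] := KP j; have [_ dj] := dK j; apply: le_trans dj _.
  rewrite ler_wpM2l// opprD powRD; last by rewrite (gt_eqF (enorm_gt0 k0)) implybT.
  rewrite powR_inv1 ?enorm_ge0// ler_piMr ?invr_ge0 ?enorm_ge0//.
  by rewrite powRN_le1 ?enorm_ge1 ?ltW.
exists (fun _ d => w + d *: e), delta, (fun j => closed_orbit (perp (K j))); split.
- exists `|e|; split; first exact: num_real.
  move=> b eb [z z'] _ /=; rewrite /lift_field /=.
  rewrite opprD addrACA subrr add0r -scalerBl normrZ mulrC.
  apply: ler_pM => //; first exact: ltW.
  by rewrite [leRHS]prod_normE le_max lexx orbT.
- by move=> x; rewrite scale0r addr0.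
- split.
    move=> j; have [d0 _] := dK j; rewrite d0 /=; apply: le_trans (dle j) _.
    have [k0 kN _ _] := KP j.
    rewrite ler_pdivrMr ?enorm_gt0// mul1r; apply: le_trans kN; by rewrite lerDl.
  apply/cvgrPdist_le => x x0.
  near=> j; rewrite sub0r normrN gtr0_norm; last by have [] := dK j.
  apply: le_trans (dle j) _; have [k0 kN _ _] := KP j.
  rewrite ler_pdivrMr ?enorm_gt0// mulrC -ler_pdivrMr//; apply: le_trans kN.
  apply: (@le_trans _ _ j%:R); last by rewrite lerDr.
  by apply: ltW; near: j; exact: nbhs_infty_gtr.
- move=> j; have [k0 _ _ neg] := KP j.
  have e0 : dotz (K j) e != 0.
    by rewrite /e dotzZr; apply: contraTneq neg => ->; rewrite mulr0 ltxx.
  have kw : dotz (K j) (w + delta j *: e) = 0.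
    by rewrite dotzDr dotzZr /delta divfK// subrr.
  rewrite (_ : (fun x => _) = (fun=> w + delta j *: e))//.
  by rewrite (orthogonal_perp k0 kw); exact: closed_orbit_invariant.
- move=> j; have [k0 kN _ _] := KP j; have [d0 dj] := dK j.
  have kp := enorm_gt0 (R := R) k0.
  have kperp : dotz (K j) (map_mx intr (perp (K j)) : 'rV[R]_2) = 0.
    by rewrite /dotz sum2E !mxE /= rmorphN /=; ring.
  apply: le_trans (wasserstein_ge k0 (closed_orbit_torus_cos kperp)); rewrite lee_fin.
  have r1' : 0 < 1 + r by rewrite addr_gt0.
  have a0 : 0 <= 1 / (1 + r) by rewrite divr_ge0// ltW.
  have h : delta j `^ (1 / (1 + r)) <= 8 / kn (K j).
    apply: (@le_trans _ _ ((8 * kn (K j) `^ (- (1 + r))) `^ (1 / (1 + r)))).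
      by apply: ge0_ler_powR; rewrite ?nnegrE ?(ltW d0)// mulr_ge0 ?powR_ge0.
    rewrite powRM ?powR_ge0// -powRrM.
    have -> : - (1 + r) * (1 / (1 + r)) = -1 by field; rewrite gt_eqF.
    rewrite powR_inv1 ?(ltW kp)// ler_wpM2r ?invr_ge0 ?(ltW kp)//.
    by apply: ler1_powR; [rewrite ler1n | rewrite ler_pdivrMr// mul1r lerDl ltW].
  apply: (@le_trans _ _ ((16 * pi)^-1 * (8 / kn (K j)))).
    by rewrite ler_wpM2l// invr_ge0 mulr_ge0// ltW.
  rewrite le_eqVlt; apply/orP; left; apply/eqP.
  have p0' : pi != 0 :> R by rewrite gt_eqF.
  have n0' : kn (K j) != 0 by rewrite gt_eqF.
  by move: (pi : R) p0' (kn (K j)) n0' => P P0 N N0; field; rewrite N0 P0.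
Unshelve. all: by end_near. Qed.

End LowerBound.

(** * Existence of resonances *)

Section Resonances.
Context {R : realType}.
Local Notation kn k := (enorm (map_mx intr k : 'rV[R]_2)).

Lemma diophantine_neq0 n (sigma c : R) (w : 'rV[R]_n) : 0 < c -> diophantine sigma c w ->
  forall k, k != 0 -> dotz k w != 0.
Proof.
move=> c0 dw k k0; rewrite -normr_gt0; apply: lt_le_trans (dw k k0).
by rewrite mulr_gt0// powR_gt0// enorm_gt0.
Qed.

(** Small divisors of a Diophantine vector occur only at high frequencies. *)
Lemma diophantine_large n (sigma c N : R) (w : 'rV[R]_n) (k : 'rV[int]_n) :
  0 < sigma -> 0 < c -> diophantine sigma c w -> 0 < N -> k != 0 ->
  `|dotz k w| < c * N `^ (- sigma) -> N <= enorm (map_mx intr k : 'rV[R]_n).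
Proof.
move=> s0 c0 dw N0 k0; rewrite leNgt; apply: contraTN => kN; rewrite -leNgt.
apply: le_trans (dw k k0); rewrite ler_wpM2l ?(ltW c0)// !powRN.
have k1 := enorm_gt0 (R := R) k0.
rewrite lef_pV2 ?posrE ?powR_gt0//.
by apply: ge0_ler_powR; rewrite ?nnegrE ?(ltW s0) ?(ltW k1) ?(ltW N0) ?(ltW kN).
Qed.

Lemma diophantine_enorm_gt0 (sigma c : R) (w : 'rV[R]_2) : 0 < c -> diophantine sigma c w ->
  0 < enorm w.
Proof.
move=> c0 dw; rewrite lt_neqAle enorm_ge0 andbT eq_sym; apply/negP => /eqP w0.
have wi i : w 0 i = 0.
  have : \sum_i w 0 i ^+ 2 == 0 by rewrite -enorm_sqr w0 expr0n.
  rewrite psumr_eq0 => [/allP/(_ i (mem_index_enum i))/=|j _]; last by rewrite sqr_ge0.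
  by rewrite sqrf_eq0 => /eqP.
have kn0 : (delta_mx 0 ord0 : 'rV[int]_2) != 0.
  by apply/eqP => /rowP/(_ ord0); rewrite !mxE !eqxx.
have /eqP := diophantine_neq0 c0 dw kn0; apply.
by rewrite /dotz big1// => i _; rewrite wi mulr0.
Qed.

(** Below the critical exponent the Diophantine condition fails for every
    constant, and a small constant forces [k] to be large. *)
Lemma sigma_star_resonances (sigma c r : R) (w : 'rV[R]_2) :
  0 < sigma -> 0 < c -> diophantine sigma c w -> 0 < enorm w -> 0 < r -> r < sigma_star w ->
  forall N : R, exists k : 'rV[int]_2, [/\ k != 0, N <= kn k &
     `|dotz k w| <= 4 * enorm w * kn k `^ (- r)].
Proof.
move=> s0 c0 dw w0 r0 rs N.
pose N' := Num.max N 1.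
have N'0 : 0 < N' by rewrite /N' lt_max ltr01 orbT.
(* the second term forces [N <= |k|] *)
pose c' := Num.min (4 * enorm w) (c * N' `^ (- sigma)).
have c'0 : 0 < c' by rewrite /c' lt_min !mulr_gt0// powR_gt0.
have : ~ diophantine r c' w.
  move=> dr; move: rs; apply/negP; rewrite -leNgt; apply: ge_inf; last by split => //; exists c'.
  by exists 0 => x [/ltW].
move=> /existsNP[k /not_implyP[k0 /negP]]; rewrite -ltNge => hk.
exists k; split => //.
  apply: le_trans (_ : N' <= _); first by rewrite /N' le_max lexx.
  apply: (diophantine_large s0 c0 dw N'0 k0); apply: lt_le_trans hk _.
  apply: (@le_trans _ _ (c' * 1)).
    by rewrite ler_wpM2l ?(ltW c'0)// powRN_le1 ?enorm_ge1 ?ltW.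
  by rewrite mulr1 /c' ge_min lexx orbT.
apply: le_trans (ltW hk) _; rewrite ler_wpM2r ?powR_ge0//.
by rewrite /c' ge_min lexx.
Qed.

(** Pigeonhole: the [(Q + 1)^2] numbers [a w_0 + b w_1] with [0 <= a, b <= Q] lie in
    an interval of length [Q S], so two of them differ by less than [S / Q]. *)
Lemma dirichlet2 (w : 'rV[R]_2) (Q : nat) : (0 < Q)%N -> 0 < enorm w ->
  exists k : 'rV[int]_2, [/\ k != 0, kn k <= 2 * Q%:R & `|dotz k w| <= 2 * enorm w / Q%:R].
Proof.
move=> Q0 w0; set w1 := w 0 ord0; set w2 := w 0 ord_max.
pose S := `|w1| + `|w2|.
have QR : 0 < Q%:R :> R by rewrite ltr0n.
have ew : enorm w ^+ 2 = w1 ^+ 2 + w2 ^+ 2 by rewrite enorm_sqr sum2E.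
have wE (x : R) : x ^+ 2 <= enorm w ^+ 2 -> `|x| <= enorm w.
  by rewrite -(real_normK (num_real x)) ler_sqr ?nnegrE ?enorm_ge0.
have S2 : S <= 2 * enorm w.
  have h1 : `|w1| <= enorm w by apply: wE; rewrite ew lerDl sqr_ge0.
  have h2 : `|w2| <= enorm w by apply: wE; rewrite ew lerDr sqr_ge0.
  by rewrite /S; lra.
have S0 : 0 < S.
  rewrite lt_neqAle addr_ge0// andbT eq_sym paddr_eq0// !normr_eq0.
  apply: contraTN w0 => /andP[/eqP a0 /eqP b0].
  have /eqP : enorm w ^+ 2 = 0 by rewrite ew a0 b0 !expr0n addr0.
  by rewrite sqrf_eq0 => /eqP ->; rewrite ltxx.
pose m := Q%:R * (Num.min w1 0 + Num.min w2 0).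
pose v (l : 'I_Q.+1 * 'I_Q.+1) := l.1%:R * w1 + l.2%:R * w2 - m.
have vrange l : 0 <= v l <= Q%:R * S.
  have one (x : R) (i : 'I_Q.+1) : 0 <= i%:R * x - Q%:R * Num.min x 0 <= Q%:R * `|x|.
    have iQ : i%:R <= Q%:R :> R by rewrite ler_nat -ltnS.
    have i0 : 0 <= i%:R :> R by [].
    case: (leP 0 x) => x0; first by rewrite ger0_norm//; nra.
    by rewrite ltr0_norm//; nra.
  have := one w1 l.1; have := one w2 l.2; rewrite /v /m /S !mulrDr.
  set A := Q%:R * Num.min w1 0; set B := Q%:R * Num.min w2 0.
  by move=> /andP[a1 a2] /andP[b1 b2]; apply/andP; split; lra.
pose s := S / Q%:R.
have s0 : 0 < s by rewrite divr_gt0.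
pose z (l : 'I_Q.+1 * 'I_Q.+1) : 'I_(Q ^ 2).+1 := inord (Num.truncn (v l / s)).
have zP l : (z l)%:R * s <= v l < (z l).+1%:R * s.
  have /andP[v0 v1] := vrange l.
  have h0 : 0 <= v l / s by rewrite divr_ge0// ltW.
  have := truncn_itv h0; rewrite ler_pdivlMr// ltr_pdivrMr//.
  rewrite /z inordK// ltnS -(ler_nat R); have /andP[h1 _] := truncn_itv h0.
  apply: le_trans h1 _; rewrite ler_pdivrMr// natrX /s expr2 -mulrA.
  by rewrite (mulrCA _ S) divff ?gt_eqF// mulr1.
have /injectivePn[l [l' ll' zl]] : ~~ injectiveb z.
  apply/negP => /injectiveP/leq_card; rewrite card_prod !card_ord; lia.
have vd : `|v l - v l'| <= s.
  have := zP l; have := zP l'; rewrite zl -natr1 mulrDl mul1r => /andP[h1 h2] /andP[h3 h4].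
  by rewrite ler_norml; apply/andP; split; lra.
pose k : 'rV[int]_2 := \row_i (if i == ord0 then l.1%:Z - l'.1%:Z else l.2%:Z - l'.2%:Z).
exists k; split.
- apply: contra_neq ll' => /rowP e; have := e ord0; have := e ord_max; rewrite !mxE /=.
  case: l l' {vd zl k e} => [a b] [a' b'] /= e1 e2.
  by congr (_, _); apply: val_inj => /=; lia.
- rewrite -ler_sqr ?nnegrE ?enorm_ge0 ?mulr_ge0// enorm_sqr sum2E !mxE /=.
  have b (x y : 'I_Q.+1) : (x%:Z - y%:Z)%:~R ^+ 2 <= Q%:R ^+ 2 :> R.
    rewrite -(real_normK (num_real _)) ler_sqr ?nnegrE// -intr_norm -abszE -pmulrn ler_nat.
    by have := ltn_ord x; have := ltn_ord y; lia.
  have := b l.1 l'.1; have := b l.2 l'.2; rewrite exprMn.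
  have : 0 <= Q%:R ^+ 2 :> R by rewrite sqr_ge0.
  lra.
- have -> : dotz k w = v l - v l'.
    by rewrite /dotz sum2E !mxE /= /v !rmorphB /= -!pmulrn -/w1 -/w2; ring.
  apply: le_trans vd _; by rewrite /s ler_wpM2r// invr_ge0 ltW.
Qed.

(** Dirichlet's bound gives the exponent [1] for every vector, and arbitrarily
    large [k] by [diophantine_large]. *)
Lemma dirichlet_resonances (sigma c : R) (w : 'rV[R]_2) :
  0 < sigma -> 0 < c -> diophantine sigma c w -> 0 < enorm w ->
  forall N : R, exists k : 'rV[int]_2, [/\ k != 0, N <= kn k &
     `|dotz k w| <= 4 * enorm w * kn k `^ (- 1)].
Proof.
move=> s0 c0 dw w0 N; pose N' := Num.max N 1.
have N'0 : 0 < N' by rewrite /N' lt_max ltr01 orbT.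
have b0 : 0 < c * N' `^ (- sigma) by rewrite mulr_gt0// powR_gt0.
pose Q := (Num.truncn (2 * enorm w / (c * N' `^ (- sigma)))).+1.
have [k [k0 kQ kw]] := dirichlet2 (isT : (0 < Q)%N) w0.
have QR : 0 < Q%:R :> R by [].
have kp := enorm_gt0 (R := R) k0.
exists k; split => //.
  apply: le_trans (_ : N' <= _); first by rewrite /N' le_max lexx.
  apply: (diophantine_large s0 c0 dw N'0 k0); apply: le_lt_trans kw _.
  rewrite ltr_pdivrMr// [ltRHS]mulrC -ltr_pdivrMr//; exact: truncnS_gt.
apply: le_trans kw _; rewrite powR_inv1 ?(ltW kp)// ler_pdivrMr// mulrAC ler_pdivlMr//.
by have := ler_wpM2l (ltW w0) kQ; lra.
Qed.

End Resonances.

(** * The theorem *)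

Unset Implicit Arguments.

Theorem theorem1p5 (R : realType) :
  (forall (n : nat) (sigma Comega M : R),
     (2 <= n)%N -> 0 < sigma -> 0 < Comega ->
     exists2 C : R, 0 < C &
       forall (omega : 'rV[R]_n) (V : torus R n -> R -> 'rV[R]_n),
         diophantine sigma Comega omega ->
         lipschitz_field V ->
         (forall x, V x 0 = omega) ->
         W1infty_norm V = M%:E ->
         [/\ unique_flow_invariant (fun x => V x 0) (lebesgue_torus R n),
             1 < sigma ->
             forall (delta : R) (mu : probability (torus R n) R),
               0 < delta <= 1 ->
               flow_invariant (fun x => V x delta) mu ->
               (wasserstein1 mu (lebesgue_torus R n)
                <= (C * delta `^ (1 / (1 + sigma)))%:E)%E &
             sigma = 1 ->
             forall (delta : R) (mu : probability (torus R n) R),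
               0 < delta <= 1 / 2 ->
               flow_invariant (fun x => V x delta) mu ->
               (wasserstein1 mu (lebesgue_torus R n)
                <= (C * (delta `^ (1 / 2) * `|ln delta|))%:E)%E])
  /\
  (forall sigma Comega : R, 0 < sigma -> 0 < Comega ->
     exists2 C' : R, 0 < C' &
       forall omega : 'rV[R]_2, diophantine sigma Comega omega ->
         (forall r : R, 1 < r -> r < sigma_star omega ->
            lower_rate omega C' (1 / (1 + r)))
         /\
         (sigma_star omega = 1 -> lower_rate omega C' (1 / 2))).
Proof.
split=> [n sigma c M n2 s0 c0|sigma c s0 c0].
  pose K : R := 10 * n%:R + 2 * n%:R * `|M| / c * (Num.sqrt n%:R * 3) `^ sigma.
  have K0 : 0 < K.
    rewrite ltr_pwDl//; first by rewrite mulr_gt0// ltr0n (leq_trans _ n2).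
    by rewrite mulr_ge0 ?powR_ge0// mulr_ge0 ?invr_ge0 ?(ltW c0)// mulr_ge0.
  have l2 : 0 < ln 2 :> R by rewrite ln_gt0// ltr1n.
  exists (K * (1 + (ln 2)^-1)).
    by rewrite mulr_gt0// addr_gt0// invr_gt0.
  move=> omega V dw VL V0 VM.
  have n0 : (0 < n)%N by rewrite (leq_trans _ n2).
  split.
  - exact: (diophantine_unique c0 dw V0).
  - move=> s1 delta mu dd inv.
    apply: le_trans (upper_rate n0 s0 c0 dw VL V0 VM dd inv) _.
    rewrite lee_fin -/K ler_wpM2r ?powR_ge0// ler_peMr ?(ltW K0)//.
    by rewrite lerDl invr_ge0 ltW.
  - move=> s1 delta mu /andP[d0 d1] inv.
    have dd : 0 < delta <= 1 by rewrite d0 (le_trans d1)// ler_pdivrMr// mul1r ler1n.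
    apply: le_trans (upper_rate n0 s0 c0 dw VL V0 VM dd inv) _.
    rewrite lee_fin -/K s1 -mulrA ler_wpM2l ?(ltW K0)// mulrCA ler_peMr ?powR_ge0//.
    have h : ln 2 <= `|ln delta| by apply: ln_half_le; rewrite d0 d1.
    rewrite mulrDl mul1r; apply: (@le_trans _ _ ((ln 2)^-1 * `|ln delta|)); last by rewrite lerDr.
    by rewrite ler_pdivlMl// mulr1.
exists (16 * pi)^-1; first by rewrite invr_gt0 mulr_gt0 ?pi_gt0.
move=> omega dw; have w0 := diophantine_enorm_gt0 c0 dw.
split=> [r r1 rs|_].
  apply: lower_rate_of_resonances => //; first exact: ltW.
    exact: diophantine_neq0 c0 dw.
  by apply: (sigma_star_resonances s0 c0 dw w0) => //; apply: lt_trans r1.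
have -> : 1 / 2 = 1 / (1 + 1) :> R by [].
apply: lower_rate_of_resonances => //; first exact: diophantine_neq0 c0 dw.
exact: (dirichlet_resonances s0 c0 dw w0).
Qed.
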